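(* The rotational symmetry group $W\subset O(3)$ of the cube centered at the origin, in its standard action on $\mathbb{R}^3$, has property $(\mathcal{B}_9)$.
   Context: For an orthogonal representation $G\to O(V)$ of a finite group, let $\sigma_1,\ldots,\sigma_m$ be homogeneous generators of positive degree of the algebra $\mathbb{R}[V]^G$ of invariant polynomials and $\sigma=(\sigma_1,\ldots,\sigma_m):V\to\mathbb{R}^m$ the orbit map; $V/G$ is identified with $\sigma(V)\subseteq\mathbb{R}^m$ via the homeomorphism induced by $\sigma$. A curve in $V/G$ is of class $C^k$ if it is $C^k$ as a curve in $\mathbb{R}^m$ (independent of the choice of generators). A lift of a curve $c$ in $\sigma(V)$ is a curve $\bar c$ in $V$ with $\sigma\circ\bar c=c$; a local lift near $t_0$ is a lift of the restriction of $c$ to an open neighborhood of $t_0$. A differentiable lift has locally bounded derivative if $\|\bar c'\|$ is bounded on compact subsets of its domain. The representation has property $(\mathcal{B}_k)$ if there exists a neighborhood $U$ of $0$ in $V/G=\sigma(V)$ such that each $C^k$-curve in $U$ admits (near each parameter value) a local differentiable lift to $V$ with locally bounded derivative. *)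

(* Defs.v *)
From mathcomp Require Import all_boot all_order all_algebra.
From mathcomp Require Import all_classical all_reals all_analysis.
(* The notations of mpoly clash with those of the analysis library. *)
From mathcomp Require Import (canonicals, coercions) mpoly.

Set Implicit Arguments.
Unset Strict Implicit.
Unset Printing Implicit Defensive.

Import Order.TTheory GRing.Theory Num.Theory.
Import numFieldNormedType.Exports.
Local Open Scope classical_set_scope.
Local Open Scope ring_scope.

Local Notation mpoly n R := (mpoly.mpoly n R).

Section Curves.
Variables (R : realType) (V : normedModType R).

(* Curves are total functions whose values off their domain are irrelevant;
   as the domain I is open, the iterated derivatives at the points of I only
   depend on the restriction to I. *)
Definition Ck_on (k : nat) (I : set R) (c : R -> V) : Prop :=
  (forall j t, (j < k)%N -> I t -> derivable (derive1n j c) t 1) /\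
  (forall j t, (j <= k)%N -> I t -> {for t, continuous (derive1n j c)}).

(* The norm on a space of matrices is the sup norm; this boundedness condition
   does not depend on the choice of a norm in finite dimension. *)
Definition differentiable_locally_bounded (J : set R) (c : R -> V) : Prop :=
  (forall t, J t -> derivable c t 1) /\
  (forall K : set R, compact K -> K `<=` J ->
     exists M : R, forall t, K t -> `|derive1 c t| <= M).

End Curves.

Section Invariants.
Variables (R : realType) (n : nat).
Implicit Types (G : set 'M[R]_n) (v : 'cV[R]_n).

Definition finite_orthogonal_group G : Prop :=
  [/\ finite_set G,
      forall A, G A -> A *m A^T = 1%:M,
      G 1%:M,
      forall A B, G A -> G B -> G (A *m B) &
      forall A, G A -> G (invmx A)].

Definition peval (p : mpoly n R) v : R := mpoly.meval (fun i => v i ord0) p.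

(* R[V]^G, for V = R^n; polynomials over the infinite field R are identified
   with polynomial functions. *)
Definition invariant_poly G (p : mpoly n R) : Prop :=
  forall A v, G A -> peval p (A *m v) = peval p v.

Definition homogeneous_generators G (m : nat) (s : m.-tuple (mpoly n R)) :
    Prop :=
  [/\ forall i, invariant_poly G (tnth s i),
      forall i, exists2 d : nat,
        (0 < d)%N & tnth s i \is mpoly.ishomog1 d mpoly.mdeg &
      forall p, invariant_poly G p ->
        exists q : mpoly m R, p = mpoly.comp_mpoly s q].

Definition orbit_map (m : nat) (s : m.-tuple (mpoly n R)) v : 'cV[R]_m :=
  \col_i peval (tnth s i) v.

Definition local_lift (m : nat) (s : m.-tuple (mpoly n R)) (I : set R)
    (c : R -> 'cV[R]_m) (t0 : R) (J : set R) (cbar : R -> 'cV[R]_n) : Prop :=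
  [/\ open J, J t0, J `<=` I & forall t, J t -> orbit_map s (cbar t) = c t].

(* Property (B_k) of the standard representation on R^n of a group G such that
   [finite_orthogonal_group G] (see [cube_rotations_group] below). It does not
   depend on the homogeneous generators, of which a finite system exists by
   Hilbert's theorem; it is required for all of them. V/G is the range of the
   orbit map with the subspace topology, and 0 is the image of 0. *)
Definition property_B (k : nat) G : Prop :=
  forall (m : nat) (s : m.-tuple (mpoly n R)),
    homogeneous_generators G s ->
    exists U : set 'cV[R]_m,
      [/\ U `<=` range (orbit_map s),
          within (range (orbit_map s)) (nbhs (0 : 'cV[R]_m)) U &
          forall (I : set R) (c : R -> 'cV[R]_m),
            open I -> is_interval I -> Ck_on k I c ->
            (forall t, I t -> U (c t)) ->
            forall t0, I t0 ->
              exists (J : set R) (cbar : R -> 'cV[R]_n),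
                local_lift s I c t0 J cbar /\
                differentiable_locally_bounded J cbar].

End Invariants.

Section Cube.
Variable R : realType.

Definition cube : set 'cV[R]_3 := [set v | forall i, `|v i ord0| <= 1].

Definition cube_rotations : set 'M[R]_3 :=
  [set A | [/\ A *m A^T = 1%:M, \det A = 1 & mulmx A @` cube = cube]].

End Cube.
Arguments cube_rotations R : clear implicits.

Section CubeFinite.
Variable R : realType.
Let W := cube_rotations R.

Lemma cube_rotations_entries (A : 'M[R]_3) : W A ->
  forall i j, A i j \in [:: 0; 1; -1].
Proof.
move=> [AAT _ AC] i j.
have l1 : \sum_k `|A i k| <= 1.
  pose v : 'cV[R]_3 := \col_k Num.sg (A i k).
  have Cv : cube v.
    by move=> k; rewrite mxE normr_sg; case: (_ != 0); rewrite ?ler01 ?lexx.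
  have : cube (A *m v) by rewrite -AC; exists v.
  move=> /(_ i); rewrite mxE; apply: le_trans.
  rewrite (le_trans _ (ler_norm _))// ler_sum// => k _.
  by rewrite mxE mulrC -normrEsg.
have l2 : \sum_k `|A i k| ^+ 2 = 1.
  have := congr1 (fun M : 'M[R]_3 => M i i) AAT; rewrite !mxE eqxx mulr1n => <-.
  by apply: eq_bigr => k _; rewrite mxE -normrX ger0_norm ?sqr_ge0// expr2.
have le1 k : `|A i k| <= 1.
  by apply: le_trans l1; rewrite (bigD1 k)//= lerDl sumr_ge0.
have eq0 k : `|A i k| - `|A i k| ^+ 2 = 0.
  have ge0 l : 0 <= `|A i l| - `|A i l| ^+ 2.
    by rewrite subr_ge0 expr2 ler_piMl.
  have : \sum_l (`|A i l| - `|A i l| ^+ 2) <= 0.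
    by rewrite sumrB l2 subr_le0.
  rewrite (bigD1 k)//= => s0; apply/eqP; rewrite eq_le ge0 andbT.
  by apply: le_trans s0; rewrite lerDl sumr_ge0.
have /eqP := eq0 j; rewrite expr2 -{1}[`|A i j|]mulr1 -mulrBr mulf_eq0.
rewrite normr_eq0 subr_eq0 !inE => /orP[->//|].
by rewrite eq_sym eqr_norml ler01 andbT => ->; rewrite orbT.
Qed.

Lemma cube_rotations_group : finite_orthogonal_group W.
Proof.
have WV A : W A -> invmx A = A^T.
  move=> [AAT _ _]; have uA : A \in unitmx by case: (mulmx1_unit AAT).
  by rewrite -[RHS]mul1mx -(mulVmx uA) -mulmxA AAT mulmx1.
split.
- pose f (g : {ffun 'I_3 * 'I_3 -> 'I_3}) : 'M[R]_3 :=
    \matrix_(i, j) [:: 0; 1; -1]`_(g (i, j)).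
  apply: (@sub_finite_set _ _ (range f)); last exact/finite_image/finite_finset.
  move=> A /cube_rotations_entries eA.
  exists [ffun ij => inord (index (A ij.1 ij.2) [:: 0; 1; -1])] => //.
  apply/matrixP => i j; rewrite mxE ffunE/= inordK ?nth_index ?eA//.
  by have := eA i j; rewrite -index_mem.
- by move=> A [].
- split; rewrite ?trmx1 ?mulmx1 ?det1//.
  by rewrite (_ : mulmx _ = id) ?image_id//; apply/funext => v; rewrite mul1mx.
- move=> A B [AA dA AC] [BB dB BC]; split.
  + by rewrite trmx_mul mulmxA -(mulmxA A) BB mulmx1.
  + by rewrite det_mulmx dA dB mulr1.
  + rewrite -[RHS]AC -{2}BC image_comp.
    by congr (_ @` _); apply/funext => v /=; rewrite mulmxA.
- move=> A WA; have AV := WV _ WA; case: WA => [AA dA AC].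
  have ATA : A^T *m A = 1%:M by apply: mulmx1C.
  rewrite AV; split; rewrite ?trmxK ?det_tr//.
  rewrite -{1}AC image_comp (_ : _ \o _ = id) ?image_id//.
  by apply/funext => v /=; rewrite mulmxA ATA mul1mx.
Qed.

End CubeFinite.

(* Main.v *)
Require Import Defs.
From mathcomp Require Import all_boot all_order all_algebra.
From mathcomp Require Import all_classical all_reals all_analysis.
From mathcomp Require Import ring lra.
From mathcomp Require Import (canonicals, coercions) mpoly.

Set Implicit Arguments.
Unset Strict Implicit.
Unset Printing Implicit Defensive.

Import Order.TTheory GRing.Theory Num.Theory.
Import numFieldNormedType.Exports.
Local Open Scope classical_set_scope.
Local Open Scope ring_scope.

(** Let [c] be a curve of class C^9 in the orbit space of the rotation group [W]
    of the cube.  Its points have preimages [v t], chosen arbitrarily, and the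
    proof has two parts.

    The orbits of [v] have bounded derivatives.  The invariants [inv2], [inv4],
    [inv6], [inv9], of degrees 2, 4, 6 and 9, separate the orbits of [W]
    ([cube_separation]); along [v] they are polynomials in the components of
    [c], hence of class C^9.  By [cube_families], the orbit of
    [v (a + s)] is therefore that of [v a + s *: w], up to an error [o(s)], with
    a bound on [w] which is locally uniform in [a].  This holds for
    arbitrary families of curves whose invariants have Taylor expansions
    uniform in the family, and the generality is used to rescale curves: the
    invariants being homogeneous, it suffices to consider families starting on
    the unit sphere ([homogeneous_reduction]).  Indeed, a curve [u] starting at
    distance [r] from 0 can be replaced by [r^-1 *: u (r * s)], since Taylor
    expansions remain uniformly bounded as long as no degree exceeds the order
    of regularity, which is the reason for nine derivatives; and for a curve
    [u] starting at 0, the orbits of [s^-1 *: u s] converge.  A point of the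
    unit sphere is, up to rotation, close to an axis through the centre of a
    face, the midpoint of an edge or a vertex ([axis_regions]).  There, the
    factors of the invariants which do not vanish can be inverted, and what
    remains is the coordinate along the axis and the basic invariants of its
    stabilizer, cyclic of order 4, 2 or 3, in the orthogonal plane
    ([face_slice], [edge_slice], [vertex_slice]).  The homogeneous reduction in
    this plane leads to the unit circle, where the curve is regular because it
    is a fourth, square or cube root of a regular complex function without
    zeros.

    A curve of orbits with a derivative at every point has a differentiable
    selection ([differentiable_selection]).  This holds for all finite groups
    of isometries, by induction on their order: where the value and the
    derivative are not fixed by the whole group, the problem reduces locally to
    their common stabilizer, and the local solutions can be glued because two
    selections agree to first order up to a single element of the group; at the
    other points every selection is differentiable.  The derivative of a
    selection is the image of the orbit derivative under an element of the group
    ([selection_derivative]), hence it satisfies the same bound. *)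

(** * Uniform Taylor classes *)

Section TaylorClasses.
Variables (R : realType) (X : Type).
Implicit Types (F G : X -> R -> R) (c : X -> R).

Definition bnd (T : Type) (c : T -> R) := exists M : R, forall x, `|c x| <= M.

Definition unif (P : X -> R -> Prop) := \forall s \near (0 : R), forall x, P x s.

(** Families of functions with an expansion of order [k] at 0 which is uniform
    in the family: the coefficients are bounded, and the last one is attained
    with a uniform error.  The index set carries no structure, so that each
    member of a family can be rescaled by a factor of its own. *)
Fixpoint Tay (k : nat) F : Prop :=
  bnd (F^~ 0) /\
  match k with
  | 0%N => forall e : R, 0 < e -> unif (fun x s => `|F x s - F x 0| <= e)
  | j.+1 => exists2 F1, Tay j F1 & unif (fun x s => F x s = F x 0 + s * F1 x s)
  end.

Lemma unifW (P : X -> R -> Prop) : (forall x s, P x s) -> unif P.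
Proof. by move=> H; apply: (@filterE _ (nbhs (0 : R))) => s x; exact: H. Qed.

Lemma unif0 (P : X -> R -> Prop) : unif P -> forall x, P x 0.
Proof. by move=> /nbhs_singleton. Qed.

Lemma near_norm_le (e : R) : 0 < e -> \forall s \near (0 : R), `|s| <= e.
Proof.
by move=> e0; apply: filterS (nbhs0_lt e0) => s /ltW.
Qed.

Lemma bnd_pos c : bnd c -> exists2 M : R, 0 < M & forall x, `|c x| <= M.
Proof.
move=> [M cM]; exists (`|M| + 1); first by rewrite ltr_wpDl.
by move=> x; rewrite (le_trans (cM x))// (le_trans (ler_norm M))// lerDl.
Qed.

Lemma bndD c d : bnd c -> bnd d -> bnd (fun x => c x + d x).
Proof.
move=> [M cM] [N dN]; exists (M + N) => x.
by rewrite (le_trans (ler_normD _ _))// lerD.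
Qed.

Lemma bndM c d : bnd c -> bnd d -> bnd (fun x => c x * d x).
Proof.
move=> [M cM] [N dN]; exists (M * N) => x.
by rewrite normrM ler_pM.
Qed.

Lemma bnd_cst (a : R) : bnd (fun _ : X => a).
Proof. by exists `|a|. Qed.

Lemma Tay_bnd0 k F : Tay k F -> bnd (F^~ 0).
Proof. by case: k => [|k] []. Qed.

Lemma Tay0_bnd F : Tay 0 F -> exists M : R, unif (fun x s => `|F x s| <= M).
Proof.
move=> [[M FM] Fc]; exists (1 + M).
apply: filterS (Fc 1 ltr01) => s Fs x.
by rewrite -[F x s](subrK (F x 0)) (le_trans (ler_normD _ _))// lerD.
Qed.

Lemma Tay_eq k F G : unif (fun x s => F x s = G x s) -> Tay k F -> Tay k G.
Proof.
move=> FG; have FG0 := unif0 FG.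
have bFG : bnd (F^~ 0) -> bnd (G^~ 0).
  by move=> [M FM]; exists M => x; rewrite -FG0.
case: k => [|k] [bF TF]; split; do ?exact: bFG.
- move=> e /TF; apply: filterS2 FG => s Es Fs x.
  by rewrite -Es -FG0.
- case: TF => F1 TF1 F1E; exists F1 => //.
  by apply: filterS2 FG F1E => s Es Fs x; rewrite -Es -FG0.
Qed.

Lemma Tay_ext k F G : (forall x s, F x s = G x s) -> Tay k F -> Tay k G.
Proof. by move=> FG; apply: Tay_eq; apply: unifW. Qed.

Lemma Tay_cst k c : bnd c -> Tay k (fun x _ => c x).
Proof.
elim: k c => [|k IH] c bc; split => //.
  by move=> e e0; apply: unifW => x s; rewrite subrr normr0 ltW.
exists (fun _ _ => 0); first exact/IH/bnd_cst.
by apply: unifW => x s; rewrite mulr0 addr0.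
Qed.

Lemma Tay_num k (a : R) : Tay k (fun _ _ => a).
Proof. exact/Tay_cst/bnd_cst. Qed.

Lemma TayD k F G : Tay k F -> Tay k G -> Tay k (fun x s => F x s + G x s).
Proof.
elim: k F G => [|k IH] F G [bF TF] [bG TG]; split; do ?exact: bndD.
  move=> e e0; have e20 : 0 < e / 2 by rewrite divr_gt0.
  apply: filterS2 (TF _ e20) (TG _ e20) => s Fs Gs x.
  by rewrite opprD addrACA (splitr e) (le_trans (ler_normD _ _))// lerD.
have [F1 TF1 FE] := TF; have [G1 TG1 GE] := TG.
exists (fun x s => F1 x s + G1 x s); first exact: IH.
by apply: filterS2 FE GE => s FE GE x; rewrite FE GE; ring.
Qed.

Lemma TayS k F : Tay k.+1 F -> Tay k F.
Proof.
elim: k F => [|k IH] F [bF [F1 TF1 FE]]; split=> //; last first.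
  by exists F1 => //; exact: IH.
have [M TM] := Tay0_bnd TF1.
move=> e e0; have Mp : 0 < `|M| + 1 by rewrite ltr_wpDl.
have eM : 0 < e / (`|M| + 1) by rewrite divr_gt0.
apply: filterS3 (near_norm_le eM) TM FE => s se Fs FE x.
rewrite FE addrC addKr normrM.
have -> : e = e / (`|M| + 1) * (`|M| + 1) by rewrite divfK ?gt_eqF.
by rewrite ler_pM// (le_trans (Fs x))// (le_trans (ler_norm M))// lerDl.
Qed.

Lemma Tay_le k j F : (j <= k)%N -> Tay k F -> Tay j F.
Proof.
by move=> /subnK <-; elim: (k - j)%N => [//|n IH] /TayS.
Qed.

Lemma Tay_s k F : Tay k F -> Tay k.+1 (fun x s => s * F x s).
Proof.
move=> TF; split; first by exists 0 => x; rewrite mul0r normr0.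
by exists F => //; apply: unifW => x s; rewrite mul0r add0r.
Qed.

Lemma TayM k F G : Tay k F -> Tay k G -> Tay k (fun x s => F x s * G x s).
Proof.
elim: k F G => [|k IH] F G TF TG; have [bF FE] := TF; have [bG GE] := TG;
  split; do ?exact: bndM.
  have [M M0 FM] := bnd_pos bF; have [N GN] := Tay0_bnd TG.
  move=> e e0; pose K := `|N| + M.
  have K0 : 0 < K by rewrite ltr_wpDl.
  have eK : 0 < e / K by rewrite divr_gt0.
  apply: filterS3 (FE _ eK) (GE _ eK) GN => s Fs Gs Ns x.
  have -> : F x s * G x s - F x 0 * G x 0 =
    (F x s - F x 0) * G x s + F x 0 * (G x s - G x 0) by ring.
  have -> : e = e / K * `|N| + M * (e / K) by rewrite /K; field; rewrite gt_eqF.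
  rewrite (le_trans (ler_normD _ _))// !normrM lerD ?ler_pM//.
  by rewrite (le_trans (Ns x))// ler_norm.
have [F1 TF1 FF] := FE; have [G1 TG1 GG] := GE.
exists (fun x s => F x 0 * G1 x s + G x 0 * F1 x s + s * (F1 x s * G1 x s)).
  have H := Tay_cst k.
  by apply: TayD; [apply: TayD; apply: IH => //; exact: H | exact/TayS/Tay_s/IH].
by apply: filterS2 FF GG => s FF GG x; rewrite FF GG; ring.
Qed.

Lemma TayN k F : Tay k F -> Tay k (fun x s => - F x s).
Proof.
move=> TF; apply: (@Tay_ext k (fun x s => (-1) * F x s)).
  by move=> x s; rewrite mulN1r.
exact: TayM (Tay_num _ _) TF.
Qed.

Lemma TayB k F G : Tay k F -> Tay k G -> Tay k (fun x s => F x s - G x s).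
Proof. by move=> TF TG; apply: TayD => //; exact: TayN. Qed.

Lemma TayX k F n : Tay k F -> Tay k (fun x s => F x s ^+ n).
Proof.
move=> TF; elim: n => [|n IH]; first exact: Tay_num.
apply: (@Tay_ext k (fun x s => F x s * F x s ^+ n)).
  by move=> x s; rewrite exprS.
exact: TayM.
Qed.

Lemma Tay_base k F : Tay k F -> Tay k (fun x _ => F x 0).
Proof. by move=> /Tay_bnd0/Tay_cst. Qed.

Lemma Tay_lb F (e : R) : 0 < e -> Tay 0 F -> (forall x, e <= `|F x 0|) ->
  unif (fun x s => e / 2 <= `|F x s|).
Proof.
move=> e0 [_ TF] Fe; have e20 : 0 < e / 2 by rewrite divr_gt0.
apply: filterS (TF _ e20) => s Fs x.
have := Fs x; have := Fe x; have := ler_normB (F x s) (F x s - F x 0).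
by rewrite subKr; lra.
Qed.

Lemma TayV k F (e : R) : 0 < e -> Tay k F -> (forall x, e <= `|F x 0|) ->
  Tay k (fun x s => (F x s)^-1).
Proof.
move=> e0 + Fe; have Fn0 x : F x 0 != 0.
  by rewrite -normr_gt0 (lt_le_trans e0).
have bV : bnd (fun x => (F x 0)^-1).
  by exists e^-1 => x; rewrite normfV lef_pV2// posrE (lt_le_trans e0).
elim: k => [|k IH] TF; split => //; have [_ FE] := TF.
  have e20 : 0 < e / 2 by rewrite divr_gt0.
  move=> d d0; have de : 0 < d * (e / 2) * e by rewrite !mulr_gt0.
  apply: filterS2 (Tay_lb e0 TF Fe) (FE _ de) => s Fs Ds x.
  have Fs0 : F x s != 0 by rewrite -normr_gt0 (lt_le_trans e20).
  have -> : (F x s)^-1 - (F x 0)^-1 = - (F x s - F x 0) / (F x s * F x 0).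
    by field; rewrite Fs0 Fn0.
  rewrite normrM normrN normfV ler_pdivrMr ?normr_gt0 ?mulf_neq0//.
  rewrite (le_trans (Ds x))// -mulrA ler_pM2l// normrM ler_pM//; exact: ltW.
have [F1 TF1 FF] := FE.
exists (fun x s => - ((F x 0)^-1 * F1 x s * (F x s)^-1)).
  by apply/TayN/TayM; [apply: TayM (Tay_cst _ bV) TF1 | exact/IH/TayS].
have TF0 : Tay 0 F by apply: Tay_le TF.
apply: filterS2 FF (Tay_lb e0 TF0 Fe) => s FF Fs x.
have Fs0 : F x s != 0 by rewrite -normr_gt0 (lt_le_trans _ (Fs x))// divr_gt0.
have E : s * F1 x s = F x s - F x 0 by rewrite FF addrC addKr.
rewrite mulrN -!mulrA mulrCA (mulrA s) E.
by field; rewrite Fs0 Fn0.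
Qed.

Lemma Tay_unroot k D : Tay k.+1 D -> (forall x, D x 0 = 0) ->
  exists2 D1, Tay k D1 & unif (fun x s => D x s = s * D1 x s).
Proof.
move=> [_ [D1 TD1 DE]] D0; exists D1 => //.
by apply: filterS DE => s DE x; rewrite DE D0 add0r.
Qed.

(** Implicit functions: a simple root inherits the regularity of the
    coefficients of its equation.  Here [Z] is the root, [D] is the value of
    the equation at the base root [Z x 0] (up to sign) and [Q] the divided
    difference, which itself depends on [Z]; each step of the induction gains
    one order thanks to the factor [s] in [D]. *)
Lemma Tay_implicit k Z Q D (e : R) : 0 < e -> Tay 0 Z ->
  (forall j, (j <= k)%N -> Tay j Z -> Tay j Q) -> Tay k D ->
  (forall x, D x 0 = 0) -> (forall x, e <= `|Q x 0|) ->
  unif (fun x s => (Z x s - Z x 0) * Q x s = D x s) -> Tay k Z.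
Proof.
move=> e0 TZ TQ TD D0 Qe ZE.
suff H j : (j <= k)%N -> Tay j Z by exact: H.
elim: j => [//|j IH] jk.
have {}IH := IH (ltnW jk); have TQj := TQ _ (ltnW jk) IH.
have [D1 TD1 DE] := Tay_unroot (Tay_le jk TD) D0.
split; first exact: Tay_bnd0 TZ.
exists (fun x s => D1 x s * (Q x s)^-1).
  by apply: TayM => //; exact: TayV e0 TQj Qe.
have TQ0 : Tay 0 Q by exact: TQ.
apply: filterS3 ZE DE (Tay_lb e0 TQ0 Qe) => s ZE DE Qs x.
have Qn0 : Q x s != 0 by rewrite -normr_gt0 (lt_le_trans _ (Qs x))// divr_gt0.
by rewrite mulrA -DE -ZE mulfK// addrC subrK.
Qed.

End TaylorClasses.

Ltac Tay_arith := repeat first [ assumption | exact: Tay_num | apply: TayD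
  | apply: TayB | apply: TayN | apply: TayM | apply: TayX ].

(** * Taylor expansions under rescaling *)

Section TaylorExpansions.
Variable R : realType.
Implicit Types X Y : Type.

Lemma unifP X (P : X -> R -> Prop) :
  unif P <-> exists2 d : R, 0 < d & forall s, `|s| < d -> forall x, P x s.
Proof.
split=> [/nbhs_norm0P[d /= d0 dP]|[d d0 dP]]; first by exists d.
by apply/nbhs_norm0P; exists d.
Qed.

Lemma unifI X (P Q : X -> R -> Prop) :
  unif P -> unif Q -> unif (fun x s => P x s /\ Q x s).
Proof. by apply: filterS2 => s Ps Qs x. Qed.

Lemma unif_le X (e : R) : 0 < e -> unif (fun (_ : X) (s : R) => `|s| <= e).
Proof. by move=> e0; apply: filterS (@near_norm_le R e e0) => s. Qed.

Lemma unif_dilate X (r : X -> R) (P : X -> R -> Prop) :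
  bnd r -> unif P -> unif (fun x s => P x (r x * s)).
Proof.
move=> /bnd_pos[B B0 rB] /unifP[d d0 dP].
apply/unifP; exists (d / B); first by rewrite divr_gt0.
move=> s sd x; apply: dP.
rewrite normrM (@le_lt_trans _ _ (B * `|s|)) ?ler_wpM2r//.
by rewrite mulrC -ltr_pdivlMr.
Qed.

Lemma Tay_reindex X Y (f : Y -> X) k (F : X -> R -> R) :
  Tay k F -> Tay k (fun y s => F (f y) s).
Proof.
elim: k F => [|k IH] F [[M bF] FE]; split; try by exists M.
  by move=> e /FE; apply: filterS.
have [F1 /IH TF1 F1E] := FE; exists (fun y s => F1 (f y) s) => //.
by apply: filterS F1E.
Qed.

Lemma Tay_dilate X (r : X -> R) k (F : X -> R -> R) :
  bnd r -> Tay k F -> Tay k (fun x s => F x (r x * s)).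
Proof.
move=> br; elim: k F => [|k IH] F [[M bF] FE]; split;
    try by exists M => x; rewrite mulr0.
  move=> e /FE/(unif_dilate br); apply: filterS => s + x.
  by rewrite mulr0.
have [F1 /IH TF1 F1E] := FE; exists (fun x s => r x * F1 x (r x * s)).
  by apply: TayM => //; exact: Tay_cst.
apply: filterS (unif_dilate br F1E) => s FE1 x.
by rewrite FE1 mulr0 mulrCA mulrA.
Qed.

Lemma Tay_sn X k n (F : X -> R -> R) :
  Tay k F -> Tay (n + k) (fun x s => s ^+ n * F x s).
Proof.
move=> TF; elim: n => [|n IH].
  by apply: Tay_ext TF => x s; rewrite mul1r.
apply: (Tay_ext _ (Tay_s IH)) => x s.
by rewrite exprS mulrA.
Qed.

Lemma Tay_sum X k n (F : nat -> X -> R -> R) :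
  (forall j, (j < n)%N -> Tay k (F j)) ->
  Tay k (fun x s => \sum_(j < n) F j x s).
Proof.
elim: n => [_|n IH TF].
  by apply: (@Tay_ext _ _ _ (fun _ _ => 0)) (Tay_num _ _ _) => x s; rewrite big_ord0.
apply: (@Tay_ext _ _ _ (fun x s => \sum_(j < n) F j x s + F n x s)).
  by move=> x s; rewrite big_ord_recr.
apply: TayD; last exact: TF.
by apply: IH => j jn; apply: TF; rewrite ltnS ltnW.
Qed.

Lemma Tay_expand X n k (F : X -> R -> R) : Tay (n + k) F ->
  exists (c : nat -> X -> R) (H : X -> R -> R), Tay k H /\
    unif (fun x s => F x s = \sum_(j < n) c j x * s ^+ j + s ^+ n * H x s).
Proof.
elim: n F => [|n IH] F TF.
  exists (fun _ _ => 0), F; split => //; apply: unifW => x s.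
  by rewrite big_ord0 add0r mul1r.
have [_ [F1 /IH[c [H [TH F1E]]] FE]] := TF.
exists (fun j => if j is i.+1 then c i else F^~ 0), H; split => //.
apply: filterS2 FE F1E => s FE F1E x.
rewrite FE F1E big_ord_recl mulr1 -addrA; congr (_ + _).
rewrite mulrDr mulr_sumr exprS mulrA; congr (_ + _).
by apply: eq_bigr => j _; rewrite /= exprS mulrCA.
Qed.

(** By induction on the number of coefficients: if [m] is the highest degree, the
    combination [f s - 2 ^ m * f (s / 2)] kills the leading term and multiplies
    the other coefficients by nonzero constants. *)
Lemma bounded_coefs X n (c : nat -> X -> R) (H : X -> R -> R) (M N : R) :
  unif (fun x s => `|\sum_(j < n) c j x * s ^+ j + s ^+ n * H x s| <= M) ->
  unif (fun x s => `|H x s| <= N) ->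
  forall j, (j < n)%N -> bnd (c j).
Proof.
elim: n c H M N => [//|n IH] c H M N FM HN.
pose f x s := \sum_(j < n.+1) c j x * s ^+ j + s ^+ n.+1 * H x s.
have bh : bnd (fun _ : X => 2^-1 : R) by exact: bnd_cst.
have bc j : (j < n)%N -> bnd (c j).
  move=> jn; have jn2 : 1 - 2 ^+ (n - j) != 0 :> R.
    rewrite subr_eq0 eq_sym -natrX -[1]/(1%:R) eqr_nat.
    by rewrite -(expn0 2) eqn_exp2l// subn_eq0 -ltnNge.
  have : bnd (fun x => c j x * (1 - 2 ^+ (n - j))).
    apply: (IH (fun i x => c i x * (1 - 2 ^+ (n - i)))
      (fun x s => s * (H x s - H x (2^-1 * s) / 2)) (M + 2 ^+ n * M)
      (1 * (N + N / 2)) _ _ j jn).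
    - apply: filterS2 FM (unif_dilate bh FM) => s FM FM2 x.
      suff -> : \sum_(i < n) c i x * (1 - 2 ^+ (n - i)) * s ^+ i +
          s ^+ n * (s * (H x s - H x (2^-1 * s) / 2)) =
          f x s - 2 ^+ n * f x (2^-1 * s).
        rewrite (le_trans (ler_normB _ _))// lerD ?FM// normrM ler_pM ?FM2//.
        by rewrite ger0_norm.
      rewrite /f !big_ord_recr/= !exprMn !exprVn.
      have -> : \sum_(i < n) c i x * (1 - 2 ^+ (n - i)) * s ^+ i =
         \sum_(i < n) c i x * s ^+ i -
         2 ^+ n * \sum_(i < n) c i x * (2^-1 * s) ^+ i.
        rewrite mulr_sumr -sumrB; apply: eq_bigr => i _.
        rewrite exprMn exprVn expfB//; field.
        by rewrite expf_neq0// pnatr_eq0.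
      rewrite !exprS; field.
      by rewrite expf_neq0// pnatr_eq0.
    - apply: filterS3 HN (unif_dilate bh HN) (near_norm_le ltr01) => s HN HN2 s1 x.
      rewrite normrM ler_pM// (le_trans (ler_normB _ _))// lerD//.
      by rewrite normrM (@ger0_norm _ 2^-1)// ler_pM2r.
  move=> [K cK]; exists (K / `|1 - 2 ^+ (n - j)|) => x.
  by rewrite ler_pdivlMr ?normr_gt0// -normrM.
move=> j; rewrite ltnS leq_eqVlt => /orP[/eqP->|/bc//].
have /unifP[d d0 FHd] := unifI FM HN.
pose s := d / 2; have s0 : 0 < s by rewrite divr_gt0.
have sd : `|s| < d by rewrite gtr0_norm// /s; lra.
have bsum : bnd (fun x => \sum_(i < n) c i x * s ^+ i).
  have [K cK] : exists K : nat -> R, forall i, (i < n)%N -> forall x,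
      `|c i x| <= K i.
    have /choice[K HK] : forall i, exists K, (i < n)%N -> forall x, `|c i x| <= K.
      move=> i; case: (ltnP i n) => [/bc[K cK]|_]; last by exists 0.
      by exists K.
    by exists K.
  exists (\sum_(i < n) K i * s ^+ i) => x.
  rewrite (le_trans (ler_norm_sum _ _ _))// ler_sum// => i _.
  by rewrite normrM ler_pM ?cK// normrX gtr0_norm.
have [K bK] := bsum; exists ((M + K + s ^+ n.+1 * N) / s ^+ n) => x.
rewrite ler_pdivlMr ?exprn_gt0// -(gtr0_norm (exprn_gt0 n s0)) -normrM.
have [FMx HNx] := FHd s sd x.
have -> : c n x * s ^+ n = f x s - \sum_(i < n) c i x * s ^+ i - s ^+ n.+1 * H x s.
  by rewrite /f big_ord_recr/=; ring.
rewrite (le_trans (ler_normB _ _))// lerD//.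
  by rewrite (le_trans (ler_normB _ _))// lerD.
rewrite normrM gtr0_norm ?exprn_gt0// ler_pM2l ?exprn_gt0//.
Qed.

Lemma Tay_id X k : Tay k (fun (_ : X) (s : R) => s).
Proof.
apply: TayS; apply: (@Tay_ext _ _ _ (fun _ s => s * 1)) (Tay_s (Tay_num _ _ _)).
by move=> x s; rewrite mulr1.
Qed.

(** Zooming in by a factor [r x] which may degenerate: for a function of order
    [r ^+ d] on the scale [r], the coefficients of order less than [d] are
    controlled by interpolation and the other ones are harmless. *)
Lemma Tay_rescale X (r : X -> R) d k F (M : R) : bnd r -> (forall x, 0 < r x) ->
  (d <= k)%N -> Tay k F ->
  unif (fun x s => `|F x (r x * s) / r x ^+ d| <= M) ->
  Tay k (fun x s => F x (r x * s) / r x ^+ d).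
Proof.
move=> br r0 dk TF FM.
have := TF; rewrite -{1}(subnKC dk) => /Tay_expand[c [H [TH FE]]].
have TH' := Tay_dilate br TH.
pose c' j x := c j x * r x ^+ j / r x ^+ d.
have FE' : unif (fun x s => F x (r x * s) / r x ^+ d =
    \sum_(j < d) c' j x * s ^+ j + s ^+ d * H x (r x * s)).
  apply: filterS (unif_dilate br FE) => s {}FE x.
  rewrite FE mulrDl mulr_suml; congr (_ + _).
    by apply: eq_bigr => j _; rewrite /c' exprMn; ring.
  by rewrite exprMn; field; rewrite expf_neq0// gt_eqF.
have [N HN] := Tay0_bnd (Tay_le (leq0n _) TH').
have bc' j : (j < d)%N -> bnd (c' j).
  apply: (@bounded_coefs _ _ _ _ M N _ HN).
  by apply: filterS2 FE' FM => s {}FE' {}FM x; rewrite -FE'.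
apply: (@Tay_eq _ _ _ (fun x s => \sum_(j < d) c' j x * s ^+ j +
    s ^+ d * H x (r x * s))).
  by apply: filterS FE' => s {}FE' x; rewrite FE'.
apply: TayD; last by rewrite -(subnKC dk); exact: Tay_sn.
apply: (@Tay_sum _ k d (fun j x s => c' j x * s ^+ j)) => j jd.
by apply: TayM; [exact/Tay_cst/bc' | exact/TayX/Tay_id].
Qed.

(** A nonnegative function which is small at a point has a small derivative
    there: its value at [- k * r x] or [k * r x] would be negative otherwise. *)
Lemma Tay_nonneg_rescale X (r : X -> R) F : bnd r -> (forall x, 0 < r x) ->
  Tay 2 F -> (forall x s, 0 <= F x s) -> (forall x, F x 0 = r x ^+ 2) ->
  exists M : R, unif (fun x s => `|F x (r x * s) / r x ^+ 2| <= M).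
Proof.
move=> br r0 [_ [F1 [_ [H TH F1E]] FE]] F0 Fr.
have [M HM] := Tay0_bnd TH.
have [B B0 rB] := bnd_pos br.
have {}FE : unif (fun x s => F x s = r x ^+ 2 + s * F1 x 0 + s ^+ 2 * H x s).
  by apply: filterS2 FE F1E => s FE F1E x; rewrite FE F1E Fr; ring.
have /unifP[d d0 FHd] := unifI FE HM.
pose k := d / (2 * B); have k0 : 0 < k by apply: divr_gt0 => //; apply: mulr_gt0.
have kd x : `|k * r x| < d.
  rewrite gtr0_norm; last exact: mulr_gt0.
  apply: (@le_lt_trans _ _ (k * B)).
    by apply: ler_wpM2l; [exact: ltW | exact: le_trans (ler_norm _) (rB x)].
  have -> : k * B = d / 2 by rewrite /k; field; rewrite gt_eqF.
  lra.
pose C := (1 + M * k ^+ 2) / k.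
have F1C x : `|F1 x 0| <= C * r x.
  have := r0 x; have := kd x.
  set rx := r x => kdx rx0.
  have [E1 H1] := FHd _ kdx x.
  have kdx' : `|- (k * rx)| < d by rewrite normrN.
  have [E2 H2] := FHd _ kdx' x.
  have := F0 x (k * rx); rewrite E1 -/rx => P1.
  have := F0 x (- (k * rx)); rewrite E2 -/rx => P2.
  have krx : 0 < k * rx by rewrite mulr_gt0.
  have Hb s : `|H x s| <= M -> (k * rx) ^+ 2 * H x s <= (k * rx) ^+ 2 * M.
    move=> HsM; rewrite ler_pM2l ?exprn_gt0// (le_trans (ler_norm _))//.
  have Q1 := Hb _ H1; have Q2 := Hb _ H2; rewrite sqrrN in P2.
  have E : C * rx * (k * rx) = rx ^+ 2 + (k * rx) ^+ 2 * M.
    by rewrite /C; field; rewrite gt_eqF.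
  rewrite -(ler_pM2r krx) E; case: (ler0P (F1 x 0)) => _; nra.
exists (1 + C + `|M|).
apply: filterS3 (unif_dilate br FE) (unif_dilate br HM) (near_norm_le ltr01)
  => s {}FE {}HM s1 x.
have rx0 := r0 x.
have -> : F x (r x * s) / r x ^+ 2 =
    1 + s * (F1 x 0 / r x) + s ^+ 2 * H x (r x * s).
  by rewrite FE; field; rewrite gt_eqF.
have A1 : `|s * (F1 x 0 / r x)| <= C.
  have -> : C = 1 * C by rewrite mul1r.
  rewrite normrM ler_pM// normrM normfV (gtr0_norm rx0) ler_pdivrMr//.
have A2 : `|s ^+ 2 * H x (r x * s)| <= `|M|.
  rewrite normrM -[leRHS]mul1r ler_pM//.
    by rewrite normrX exprn_ile1.
  exact: le_trans (HM x) (ler_norm _).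
rewrite (le_trans (ler_normD _ _))// lerD// (le_trans (ler_normD _ _))//.
by rewrite normr1 lerD.
Qed.

(** A function of size [s ^+ d] has no terms of order less than [d]. *)
Lemma Tay_small X d k (F : X -> R -> R) (C : R) : Tay (d + k) F ->
  unif (fun x s => s != 0 -> `|F x s| <= C * `|s| ^+ d) ->
  exists2 H, Tay k H & unif (fun x s => F x s = s ^+ d * H x s).
Proof.
elim: d F => [|d IH] F TF FC.
  by exists F => //; apply: unifW => x s; rewrite mul1r.
have F0 x : F x 0 = 0.
  have [_ FE] := Tay_le (leq0n _) TF.
  apply/eqP; rewrite -normr_eq0 eq_le normr_ge0 andbT.
  apply/ler_addgt0Pl => /= e e0; rewrite addr0.
  have e20 : 0 < e / 2 by rewrite divr_gt0.
  have C1 : 0 < `|C| + 1 by rewrite ltr_wpDl.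
  have eC : 0 < e / 2 / (`|C| + 1) by rewrite divr_gt0.
  have /unifP[r r0 Hr] := unifI (unifI FC (FE _ e20))
    (unifI (@unif_le X _ eC) (@unif_le X _ ltr01)).
  have rd : `|r / 2| < r by rewrite gtr0_norm; lra.
  have [[H1 H2] [H3 H4]] := Hr _ rd x.
  have r2 : r / 2 != 0 by rewrite gt_eqF// divr_gt0.
  have := H1 r2 => {}H1.
  have H5 : C * `|r / 2| ^+ d.+1 <= e / 2.
    have -> : e / 2 = (`|C| + 1) * (e / 2 / (`|C| + 1)).
      by rewrite [RHS]mulrC divfK ?gt_eqF.
    rewrite (@le_trans _ _ ((`|C| + 1) * `|r / 2| ^+ d.+1))//.
      by rewrite ler_wpM2r// (le_trans (ler_norm _))// lerDl.
    rewrite ler_pM2l// exprS (le_trans _ H3)//.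
    by rewrite ler_piMr// exprn_ile1// H4.
  rewrite -[F x 0]opprK normrN -[- F x 0](addKr (F x (r / 2))).
  have -> : - F x (r / 2) + (F x (r / 2) - F x 0) = - F x 0 by ring.
  have := ler_normB (F x (r / 2) - F x 0) (F x (r / 2)).
  by rewrite addrAC subrr add0r; lra.
have [_ [F1 TF1 FE]] := TF.
have [|H TH HE] := IH F1 TF1.
  apply: filterS2 FE FC => s FE FC x s0.
  have := FC x s0; rewrite FE F0 add0r normrM exprS mulrCA.
  by rewrite ler_pM2l ?normr_gt0.
exists H => //; apply: filterS2 FE HE => s FE HE x.
by rewrite FE F0 add0r HE exprS mulrA.
Qed.

End TaylorExpansions.

(** * Orbits of finite groups of isometries *)

Lemma nonexpansive_continuous (R : realType) (U W : normedModType R) (f : U -> W) :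
  (forall u v, `|f u - f v| <= `|u - v|) -> continuous f.
Proof.
move=> fn u; apply/cvgrPdist_le => e e0; near=> v.
rewrite (le_trans (fn _ _))//; near: v.
Unshelve. all: by end_near. Qed.

Section Orbits.
Variables (R : realType) (n : nat).
Local Notation V := 'cV[R]_n.
Implicit Types (G E : set 'M[R]_n) (u v w : V).

Lemma mx_norm_leP m p (A : 'M[R]_(m, p)) (e : R) : 0 <= e ->
  `|A| <= e <-> forall i j, `|A i j| <= e.
Proof.
move=> e0; rewrite {1}/Num.norm/= mx_normrE; split=> [/bigmax_leP[_ H] i j|H].
  exact: (H (i, j)).
by apply/bigmax_leP; split=> // -[i j] _; exact: H.
Qed.

Lemma cV_norm_leP u (e : R) : 0 <= e ->
  `|u| <= e <-> forall i, `|u i 0| <= e.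
Proof.
move=> e0; rewrite mx_norm_leP//; split=> H i; first exact: H.
by move=> j; rewrite (ord1 j).
Qed.

Lemma cV_coord_le u i : `|u i 0| <= `|u|.
Proof. by move: i; apply/cV_norm_leP. Qed.

Lemma box_compact (B : R) : compact [set u : V | `|u| <= B].
Proof.
have tr_norm (u : 'rV[R]_n) : `|u^T| = `|u|.
  apply/eqP; rewrite eq_le; apply/andP; split.
    apply/mx_norm_leP => // i j; rewrite mxE.
    by move: (j) (i) => i' j'; exact: (mx_norm_leP _ _).1.
  apply/mx_norm_leP => // i j; have -> : u i j = u^T j i by rewrite mxE.
    exact: (mx_norm_leP _ _).1.
have -> : [set u : V | `|u| <= B] = trmx @` [set u : 'rV[R]_n | `|u| <= B].
  apply/seteqP; split=> [u /= uB|_ [u /= uB <-]]; last by rewrite tr_norm.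
  by exists u^T; rewrite ?trmxK//= -tr_norm trmxK.
apply: continuous_compact.
  apply/continuous_subspaceT/nonexpansive_continuous => u v.
  by rewrite -linearB tr_norm.
apply: bounded_closed_compact.
  by exists B; split; rewrite ?num_real// => M /ltW BM u /= /le_trans; apply.
apply: (@preimage_closed _ _ (fun u : 'rV[R]_n => `|u|) [set x | x <= B]).
  by move=> u _; exact: norm_continuous.
exact: closed_le.
Qed.

(** The norm is the sup norm.  Its unit ball is the cube, so that it is preserved
    by the rotations of the cube, like the euclidean norm. *)
Definition isometry_group G := [/\ finite_set G, G 1%:M,
  forall g h, G g -> G h -> G (g *m h),
  forall g, G g -> exists2 h, G h & h *m g = 1%:M &
  forall g u, G g -> `|g *m u| <= `|u|].

Lemma isometry_group_norm G g u : isometry_group G -> G g -> `|g *m u| = `|u|.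
Proof.
move=> [_ _ _ GV Gn] Gg; apply/eqP; rewrite eq_le Gn//=.
have [h Gh hg] := GV _ Gg; rewrite -{1}(mul1mx u) -hg -mulmxA.
exact: Gn.
Qed.

Lemma isometry_mulmx_continuous G g : isometry_group G -> G g ->
  continuous (fun u => g *m u).
Proof.
move=> GG Gg; apply: nonexpansive_continuous => u v.
by rewrite -mulmxBr (isometry_group_norm _ GG Gg).
Qed.

(** To first order, the orbit of [c s] is that of [c 0 + s *: w].  The
    representatives [c s] themselves need not even be continuous, and [w] is
    unique up to the stabilizer of [c 0]. *)
Definition orbit_derivative G (c : R -> V) w := forall e : R, 0 < e ->
  \forall s \near (0 : R),
    exists2 g, G g & `|c s - g *m (c 0 + s *: w)| <= e * `|s|.

Definition bounded_orbit_derivative G (X : Type) (c : X -> R -> V) :=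
  exists C : R, forall x, exists2 w, `|w| <= C & orbit_derivative G (c x) w.

Lemma orbit_derivative_move G (c c' : R -> V) w' : isometry_group G ->
  (forall s, exists2 g, G g & c' s = g *m c s) -> orbit_derivative G c' w' ->
  exists2 w, `|w| <= `|w'| & orbit_derivative G c w.
Proof.
move=> GG; have [_ _ GM GV Gn] := GG => cc' Dc'.
have [h0 Gh0 c'0] := cc' 0; have [k0 Gk0 kh0] := GV _ Gh0.
have hk0 : h0 *m k0 = 1%:M by apply: mulmx1C.
exists (k0 *m w'); first exact: Gn.
move=> e /Dc'; apply: filterS => s [g Gg gP].
have [h Gh c's] := cc' s; have [k Gk kh] := GV _ Gh.
exists (k *m (g *m h0)); first exact: GM _ _ Gk (GM _ _ Gg Gh0).
rewrite -(isometry_group_norm _ GG Gh) mulmxBr -c's; move: gP.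
rewrite !mulmxA (mulmx1C kh) mul1mx -mulmxA (mulmxDr h0) -c'0.
by rewrite -scalemxAr mulmxA hk0 mul1mx.
Qed.

Lemma bounded_orbit_derivative_move G X (c c' : X -> R -> V) :
  isometry_group G ->
  (forall x s, exists2 g, G g & c' x s = g *m c x s) ->
  bounded_orbit_derivative G c' -> bounded_orbit_derivative G c.
Proof.
move=> GG cc' [C HC]; exists C => x; have [w' w'C] := HC x.
by move=> /(orbit_derivative_move GG (cc' x))[w ww' Dw]; exists w => //; exact: le_trans w'C.
Qed.

Lemma bounded_orbit_derivative_split G X (c : X -> R -> V) (P : X -> Prop) :
  bounded_orbit_derivative G (fun (x : {x | P x}) => c (sval x)) ->
  bounded_orbit_derivative G (fun (x : {x | ~ P x}) => c (sval x)) ->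
  bounded_orbit_derivative G c.
Proof.
move=> [C HC] [D HD]; exists (Num.max C D) => x.
have [Px|nPx] := pselect (P x).
  by have [w wC Dw] := HC (exist _ x Px); exists w; rewrite // le_max wC.
by have [w wC Dw] := HD (exist _ x nPx); exists w; rewrite // le_max wC orbT.
Qed.

Lemma finite_argmin (T : choiceType) (A : set T) (f : T -> R) :
  finite_set A -> A !=set0 -> exists2 a, A a & forall b, A b -> f a <= f b.
Proof.
move=> /finite_seqP[s ->]; elim: s => [[]//|a s IH _].
have [[b bs]|s0] := pselect ([set` s] !=set0); last first.
  exists a => /=; first by rewrite mem_head.
  move=> b; rewrite /= inE => /predU1P[->//|bs].
  by exfalso; apply: s0; exists b.
have [c /= cs cP] := IH (ex_intro _ b bs).
case: (leP (f a) (f c)) => [ac|/ltW ca].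
  exists a; rewrite /= ?mem_head// => d; rewrite inE => /predU1P[->//|ds].
  by rewrite (le_trans ac) ?cP.
exists c; first by rewrite /= inE cs orbT.
by move=> d; rewrite /= inE => /predU1P[->//|ds]; exact: cP.
Qed.

(** Continuous invariants which separate the orbits do so uniformly on bounded
    sets, by compactness. *)
Lemma uniform_orbit_separation G (E : set V) m (h : 'I_m -> V -> R) :
  isometry_group G -> closed E -> (forall i, continuous (h i)) ->
  (forall u v, E u -> E v -> (forall i, h i u = h i v) ->
     exists2 g, G g & u = g *m v) ->
  forall B e : R, 0 < e -> exists2 d : R, 0 < d & forall u v, E u -> E v ->
    `|u| <= B -> `|v| <= B -> (forall i, `|h i u - h i v| <= d) ->
    exists2 g, G g & `|u - g *m v| <= e.
Proof.
move=> GG cE ch sep B e e0.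
pose A := [set p : V * V | [/\ E p.1, E p.2, `|p.1| <= B, `|p.2| <= B &
  forall g, G g -> e <= `|p.1 - g *m p.2|]].
have c1 : continuous (fun p : V * V => p.1) by move=> p; exact: cvg_fst.
have c2 : continuous (fun p : V * V => p.2) by move=> p; exact: cvg_snd.
have cA : compact A.
  have -> : A = ([set u | `|u| <= B] `*` [set u | `|u| <= B]) `&`
      ([set p | E p.1] `&` [set p | E p.2] `&`
      (\bigcap_(g in G) [set p | e <= `|p.1 - g *m p.2|])).
    apply/seteqP; split=> p.
      by move=> [p1 p2 p3 p4 p5]; split => //; split.
    by move=> [[p3 p4] [[p1 p2] p5]].
  apply: compact_closedI.
    by apply: compact_setX; exact: box_compact.
  apply: closedI.
    by apply: closedI; apply: preimage_closed => // p _.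
  apply: closed_bigI => g Gg.
  apply: (@preimage_closed _ _ (fun p : V * V => `|p.1 - g *m p.2|) [set x | e <= x]).
    move=> p _; apply: continuous_comp; last exact: norm_continuous.
    apply: continuousB; first exact: c1.
    apply: (@continuous_comp _ _ _ (fun p : V * V => p.2) (mulmx g)).
      exact: c2.
    exact: (isometry_mulmx_continuous GG Gg).
  exact: closed_ge.
pose f (p : V * V) := \sum_i `|h i p.1 - h i p.2|.
have cf : continuous f.
  apply: (@continuous_big _ _ +%R 0) => [|i _ p]; first exact: add_continuous.
  apply: cvg_norm.
  apply: cvgB.
    by apply: (continuous_comp (c1 p)); exact: ch.
  by apply: (continuous_comp (c2 p)); exact: ch.
have [A0|nA0] := pselect (A !=set0); last first.
  exists 1 => // u v Eu Ev uB vB _; apply: contrapT => H.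
  apply: nA0; exists (u, v); split => //= g Gg; rewrite leNgt.
  by apply/negP => /ltW gP; apply: H; exists g.
have [p /set_mem Ap pmin] := compact_EVT_min A0 cA (continuous_subspaceT cf).
have fp : 0 < f p.
  rewrite lt_neqAle sumr_ge0// andbT eq_sym psumr_eq0//; apply/negP => /allP f0.
  have [Ep1 Ep2 _ _ Hp] := Ap.
  have [|g Gg pg] := sep _ _ Ep1 Ep2.
    move=> i; have := f0 i (mem_index_enum _) => /=.
    by rewrite normr_eq0 subr_eq0 => /eqP.
  by have := Hp g Gg; rewrite pg subrr normr0 leNgt e0.
exists (f p / m.+1%:R); first by rewrite divr_gt0.
move=> u v Eu Ev uB vB huv; apply: contrapT => H.
have Auv : A (u, v).
  split => //= g Gg; rewrite leNgt.
  by apply/negP => /ltW gP; apply: H; exists g.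
have := pmin _ (mem_set Auv); apply/negP; rewrite -ltNge.
apply: (@le_lt_trans _ _ (\sum_(i < m) f p / m.+1%:R)); first exact: ler_sum.
rewrite sumr_const card_ord -[_ *+ m]mulr_natr mulrAC ltr_pdivrMr//.
by rewrite ltr_pM2l// ltr_nat.
Qed.

(** By [uniform_orbit_separation], the representative of the orbit which is
    closest to the base point is uniformly close to it. *)
Lemma orbit_selection G (E : set V) m (h : 'I_m -> V -> R) X (c : X -> R -> V)
    (B : R) :
  isometry_group G -> closed E -> (forall i, continuous (h i)) ->
  (forall u v, E u -> E v -> (forall i, h i u = h i v) ->
     exists2 g, G g & u = g *m v) ->
  (forall x s, E (c x s)) -> unif (fun x s => `|c x s| <= B) ->
  (forall i, Tay 0 (fun x s => h i (c x s))) ->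
  exists c' : X -> R -> V, [/\ forall x s, exists2 g, G g & c' x s = g *m c x s,
    forall x, c' x 0 = c x 0 &
    forall e : R, 0 < e -> unif (fun x s => `|c' x s - c x 0| <= e)].
Proof.
move=> GG cE ch sep Ec cB Th; have [Gf G1 GM GV Gn] := GG.
have /choice[g gP] : forall p : X * R, exists g, G g /\
    forall g', G g' -> `|g *m c p.1 p.2 - c p.1 0| <= `|g' *m c p.1 p.2 - c p.1 0|.
  move=> p; have G0 : G !=set0 by exists 1%:M.
  have [a Ga aP] := @finite_argmin _ G
    (fun g => `|g *m c p.1 p.2 - c p.1 0|) Gf G0.
  by exists a.
exists (fun x s => g (x, s) *m c x s); split.
- by move=> x s; exists (g (x, s)) => //; case: (gP (x, s)).
- move=> x; have [_ /(_ _ G1)/=] := gP (x, 0).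
  by rewrite mul1mx subrr normr0 normr_le0 subr_eq0 => /eqP.
move=> e e0; have [d d0 dP] := uniform_orbit_separation GG cE ch sep B e0.
have hd : \forall s \near (0 : R), forall i x, `|h i (c x s) - h i (c x 0)| <= d.
  apply: (@filter_forall _ 'I_m
    (fun i s => forall x, `|h i (c x s) - h i (c x 0)| <= d) (nbhs (0 : R))) => i.
  by have [_ H] := Th i; exact: H.
have cB0 := unif0 cB.
apply: filterS2 hd cB => s hd cB x.
have [k Gk kP] : exists2 k, G k & `|c x 0 - k *m c x s| <= e.
  by apply: dP => // i; rewrite distrC.
have [_ /(_ k Gk)/=] := gP (x, s); move=> /le_trans; apply.
by rewrite distrC.
Qed.

End Orbits.

(** * Homogeneous invariants and reduction to the unit sphere *)

Lemma continuous_dist_le (R : realType) (T : topologicalType) (f : T -> R) w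
    (e : R) : continuous f -> 0 < e -> nbhs w [set v | `|f w - f v| <= e].
Proof. by move=> cf e0; have /cvgrPdist_le/(_ _ e0) := cf w. Qed.

Section HomogeneousReduction.
Variables (R : realType) (n : nat).
Local Notation V := 'cV[R]_n.
Implicit Types (u v w : V).

Definition sqnorm u := \sum_i u i 0 ^+ 2.

Lemma sqnorm_ge0 u : 0 <= sqnorm u.
Proof. by apply: sumr_ge0 => i _; exact: sqr_ge0. Qed.

Lemma sqnormZ (a : R) u : sqnorm (a *: u) = a ^+ 2 * sqnorm u.
Proof.
by rewrite mulr_sumr; apply: eq_bigr => i _; rewrite mxE exprMn.
Qed.

Lemma norm_le_sqnorm u (M : R) : sqnorm u <= M -> `|u| <= 1 + M.
Proof.
move=> uM; have M0 : 0 <= M by exact: le_trans (sqnorm_ge0 u) uM.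
apply/cV_norm_leP; first by rewrite addr_ge0.
move=> i; have : `|u i 0| ^+ 2 <= M.
  rewrite real_normK ?num_real//; apply: le_trans uM.
  by rewrite /sqnorm (bigD1 i)//= lerDl sumr_ge0// => j _; exact: sqr_ge0.
by have := sqr_ge0 (`|u i 0| - 1); have := normr_ge0 (u i 0); nra.
Qed.

Lemma sqnorm_eq0 u : sqnorm u = 0 -> u = 0.
Proof.
move=> /eqP; rewrite psumr_eq0; last by move=> i _; exact: sqr_ge0.
move=> /allP H; apply/colP => i; rewrite mxE; apply/eqP.
by have := H i (mem_index_enum _); rewrite /= sqrf_eq0.
Qed.

(** The base point is a minimum, so that the first-order term vanishes. *)
Lemma Tay_nonneg_zero X (F : X -> R -> R) : Tay 2 F ->
  (forall x s, 0 <= F x s) -> (forall x, F x 0 = 0) ->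
  exists M : R, unif (fun x s => F x s <= M * s ^+ 2).
Proof.
move=> [_ [F1 [_ [H TH F1E]] FE]] F0 Fr; have [M HM] := Tay0_bnd TH.
have {}FE : unif (fun x s => F x s = s * F1 x 0 + s ^+ 2 * H x s).
  by apply: filterS2 FE F1E => s FE F1E x; rewrite FE F1E Fr; ring.
have /unifP[d d0 FHd] := unifI FE HM.
have F10 x : F1 x 0 = 0.
  have H1 s : 0 < s -> s < d -> `|F1 x 0| <= `|M| * s.
    move=> s0 sd; have [|E1 M1] := FHd s _ x; first by rewrite gtr0_norm.
    have [|E2 M2] := FHd (- s) _ x; first by rewrite normrN gtr0_norm.
    have P1 := F0 x s; have P2 := F0 x (- s).
    rewrite E1 in P1; rewrite E2 in P2.
    have Q1 : s ^+ 2 * H x s <= s * (`|M| * s).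
      rewrite expr2 -mulrA ler_pM2l// mulrC ler_pM2r//.
      by rewrite (le_trans (ler_norm _))// (le_trans M1)// ler_norm.
    have Q2 : (- s) ^+ 2 * H x (- s) <= s * (`|M| * s).
      rewrite sqrrN expr2 -mulrA ler_pM2l// mulrC ler_pM2r//.
      by rewrite (le_trans (ler_norm _))// (le_trans M2)// ler_norm.
    rewrite -(ler_pM2l s0); case: (ler0P (F1 x 0)) => _; lra.
  apply/eqP; rewrite -normr_eq0 eq_le normr_ge0 andbT.
  apply/ler_addgt0Pl => /= e e0; rewrite addr0.
  have M1 : 0 < `|M| + 1 by rewrite ltr_wpDl.
  pose s := Num.min (d / 2) (e / (`|M| + 1)).
  have s0 : 0 < s by rewrite lt_min !divr_gt0.
  have sd : s < d by rewrite gt_min; apply/orP; left; lra.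
  apply: (le_trans (H1 s s0 sd)).
  have se : s <= e / (`|M| + 1) by rewrite ge_min lexx orbT.
  rewrite ler_pdivlMr// in se; apply: le_trans se.
  by rewrite mulrC ler_pM2l// lerDl.
exists M; apply: filterS2 FE HM => s FE HM x.
rewrite FE F10 mulr0 add0r mulrC ler_wpM2r ?sqr_ge0//.
exact: le_trans (ler_norm _) (HM x).
Qed.

(* The closed cone [E] will be the whole space or the plane orthogonal to an
   axis of the group. *)
Variables (G : set 'M[R]_n) (E : set V) (m : nat) (h : 'I_m -> V -> R)
  (d : 'I_m -> nat) (k : nat) (i0 : 'I_m).
Hypotheses (GG : isometry_group G) (cE : closed E)
  (EZ : forall (a : R) u, E u -> E (a *: u))
  (ch : forall i, continuous (h i))
  (hZ : forall i (a : R) u, h i (a *: u) = a ^+ d i * h i u)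
  (dk : forall i, (d i <= k)%N) (k2 : (1 < k)%N)
  (h0 : forall u, h i0 u = sqnorm u)
  (sep : forall u v, E u -> E v -> (forall i, h i u = h i v) ->
     exists2 g, G g & u = g *m v).

Definition invariant_family X (c : X -> R -> V) :=
  (forall x s, E (c x s)) /\ forall i, Tay k (fun x s => h i (c x s)).

Hypothesis unit_case : forall X (c : X -> R -> V), invariant_family c ->
  (forall x, sqnorm (c x 0) = 1) -> bounded_orbit_derivative G c.

Lemma invariant_bounded (B : R) :
  exists K : R, forall i u, `|u| <= B -> `|h i u| <= K.
Proof.
have /choice[K HK] : forall i, exists K : R, forall u, `|u| <= B -> `|h i u| <= K.
  move=> i; have /compact_bounded[M [_ HM]] : compact (h i @` [set u | `|u| <= B]).
    apply: continuous_compact; last exact: box_compact.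
    exact: continuous_subspaceT.
  exists (M + 1) => u uB; apply: (HM (M + 1)); first by rewrite ltrDl.
  by exists u.
exists (\sum_i `|K i|) => i u uB; rewrite (le_trans (HK i u uB))//.
rewrite (le_trans (ler_norm _))// (bigD1 i)//= lerDl sumr_ge0//.
Qed.

(** A curve starting at distance [r x] from 0 is dilated by the factor
    [(r x)^-1] both in space and in time.  As the degrees of the invariants are
    at most [k], the dilated curves form a family in the same Taylor class. *)
Lemma nonzero_case X (c : X -> R -> V) : invariant_family c ->
  (forall x, sqnorm (c x 0) <> 0) -> bounded_orbit_derivative G c.
Proof.
move=> [Ec Tc] c0.
have Tn : Tay k (fun x s => sqnorm (c x s)).
  by apply: Tay_ext (Tc i0) => x s; rewrite h0.
pose r x := Num.sqrt (sqnorm (c x 0)).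
have r0 x : 0 < r x.
  by rewrite sqrtr_gt0 lt_neqAle sqnorm_ge0 andbT eq_sym; apply/eqP.
have rn0 x : r x != 0 by rewrite gt_eqF.
have rE x : sqnorm (c x 0) = r x ^+ 2 by rewrite sqr_sqrtr// sqnorm_ge0.
have br : bnd r.
  have [M HM] := Tay_bnd0 Tn; exists (1 + M) => x.
  have := HM x; rewrite /= rE; have := sqr_ge0 (r x - 1).
  by rewrite !gtr0_norm ?exprn_gt0//; nra.
pose u x s := (r x)^-1 *: c x (r x * s).
have hu i x s : h i (u x s) = h i (c x (r x * s)) / r x ^+ d i.
  by rewrite hZ exprVn mulrC.
have nu x s : sqnorm (u x s) = sqnorm (c x (r x * s)) / r x ^+ 2.
  by rewrite sqnormZ exprVn mulrC.
have [M uM] := Tay_nonneg_rescale br r0 (Tay_le k2 Tn)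
  (fun x s => sqnorm_ge0 (c x s)) rE.
have ub : unif (fun x s => `|u x s| <= 1 + M).
  apply: filterS uM => s uM x; apply: norm_le_sqnorm; rewrite nu.
  exact: le_trans (ler_norm _) (uM x).
have [K HK] := invariant_bounded (1 + M).
have Fu : invariant_family u.
  split=> [x s|i]; first exact/EZ/Ec.
  apply: (@Tay_ext _ _ _ (fun x s => h i (c x (r x * s)) / r x ^+ d i)).
    by move=> x s; rewrite hu.
  apply: (@Tay_rescale _ _ _ _ _ (fun x s => h i (c x s)) K br r0 (dk i) (Tc i)).
  by apply: filterS ub => s ub x; rewrite -hu; apply: HK.
have [|C HC] := unit_case Fu.
  by move=> x; rewrite nu mulr0 rE divff// expf_neq0.
exists C => x; have [w wC Dw] := HC x; exists w => // e /Dw De.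
have : \forall s \near (0 : R), exists2 g, G g &
    `|u x ((r x)^-1 * s) - g *m (u x 0 + ((r x)^-1 * s) *: w)| <= e * `|(r x)^-1 * s|.
  have bc : bnd (fun _ : unit => (r x)^-1) by exists `|(r x)^-1|.
  have /(unif_dilate bc) : unif (fun (_ : unit) s => exists2 g, G g &
    `|u x s - g *m (u x 0 + s *: w)| <= e * `|s|).
    by apply: filterS De => s.
  by apply: filterS => s /(_ tt).
apply: filterS => s [g Gg gP]; exists g => //.
have -> : c x s = r x *: u x ((r x)^-1 * s).
  by rewrite /u scalerA mulfV// scale1r mulrA mulfV// mul1r.
have -> : c x 0 + s *: w = r x *: (u x 0 + ((r x)^-1 * s) *: w).
  rewrite scalerDr /u scalerA mulr0 mulfV// scale1r scalerA mulrA mulfV//.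
  by rewrite mul1r.
rewrite -scalemxAr -scalerBr normrZ (gtr0_norm (r0 x)).
rewrite -(ler_pM2l (r0 x)) in gP; apply: (le_trans gP).
rewrite normrM normfV (gtr0_norm (r0 x)) mulrCA mulrA.
by rewrite -mulrA mulVKf// mulrC.
Qed.

(** At a zero of the family, the orbits of [c x s / s] converge. *)
Lemma zero_case X (c : X -> R -> V) : invariant_family c ->
  (forall x, sqnorm (c x 0) = 0) -> bounded_orbit_derivative G c.
Proof.
move=> [Ec Tc] c0.
have Tn : Tay k (fun x s => sqnorm (c x s)).
  by apply: Tay_ext (Tc i0) => x s; rewrite h0.
have [M nM] := Tay_nonneg_zero (Tay_le k2 Tn) (fun x s => sqnorm_ge0 _) c0.
pose u x s := s^-1 *: c x s.
have uM : unif (fun x s => s != 0 -> `|u x s| <= 1 + M).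
  apply: filterS nM => s nM x s0; apply: norm_le_sqnorm.
  rewrite sqnormZ exprVn mulrC ler_pdivrMr; first exact: nM.
  by rewrite lt_neqAle sqr_ge0 andbT eq_sym sqrf_eq0.
have [K HK] := invariant_bounded (1 + M).
have hc i x s : s != 0 -> h i (c x s) = s ^+ d i * h i (u x s).
  by move=> s0; rewrite hZ exprVn mulrA mulfV ?mul1r// expf_neq0.
have /choice[H HP] : forall i, exists H : X -> R -> R, Tay 0 H /\
    unif (fun x s => h i (c x s) = s ^+ d i * H x s).
  move=> i; have TF := Tc i; rewrite -(subnKC (dk i)) in TF.
  have [|H TH HE] := @Tay_small _ _ _ _ _ K TF.
    apply: filterS uM => s uM x s0; rewrite hc// normrM normrX mulrC.
    by rewrite ler_wpM2r ?exprn_ge0//; apply/HK/uM.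
  by exists H; split => //; exact: Tay_le TH.
have hH x (e : R) : 0 < e -> \forall s \near (0 : R),
    s != 0 -> forall i, `|h i (u x s) - H i x 0| <= e.
  move=> e0; apply: (filterS (P := fun s => forall i, s != 0 ->
      `|h i (u x s) - H i x 0| <= e)).
    by move=> s Hs s0 i; exact: Hs.
  apply: (@filter_forall _ 'I_m (fun i s => s != 0 ->
    `|h i (u x s) - H i x 0| <= e) (nbhs (0 : R))) => i.
  have [[_ TH] HE] := HP i.
  apply: filterS2 (TH e e0) HE => s HsE HE s0.
  suff -> : h i (u x s) = H i x s by exact: HsE.
  by apply: (mulfI (expf_neq0 (d i) s0)); rewrite -HE hc.
exists (1 + M) => x.
have [w [Ew wM hw]] : exists w, [/\ E w, `|w| <= 1 + M &
    forall i, h i w = H i x 0].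
  have cB : compact ([set v : V | `|v| <= 1 + M] `&` E).
    by apply: compact_closedI; [exact: box_compact | exact: cE].
  have FF : ProperFilter (u x @ (0 : R)^') by exact: fmap_proper_filter.
  have FB : (u x @ (0 : R)^') ([set v : V | `|v| <= 1 + M] `&` E).
    rewrite /fmap/= /nbhs/= /dnbhs/within/=.
    by apply: filterS uM => s uM s0; split; [exact: uM | exact/EZ/Ec].
  have [w [[wM Ew] cw]] := cB _ FF FB.
  exists w; split => // i; apply/eqP; rewrite -subr_eq0 -normr_eq0.
  rewrite eq_le normr_ge0 andbT; apply/ler_addgt0Pl => /= e e0; rewrite addr0.
  have e20 : 0 < e / 2 by rewrite divr_gt0.
  have FA : (u x @ (0 : R)^') [set v | `|h i v - H i x 0| <= e / 2].
    rewrite /fmap/= /nbhs/= /dnbhs/within/=.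
    by apply: filterS (hH x _ e20) => s Hs s0; exact: Hs.
  have NB : nbhs w [set v | `|h i w - h i v| <= e / 2].
    exact: continuous_dist_le.
  have [v [/= v1 v2]] := cw _ _ FA NB.
  rewrite -(subrKA (h i v)) (splitr e) (le_trans (ler_normD _ _))//.
  by rewrite lerD.
exists w => // e e0.
have [eta eta0 etaP] := uniform_orbit_separation GG cE ch sep (1 + M) e0.
apply: filterS2 (hH x _ eta0) uM => s Hs uM.
have cx0 : c x 0 = 0 by exact/sqnorm_eq0.
have [->|s0] := eqVneq s 0.
  have [_ G1 _ _ _] := GG; exists 1%:M => //.
  by rewrite cx0 scale0r addr0 mulmx0 subr0 !normr0 mulr0.
have [|g Gg gP] := etaP (u x s) w (EZ _ (Ec x s)) Ew (uM x s0) wM.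
  by move=> i; rewrite hw; exact: Hs.
exists g => //; rewrite cx0 add0r -scalemxAr.
have -> : c x s = s *: u x s by rewrite scalerA mulfV// scale1r.
by rewrite -scalerBr normrZ mulrC ler_wpM2r.
Qed.

(** Homogeneity reduces the problem to families starting on the unit sphere:
    away from the zeros by zooming in, at the zeros by the previous lemma. *)
Theorem homogeneous_reduction X (c : X -> R -> V) : invariant_family c ->
  bounded_orbit_derivative G c.
Proof.
move=> [Ec Tc]; apply: (bounded_orbit_derivative_split (P := fun x => sqnorm (c x 0) = 0)).
  apply: zero_case; last by case.
  by split=> [x s|i]; [exact: Ec | exact: (Tay_reindex sval (Tc i))].
apply: nonzero_case; last by case.
by split=> [x s|i]; [exact: Ec | exact: (Tay_reindex sval (Tc i))].
Qed.

End HomogeneousReduction.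

(** * Differentiable selections of orbits *)

Section Lifting.
Variables (R : realType) (n : nat).
Local Notation V := 'cV[R]_n.
Implicit Types (G H : set 'M[R]_n) (u v w : V) (c f : R -> V) (D : set R).

Lemma near0P (P : R -> Prop) : (\forall s \near (0 : R), P s) <->
  exists2 d : R, 0 < d & forall s, `|s| < d -> P s.
Proof.
split=> [/nbhs_norm0P[d /= d0 dP]|[d d0 dP]]; first by exists d.
by apply/nbhs_norm0P; exists d.
Qed.

Definition has_derivative f t w := forall e : R, 0 < e ->
  \forall s \near (0 : R), `|f (t + s) - (f t + s *: w)| <= e * `|s|.

Lemma has_derivative_eq f f' t w (d : R) : 0 < d ->
  (forall s, `|s| < d -> f (t + s) = f' (t + s)) ->
  has_derivative f t w -> has_derivative f' t w.
Proof.
move=> d0 ff' Df e /Df /near0P[d' d'0 H].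
have E0 : f t = f' t by have := ff' 0; rewrite normr0 addr0; exact.
apply/near0P; exists (Num.min d d'); first by rewrite lt_min d0.
by move=> s; rewrite lt_min => /andP[sd sd']; rewrite -ff'// -E0; exact: H.
Qed.

(** A first-order error between two lines is not [o(s)] unless they agree. *)
Lemma affine_lower_bound u w : u <> 0 \/ w <> 0 -> exists2 e : R, 0 < e &
  \forall s \near (0 : R), e * `|s| <= `|u + s *: w|.
Proof.
have [->|/eqP u0 _] := eqVneq u 0.
  case=> // /eqP w0; exists `|w|; first by rewrite normr_gt0.
  by apply/near0P; exists 1 => // s _; rewrite add0r normrZ mulrC.
have nu : 0 < `|u| by rewrite normr_gt0; apply/eqP.
have nw : 0 < 2 * (`|w| + 1) by rewrite mulr_gt0// ltr_wpDl.
exists 1 => //; apply/near0P; exists (`|u| / (2 * (`|w| + 1))).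
  by rewrite divr_gt0.
move=> s; rewrite ltr_pdivlMr// => su; rewrite mul1r.
have := lerB_normD u (s *: w); rewrite normrZ => /(le_trans _); apply.
by have := normr_ge0 s; have := normr_ge0 w; nra.
Qed.

Lemma finite_near_lower_bound (A : set 'M[R]_n) (P : 'M[R]_n -> R -> R) :
  finite_set A ->
  (forall g, A g -> exists2 e : R, 0 < e &
     \forall s \near (0 : R), e * `|s| <= P g s) ->
  exists2 e : R, 0 < e &
     \forall s \near (0 : R), forall g, A g -> e * `|s| <= P g s.
Proof.
move=> /finite_seqP[l ->]; elim: l => [_|g l IH Pl].
  by exists 1 => //; apply/near0P; exists 1.
have [e e0 He] := Pl g (mem_head _ _).
have [h hl|e' e'0 He'] := IH; first by apply: Pl; rewrite /= inE (hl : h \in l) orbT.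
exists (Num.min e e'); first by rewrite lt_min e0.
apply: filterS2 He He' => s He He' h /=; rewrite inE => /predU1P[->|hl].
  by apply: le_trans He; rewrite ler_wpM2r// ge_min lexx.
by apply: le_trans (He' h hl); rewrite ler_wpM2r// ge_min lexx orbT.
Qed.

(** A differentiable selection of orbits realises the orbit derivative: by
    finiteness, a single group element occurs at arbitrarily small times. *)
Lemma selection_derivative G f t a b w : finite_set G ->
  (forall e : R, 0 < e -> \forall s \near (0 : R), exists2 g, G g &
     `|f (t + s) - g *m (a + s *: b)| <= e * `|s|) ->
  has_derivative f t w -> exists g, [/\ G g, f t = g *m a & w = g *m b].
Proof.
move=> Gf Hf Df; apply: contrapT => nex.
have [|e e0 He] := @finite_near_lower_bound G
    (fun g s => `|(f t - g *m a) + s *: (w - g *m b)|) Gf.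
  move=> g Gg; apply: affine_lower_bound; apply: contrapT => /not_orP[H1 H2].
  apply: nex; exists g; split => //; apply/eqP; rewrite -subr_eq0; apply/eqP.
    exact: contrapT.
  exact: contrapT.
have e30 : 0 < e / 3 by rewrite divr_gt0.
have [d d0 Hd] := (near0P _).1 (filterI He (filterI (Hf _ e30) (Df _ e30))).
pose s := d / 2; have s0 : 0 < s by rewrite divr_gt0.
have [|H1 [[g Gg H2] H3]] := Hd s; first by rewrite gtr0_norm// /s; lra.
have := H1 g Gg.
have -> : f t - g *m a + s *: (w - g *m b) =
    (f (t + s) - g *m (a + s *: b)) - (f (t + s) - (f t + s *: w)).
  rewrite mulmxDr -scalemxAr scalerBr.
  by rewrite opprB [RHS]addrC subrKA opprD addrACA.
have := ler_normB (f (t + s) - g *m (a + s *: b)) (f (t + s) - (f t + s *: w)).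
by move: H2 H3; rewrite gtr0_norm//; nra.
Qed.

Definition lift G c D f := forall t, D t ->
  (exists2 g, G g & f t = g *m c t) /\ exists w, has_derivative f t w.

(** By [selection_derivative], where the second selection provides the first-order
    data of the orbits. *)
Lemma lift_match G c f1 f2 t w1 w2 (d : R) : isometry_group G -> 0 < d ->
  (forall s, `|s| < d -> exists2 g, G g & f1 (t + s) = g *m c (t + s)) ->
  (forall s, `|s| < d -> exists2 g, G g & f2 (t + s) = g *m c (t + s)) ->
  has_derivative f1 t w1 -> has_derivative f2 t w2 ->
  exists g, [/\ G g, f1 t = g *m f2 t & w1 = g *m w2].
Proof.
move=> GG d0 F1 F2 D1 D2; have [Gf G1 GM GV Gn] := GG.
apply: (selection_derivative Gf _ D1) => e /D2/near0P[d' d'0 D2e].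
apply/near0P; exists (Num.min d d'); first by rewrite lt_min d0.
move=> s; rewrite lt_min => /andP[sd sd'].
have [g1 Gg1 ->] := F1 s sd; have [g2 Gg2 E2] := F2 s sd.
have [h Gh hg] := GV _ Gg2; exists (g1 *m h); first exact: GM.
have -> : g1 *m c (t + s) = (g1 *m h) *m f2 (t + s).
  by rewrite E2 -!mulmxA (mulmxA h) hg mul1mx.
by rewrite -mulmxBr (isometry_group_norm _ GG (GM _ _ Gg1 Gh)) D2e.
Qed.

Lemma lift_move G c D f g : isometry_group G -> G g -> lift G c D f ->
  lift G c D (fun t => g *m f t).
Proof.
move=> GG Gg Lf t Dt; have [_ _ GM _ _] := GG.
have [[h Gh E] [w Dw]] := Lf t Dt; split.
  by exists (g *m h); [exact: GM | rewrite E mulmxA].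
exists (g *m w) => e /Dw; apply: filterS => s.
by rewrite scalemxAr -mulmxDr -mulmxBr (isometry_group_norm _ GG Gg).
Qed.

Lemma lift_local G c D D' f f' :
  (forall t, D' t -> exists2 d : R, 0 < d & forall s, `|s| < d ->
     D (t + s) /\ f (t + s) = f' (t + s)) ->
  lift G c D f -> lift G c D' f'.
Proof.
move=> H Lf t /H[d d0 Hd].
have := Hd 0; rewrite normr0 addr0 => /(_ d0)[Dt E].
have [[g Gg fg] [w Dw]] := Lf t Dt; split; first by exists g; rewrite // -E.
by exists w; apply: has_derivative_eq d0 _ Dw => s /Hd[].
Qed.

Lemma open_near D t : open D -> D t ->
  exists2 d : R, 0 < d & forall s, `|s| < d -> D (t + s).
Proof.
move=> oD Dt; have : nbhs t D by exact: open_nbhs_nbhs.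
move=> /nbhs_normP[d /= d0 dD]; exists d => // s sd; apply: dD => /=.
by rewrite opprD addrA subrr add0r normrN.
Qed.

Lemma lift_glue G c D1 D2 f1 f2 t : isometry_group G -> open D1 -> open D2 ->
  D1 t -> D2 t -> lift G c D1 f1 -> lift G c D2 f2 ->
  exists2 f, lift G c [set s | (s <= t -> D1 s) /\ (t <= s -> D2 s)] f &
    forall s, s <= t -> f s = f1 s.
Proof.
move=> GG o1 o2 D1t D2t L1 L2.
have [_ [w1 Dw1]] := L1 t D1t; have [_ [w2 Dw2]] := L2 t D2t.
have [d1 d10 H1] := open_near o1 D1t; have [d2 d20 H2] := open_near o2 D2t.
have [g [Gg gf gw]] : exists g, [/\ G g, f1 t = g *m f2 t & w1 = g *m w2].
  apply: (@lift_match G c f1 f2 t w1 w2 (Num.min d1 d2)) => //.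
  - by rewrite lt_min d10.
  - by move=> s; rewrite lt_min => /andP[/H1/L1[]].
  - by move=> s; rewrite lt_min => /andP[_ /H2/L2[]].
have L2' := lift_move GG Gg L2.
pose f s := if s <= t then f1 s else g *m f2 s.
exists f; last by move=> s st; rewrite /f st.
move=> s /= [Ds1 Ds2]; case: (ltgtP s t) => st; last first.
- subst s; split; first by rewrite /f lexx; have [] := L1 t D1t.
  have ft : f t = f1 t by rewrite /f lexx.
  exists w1 => e e0.
  have Dg : has_derivative (fun t => g *m f2 t) t w1.
    move=> e' /Dw2; apply: filterS => s.
    by rewrite gw scalemxAr -mulmxDr -mulmxBr (isometry_group_norm _ GG Gg).
  apply: filterS2 (Dw1 e e0) (Dg e e0) => s E1 E2.
  by rewrite ft /f; case: ifP => // _; rewrite gf.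
- apply: (lift_local _ L2' (D' := [set s | t < s /\ D2 s])); last first.
    by split => //; exact/Ds2/ltW.
  move=> r [/= tr D2r]; have [d d0 Hd] := open_near o2 D2r.
  exists (Num.min d (r - t)); first by rewrite lt_min d0 subr_gt0.
  move=> q; rewrite lt_min => /andP[qd qr]; split; first exact: Hd.
  rewrite /f; case: ifP => // rt; exfalso; move: qr rt.
  by rewrite ltr_norml => /andP[+ _]; lra.
- apply: (lift_local _ L1 (D' := [set s | s < t /\ D1 s])); last first.
    by split => //; exact/Ds1/ltW.
  move=> r [/= tr D1r]; have [d d0 Hd] := open_near o1 D1r.
  exists (Num.min d (t - r)); first by rewrite lt_min d0 subr_gt0.
  move=> q; rewrite lt_min => /andP[qd qr]; split; first exact: Hd.
  rewrite /f; case: leP => // rt; exfalso; move: qr rt.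
  by rewrite ltr_norml => /andP[_ +]; lra.
Qed.

Definition liftable_at G c t :=
  exists2 d : R, 0 < d & exists f, lift G c [set s | `|s - t| < d] f.

Lemma open_ball_norm t (d : R) : open [set s : R | `|s - t| < d].
Proof.
have -> : [set s : R | `|s - t| < d] = ball t d.
  by apply/seteqP; split => s; rewrite /ball/= distrC.
exact: ball_open.
Qed.

Lemma open_Ioo (a b : R) : open [set s : R | a < s < b].
Proof.
have -> : [set s : R | a < s < b] = `]a, b[%classic.
  by apply/seteqP; split => s /=; rewrite in_itv.
exact: interval_open.
Qed.

(** At the supremum of the points up to which the selection extends, a local
    selection can be glued to it. *)
Lemma lift_extend G c (a b b' e : R) f : isometry_group G -> b <= b' ->
  a < b -> 0 < e -> lift G c [set s | a < s < b + e] f ->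
  (forall t, b <= t <= b' -> liftable_at G c t) ->
  exists2 e' : R, 0 < e' & exists2 f', lift G c [set s | a < s < b' + e'] f' &
    forall s, s <= b -> f' s = f s.
Proof.
move=> GG bb' ab e0 Lf Lloc.
pose S := [set r | b <= r <= b' /\ exists2 e' : R, 0 < e' &
  exists2 f', lift G c [set s | a < s < r + e'] f' & forall s, s <= b -> f' s = f s].
have Sb : S b by split; [rewrite lexx | exists e => //; exists f].
have Sub : ubound S b' by move=> r [/andP[]].
have supS : has_sup S by split; [exists b | exists b'].
pose z := sup S.
have bz : b <= z by exact: sup_upper_bound.
have zb' : z <= b' by apply: ge_sup => //; exists b.
have [d d0 [phi Lphi]] := Lloc z (introT andP (conj bz zb')).
have [r Sr zr] : exists2 r, S r & z - d / 2 < r.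
  by apply: sup_adherent => //; rewrite divr_gt0.
have rz : r <= z by exact: sup_upper_bound.
have [/andP[br rb'] [e' e'0 [f' Lf' ff']]] := Sr.
pose t := r + Num.min (e' / 2) (d / 4).
have m0 : 0 < Num.min (e' / 2) (d / 4) by rewrite lt_min !divr_gt0.
have m1 : Num.min (e' / 2) (d / 4) <= e' / 2 by rewrite ge_min lexx.
have m2 : Num.min (e' / 2) (d / 4) <= d / 4 by rewrite ge_min lexx orbT.
have tz : `|t - z| < d.
  by rewrite ltr_norml /t; move: (Num.min _ _) m0 m1 m2 => mm; lra.
have [||fz Lfz fzE] := lift_glue GG (@open_Ioo a (r + e')) (@open_ball_norm z d)
  (t := t) _ _ Lf' Lphi.
- by rewrite /= /t; move: (Num.min _ _) m0 m1 m2 => mm; lra.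
- by [].
have fzf s : s <= b -> fz s = f s.
  move=> sb; rewrite fzE ?ff'//; rewrite /t; move: (Num.min _ _) m0 => mm; lra.
have Lz : lift G c [set s | a < s < z + d] fz.
  move=> s /= /andP[sa sz]; apply: Lfz; split=> st /=.
    by rewrite sa /= (le_lt_trans st)// /t ltrD2l (le_lt_trans m1)//; lra.
  by move: tz; rewrite !ltr_norml => /andP[? ?]; apply/andP; split; lra.
have Sz : S (Num.min b' (z + d / 2)).
  split; first by rewrite ge_min lexx andbT le_min bb'/=; lra.
  exists (d / 2); first by rewrite divr_gt0.
  exists fz => // s /= /andP[sa sz]; apply: Lz; rewrite /= sa/=.
  apply: (lt_le_trans sz); rewrite -lerBrDr ge_min; apply/orP; right; lra.
have : Num.min b' (z + d / 2) <= z by exact: sup_upper_bound.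
rewrite ge_min => /orP[b'z|]; last by lra.
have [_ [e2 e20 He2]] := Sz; move: He2.
have -> : Num.min b' (z + d / 2) = b' by apply/min_idPl; lra.
by exists e2.
Qed.

(** Extension to the right up to the first point without a local lift, along a
    sequence which exhausts the half-open interval. *)
Lemma lift_right G c (a x e : R) f : isometry_group G -> a < x -> 0 < e ->
  lift G c [set s | a < s < x + e] f ->
  exists f', lift G c [set t | a < t /\ (x <= t ->
    exists2 y, t < y & forall r, x <= r <= y -> liftable_at G c r)] f'.
Proof.
move=> GG ax e0 Lf.
pose C := [set y | x <= y /\ forall r, x <= r <= y -> liftable_at G c r].
have Cx : C x.
  split=> // r; rewrite -eq_le => /eqP <-; exists (Num.min e (x - a)).
    by rewrite lt_min e0 subr_gt0.
  exists f => s /=; rewrite lt_min => /andP[]; rewrite !ltr_norml.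
  move=> /andP[_ s1] /andP[s2 _]; apply: Lf => /=; apply/andP; split; lra.
have [b [b0 bS bC bcof]] : exists b : nat -> R, [/\ b 0%N = x,
    forall k, b k <= b k.+1, forall k, C (b k) &
    forall t y, C y -> t < y -> exists k, t < b k].
  have Cdown y t : C y -> x <= t -> t <= y -> C t.
    move=> [xy Hy] xt ty; split=> // r /andP[xr rt]; apply: Hy.
    by rewrite xr (le_trans rt).
  have [[B0 HB]|unb] := pselect (has_ubound C); last first.
    exists (fun k => x + k%:R); split; first by rewrite addr0.
    - by move=> k; rewrite lerD2l ler_nat.
    - move=> k; apply: contrapT => nC; apply: unb; exists (x + k%:R) => y Cy.
      rewrite leNgt; apply/negP => /ltW ky; apply/nC/(Cdown y) => //.
      by rewrite lerDl.
    - move=> t y _ _; exists (Num.truncn (t - x)).+1.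
      by rewrite /= -ltrBlDl truncnS_gt.
  pose B := sup C.
  have supC : has_sup C by split; [exists x | exists B0].
  have xB : x <= B by exact: sup_upper_bound.
  exists (fun k => B - (B - x) / k.+1%:R); split; first by rewrite divr1 subKr.
  - move=> k; rewrite lerD2l lerN2 ler_wpM2l ?subr_ge0//.
    by rewrite lef_pV2 ?posrE// ler_nat.
  - move=> k; have [xB'|] := ltP x B; last first.
      move=> Bx; have -> : B = x by apply/eqP; rewrite eq_le Bx.
      by rewrite subrr mul0r subr0.
    have [||y Cy yB] := @sup_adherent _ C ((B - x) / k.+1%:R) => //.
      by rewrite divr_gt0// subr_gt0.
    apply: (Cdown y) => //; last exact: ltW.
    rewrite lerBrDr -lerBrDl ler_pdivrMr// ler_peMr ?subr_ge0//.
    by rewrite ler1n.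
  - move=> t y Cy ty; have yB : y <= B by exact: sup_upper_bound.
    have tB : 0 < B - t by rewrite subr_gt0 (lt_le_trans ty).
    exists (Num.truncn ((B - x) / (B - t))); rewrite /= ltrBrDr -ltrBrDl.
    by rewrite ltr_pdivrMr// mulrC -ltr_pdivrMr// truncnS_gt.
have step (p : nat * (R -> V)) : exists f' : R -> V,
    (exists2 e : R, 0 < e & lift G c [set s | a < s < b p.1 + e] p.2) ->
    (exists2 e : R, 0 < e & lift G c [set s | a < s < b p.1.+1 + e] f') /\
    forall s, s <= b p.1 -> f' s = p.2 s.
  case: p => k fk /=; have [[ek ek0 Lk]|nL] := pselect (exists2 e : R, 0 < e &
      lift G c [set s | a < s < b k + e] fk); last by exists fk.
  have abk : a < b k by apply: lt_le_trans ax _; have [] := bC k.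
  have [|e' e'0 [f' Lf' ff']] := lift_extend GG (bS k) abk ek0 Lk.
    move=> t /andP[bt tb]; have [_] := bC k.+1; apply.
    by rewrite tb andbT (le_trans _ bt)//; have [] := bC k.
  by exists f'; split => //; exists e'.
have [next nextP] := choice step.
pose F := fix F k := if k is k'.+1 then next (k', F k') else f.
have FL k : exists2 e : R, 0 < e & lift G c [set s | a < s < b k + e] (F k).
  elim: k => [|k IH]; first by exists e => //; rewrite b0.
  by have [] := nextP (k, F k) IH.
have FS k s : s <= b k -> F k.+1 s = F k s.
  by have [_] := nextP (k, F k) (FL k); apply.
have bmono k l : (k <= l)%N -> b k <= b l.
  by move=> /subnK <-; elim: (l - k)%N => // i IH; exact: le_trans (bS _).
have FE k l s : (k <= l)%N -> s <= b k -> F l s = F k s.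
  move=> /subnK <- sb; elim: (l - k)%N => // i IH.
  by rewrite addSn FS// (le_trans sb)// bmono// leq_addl.
have /choice[N HN] : forall t, exists k, forall k', t < b k' -> t < b k.
  move=> t; have [[k tk]|nk] := pselect (exists k, t < b k); first by exists k.
  by exists 0%N => k' tk'; exfalso; apply: nk; exists k'.
exists (fun t => F (N t) t).
have FN t k : t < b k -> F (N t) t = F k t.
  move=> tk; have tN := HN t k tk.
  case: (leqP k (N t)) => [kN|/ltnW Nk]; first by rewrite (FE k) // ltW.
  by rewrite [RHS](FE (N t)) // ltW.
move=> t [at' Ht].
have [k tk] : exists k, t < b k.
  case: (ltP t x) => [tx|xt]; first by exists 0%N; rewrite b0.
  have [y ty Hy] := Ht xt; apply: (bcof t y) => //; split=> //.
  by rewrite (le_trans xt)// ltW.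
have [ek ek0 Lk] := FL k.
suff Lb : lift G c [set s | a < s < b k] (fun t => F (N t) t).
  by apply: Lb; rewrite /= at'.
apply: (lift_local _ Lk) => r Dr.
have [d d0 Hd] := open_near (@open_Ioo a (b k)) Dr.
exists d => // s /Hd /andP[as' sb]; split; last by rewrite (FN _ k).
by rewrite /= as' (lt_trans sb)// ltrDl.
Qed.

Lemma lift_reflect G c D f : lift G c D f ->
  lift G (fun t => c (- t)) [set t | D (- t)] (fun t => f (- t)).
Proof.
move=> Lf t /Lf[[g Gg E] [w Dw]]; split; first by exists g.
exists (- w) => e /Dw /near0P[d d0 Hd].
apply/near0P; exists d => // s sd; have := Hd (- s).
by rewrite normrN scaleNr -[- t - s]opprD -scalerN; apply.
Qed.

Lemma liftable_reflect G c t : liftable_at G c t ->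
  liftable_at G (fun t => c (- t)) (- t).
Proof.
move=> [d d0 [f Lf]]; exists d => //; exists (fun t => f (- t)).
move=> s /= sd; apply: (lift_reflect Lf) => /=.
by rewrite -normrN opprD opprK.
Qed.

Lemma lift_left G c (b x e : R) f : isometry_group G -> x < b -> 0 < e ->
  lift G c [set s | x - e < s < b] f ->
  exists f', lift G c [set t | t < b /\ (t <= x ->
    exists2 y, y < t & forall r, y <= r <= x -> liftable_at G c r)] f'.
Proof.
move=> GG xb e0 Lf.
have [||f' Lf'] := @lift_right G (fun t => c (- t)) (- b) (- x) e
    (fun t => f (- t)) GG _ e0; first by rewrite ltrN2.
  move=> s /= /andP[bs sx]; apply: (lift_reflect Lf) => /=.
  by apply/andP; split; lra.
exists (fun t => f' (- t)) => t /= [tb Ht].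
have := lift_reflect Lf' (t := t); rewrite /= opprK.
apply; split; first by rewrite ltrN2.
rewrite lerN2 => tx; have [y yt Hy] := Ht tx.
exists (- y); first by rewrite ltrN2.
move=> r /andP[xr ry]; rewrite -[r]opprK; apply/liftable_reflect/Hy.
by apply/andP; split; lra.
Qed.

(** A connected component of the open set of points with local lifts, described
    by intervals. *)
Definition lift_component G c x := [set t | exists y z,
  [/\ y < t < z, y < x < z & forall r, y <= r <= z -> liftable_at G c r]].

Lemma lift_component_lift G c x : isometry_group G ->
  exists f, lift G c (lift_component G c x) f.
Proof.
move=> GG; have [[d d0 [f Lf]]|nx] := pselect (liftable_at G c x); last first.
  exists c => t [y [z [_ /andP[yx xz] H]]]; exfalso; apply/nx/H.
  by rewrite !ltW.
have [||fr Lr] := @lift_right G c (x - d) x d f GG _ d0; first by lra.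
  by move=> s /= /andP[s1 s2]; apply: Lf; rewrite /= ltr_norml; apply/andP; split; lra.
have [||fl Ll] := @lift_left G c (x + d) x d f GG _ d0; first by lra.
  by move=> s /= /andP[s1 s2]; apply: Lf; rewrite /= ltr_norml; apply/andP; split; lra.
pose Dr := [set t | exists y z, [/\ y < t < z, y < x < z, x - d < y &
  forall r, x <= r <= z -> liftable_at G c r]].
pose Dl := [set t | exists y z, [/\ y < t < z, y < x < z, z < x + d &
  forall r, y <= r <= x -> liftable_at G c r]].
have open_ex (P : R -> R -> Prop) : open [set t | exists y z, y < t < z /\ P y z].
  have -> : [set t | exists y z, y < t < z /\ P y z] =
      \bigcup_(p in [set p | P p.1 p.2]) [set t | p.1 < t < p.2].
    apply/seteqP; split => [t [y [z [yt Pyz]]]|t [[y z] Pyz yt]].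
      by exists (y, z).
    by exists y, z.
  by apply: bigcup_open => p _; exact: open_Ioo.
have oDr : open Dr.
  have -> : Dr = [set t | exists y z, y < t < z /\ (y < x < z /\ x - d < y /\
      forall r, x <= r <= z -> liftable_at G c r)].
    apply/seteqP; split=> t [y [z]].
      by move=> [H1 H2 H3 H4]; exists y, z.
    by move=> [H1 [H2 [H3 H4]]]; exists y, z.
  exact: open_ex.
have oDl : open Dl.
  have -> : Dl = [set t | exists y z, y < t < z /\ (y < x < z /\ z < x + d /\
      forall r, y <= r <= x -> liftable_at G c r)].
    apply/seteqP; split=> t [y [z]].
      by move=> [H1 H2 H3 H4]; exists y, z.
    by move=> [H1 [H2 [H3 H4]]]; exists y, z.
  exact: open_ex.
have L1 : lift G c Dl fl.
  move=> t [y [z [/andP[yt tz] /andP[yx xz] zd H]]]; apply: Ll => /=.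
  split; first exact: lt_trans zd.
  by move=> _; exists y.
have L2 : lift G c Dr fr.
  move=> t [y [z [/andP[yt tz] /andP[yx xz] zd H]]]; apply: Lr => /=.
  split; first exact: lt_trans yt.
  by move=> _; exists z.
have near_x r : `|r - x| < d -> liftable_at G c r.
  move=> rd; exists (d - `|r - x|); first by rewrite subr_gt0.
  exists f => s /= sr; apply: Lf => /=.
  have -> : s - x = (s - r) + (r - x) by rewrite subrKA.
  by rewrite (le_lt_trans (ler_normD _ _))// -ltrBrDr.
have Dlx : Dl x.
  exists (x - d / 2), (x + d / 2); split; try by apply/andP; split; lra.
    lra.
  move=> r /andP[r1 r2]; apply: near_x; rewrite ltr_norml; apply/andP; split; lra.
have Drx : Dr x.
  exists (x - d / 2), (x + d / 2); split; try by apply/andP; split; lra.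
    lra.
  move=> r /andP[r1 r2]; apply: near_x; rewrite ltr_norml; apply/andP; split; lra.
have [f' Lf' _] := lift_glue GG oDl oDr Dlx Drx L1 L2.
exists f' => t [y [z [/andP[yt tz] /andP[yx xz] H]]]; apply: Lf'; split => tx.
  have h1 : x < Num.min z (x + d / 2) by rewrite lt_min xz; lra.
  have h2 : Num.min z (x + d / 2) <= x + d / 2 by rewrite ge_min lexx orbT.
  exists y, (Num.min z (x + d / 2)); split.
  - by rewrite yt (le_lt_trans tx).
  - by rewrite yx.
  - by rewrite (le_lt_trans h2)//; lra.
  - by move=> r /andP[yr rx]; apply: H; rewrite yr (le_trans rx)// ltW.
have h1 : Num.max y (x - d / 2) < x by rewrite gt_max yx; lra.
have h2 : x - d / 2 <= Num.max y (x - d / 2) by rewrite le_max lexx orbT.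
exists (Num.max y (x - d / 2)), z; split.
- by rewrite tz andbT (lt_le_trans h1).
- by rewrite h1.
- by rewrite (lt_le_trans _ h2)//; lra.
- by move=> r /andP[xr rz]; apply: H; rewrite rz andbT (le_trans _ xr)// ltW.
Qed.

Lemma lift_component_sub G c x y : lift_component G c x y ->
  lift_component G c y `<=` lift_component G c x.
Proof.
move=> [a [b [/andP[ay yb] /andP[ax xb] Hab]]] t
  [a' [b' [/andP[at' tb'] /andP[ay' yb'] Hab']]].
exists (Num.min a a'), (Num.max b b'); split.
- by rewrite gt_min lt_max at' tb' !orbT.
- by rewrite gt_min lt_max ax xb.
- move=> r /andP[]; rewrite ge_min le_max => ar rb.
  case: (leP a r) ar => [ar _|ra /= ar].
    case: (leP r b) rb => [rb _|br /= rb]; first by apply: Hab; rewrite ar.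
    by apply: Hab'; rewrite rb andbT ltW// (lt_trans ay')// (lt_trans yb).
  by apply: Hab'; rewrite ar ltW// (lt_trans ra)// (lt_trans ay).
Qed.

Lemma lift_component_eq G c x y : lift_component G c x y ->
  lift_component G c x = lift_component G c y.
Proof.
move=> xy; apply/seteqP; split; last exact: lift_component_sub.
by apply: lift_component_sub; case: xy => a [b [ay ax H]]; exists a, b.
Qed.

Lemma lift_component_nbhs G c x : liftable_at G c x ->
  exists2 d : R, 0 < d & forall s, `|s| < d -> lift_component G c x (x + s).
Proof.
move=> [d d0 [f Lf]]; exists (d / 2); first by rewrite divr_gt0.
move=> s; rewrite ltr_norml => /andP[s1 s2].
exists (x - d / 2), (x + d / 2); split; try by apply/andP; split; lra.
move=> r /andP[r1 r2].
have rd : `|r - x| < d by rewrite ltr_norml; apply/andP; split; lra.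
exists (d - `|r - x|); first by rewrite subr_gt0.
exists f => q /= qr; apply: Lf => /=.
have -> : q - x = (q - r) + (r - x) by rewrite subrKA.
by rewrite (le_lt_trans (ler_normD _ _))// -ltrBrDr.
Qed.

(** Distinct components being disjoint, selections on them define a single one. *)
Lemma lift_liftable G c : isometry_group G ->
  exists f, lift G c (liftable_at G c) f.
Proof.
move=> GG.
have /choice[F FP] : forall C : set R, exists f,
    (exists x, C = lift_component G c x) -> lift G c C f.
  move=> C; have [[x ->]|nx] := pselect (exists x, C = lift_component G c x).
    by have [f Lf] := lift_component_lift c x GG; exists f.
  by exists c.
exists (fun t => F (lift_component G c t) t) => t Lt.
have [d d0 Hd] := lift_component_nbhs Lt.
have Ltt : lift_component G c t t by have := Hd 0; rewrite normr0 addr0; exact.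
have Lc : lift G c (lift_component G c t) (F (lift_component G c t)).
  by apply: FP; exists t.
suff L : lift G c [set s | `|s - t| < d] (fun t => F (lift_component G c t) t).
  by apply: L; rewrite /= subrr normr0.
apply: (lift_local _ Lc) => r /= rt; exists (d - `|r - t|).
  by rewrite subr_gt0.
move=> s sd; have Lrs : lift_component G c t (r + s).
  have -> : r + s = t + (s + (r - t)) by ring.
  by apply: Hd; rewrite (le_lt_trans (ler_normD _ _))// -ltrBrDr.
by split=> //; rewrite -(lift_component_eq Lrs).
Qed.

Lemma stabilizer_group G (a b : V) : isometry_group G ->
  isometry_group [set g | [/\ G g, g *m a = a & g *m b = b]].
Proof.
move=> [Gf G1 GM GV Gn]; split.
- by apply: sub_finite_set Gf => g [].
- by split; rewrite ?mul1mx.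
- move=> g h [Gg ga gb] [Gh ha hb]; split; first exact: GM.
    by rewrite -mulmxA ha ga.
  by rewrite -mulmxA hb gb.
- move=> g [Gg ga gb]; have [h Gh hg] := GV _ Gg; exists h => //; split => //.
    by rewrite -{1}ga mulmxA hg mul1mx.
  by rewrite -{1}gb mulmxA hg mul1mx.
- by move=> g u [Gg _ _]; exact: Gn.
Qed.

(** Near a point whose orbit derivative data is [(a, b)], the orbits of [c]
    come with a distinguished selection close to the line [a + s *: b], which
    reduces the group to the stabilizer of [(a, b)]. *)
Lemma stabilizer_reduction G c (D : set R) t0 b (H := [set g | [/\ G g,
    g *m c t0 = c t0 & g *m b = b]]) : isometry_group G -> open D -> D t0 ->
  (forall t, D t -> exists w, orbit_derivative G (fun s => c (t + s)) w) ->
  orbit_derivative G (fun s => c (t0 + s)) b ->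
  exists2 d : R, 0 < d & exists c', (forall t, `|t - t0| < d ->
    (exists2 g, G g & c' t = g *m c t) /\
    exists w, orbit_derivative H (fun s => c' (t + s)) w).
Proof.
move=> GG oD Dt0 Dc Db; have [Gf G1 GM GV Gn] := GG.
set a := c t0; have ca : c (t0 + 0) = a by rewrite addr0.
have [||e e0 He] := @finite_near_lower_bound (G `\` H)
    (fun g s => `|g *m (a + s *: b) - (a + s *: b)|).
- by apply: sub_finite_set Gf => g [].
- move=> g [Gg nHg].
  have [|e e0 He] := @affine_lower_bound (g *m a - a) (g *m b - b).
    apply: contrapT => /not_orP[/contrapT H1 /contrapT H2]; apply: nHg.
    by split => //; apply/eqP; rewrite -subr_eq0 ?H1 ?H2.
  exists e => //; apply: filterS He => s; congr (_ <= `|_|).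
  by rewrite mulmxDr -scalemxAr scalerBr opprD addrACA.
have e50 : 0 < e / 5 by rewrite divr_gt0.
have [d1 d10 Hd1] := (near0P _).1 (filterI He (Db _ e50)).
have [d2 d20 Hd2] := open_near oD Dt0.
pose d := Num.min d1 d2; have d0 : 0 < d by rewrite lt_min d10.
have sel t : exists y, `|t - t0| < d -> (exists2 g, G g & y = g *m c t) /\
    `|y - (a + (t - t0) *: b)| <= e / 5 * `|t - t0|.
  have [td|] := boolP (`|t - t0| < d); last by move=> _; exists 0.
  have td1 : `|t - t0| < d1 by apply: lt_le_trans td _; rewrite ge_min lexx.
  have [_ [g Gg]] := Hd1 _ td1; rewrite subrKC ca => gP.
  have [h Gh hg] := GV _ Gg; exists (h *m c t) => _; split; first by exists h.
  rewrite -(isometry_group_norm _ GG Gg) mulmxBr mulmxA (mulmx1C hg).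
  by rewrite mul1mx.
have [c' c'P] := choice sel; exists d => //; exists c' => t1 t1d.
have [[g1 Gg1 c't1] c'n] := c'P t1 t1d.
split; first by exists g1.
pose s1 := t1 - t0.
have t1s1 : `|s1| < d1 by apply: lt_le_trans t1d _; rewrite ge_min lexx.
have [k1 Gk1 kg1] := GV _ Gg1.
have near_t1 : \forall s \near (0 : R), `|t1 + s - t0| < d.
  apply/near0P; exists (d - `|s1|); first by rewrite subr_gt0.
  move=> s sd; rewrite addrAC (le_lt_trans (ler_normD _ _))//.
  by rewrite -ltrBrDl.
have [s10|s1n0] := eqVneq s1 0.
  have t10 : t1 = t0 by apply/eqP; rewrite -subr_eq0 -/s1 s10.
  have c't1a : c' t1 = a.
    apply/eqP; rewrite -subr_eq0 -normr_le0.
    by move: c'n; rewrite -/s1 s10 scale0r addr0 normr0 mulr0.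
  exists b => e' e'0.
  have m0 : 0 < Num.min e' (e / 5) by rewrite lt_min e'0.
  have nHe : \forall s \near (0 : R), `|s| < d1 by apply/near0P; exists d1.
  apply: filterS3 near_t1 (Db _ m0) nHe => s sd [g Gg gP] sd1.
  rewrite addr0 c't1a.
  have [[h Gh c'h] c'hn] := c'P _ sd.
  have ts : t1 + s - t0 = s by rewrite t10 addrC addKr.
  have [s0|s0] := eqVneq s 0.
    exists 1%:M; first by split => //; rewrite mul1mx.
    by rewrite s0 addr0 c't1a scale0r addr0 mul1mx subrr !normr0 mulr0.
  have gP' : `|c' (t1 + s) - (h *m g) *m (a + s *: b)| <= Num.min e' (e / 5) * `|s|.
    rewrite c'h -mulmxA -mulmxBr (isometry_group_norm _ GG Gh) t10.
    by move: gP; rewrite ca.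
  exists (h *m g); last first.
    by apply: (le_trans gP'); rewrite ler_wpM2r// ge_min lexx.
  apply: contrapT => nH.
  have [Hs _] := Hd1 s sd1.
  have := Hs (h *m g) (conj (GM _ _ Gh Gg) nH); apply/negP; rewrite -ltNge.
  have ns : 0 < `|s| by rewrite normr_gt0.
  apply: (@le_lt_trans _ _ (e / 5 * `|s| + e / 5 * `|s|)); last by nra.
  rewrite -(subrKA (c' (t1 + s))) (le_trans (ler_normD _ _))// lerD//.
    rewrite distrC; apply: (le_trans gP').
    by rewrite ler_wpM2r// ge_min lexx orbT.
  by rewrite ts in c'hn.
have [w1 Dw1] : exists w, orbit_derivative G (fun s => c (t1 + s)) w.
  apply: Dc; rewrite -(subrK t0 t1) addrC; apply: Hd2.
  by apply: lt_le_trans t1d _; rewrite ge_min lexx orbT.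
exists (g1 *m w1) => e' e'0.
have ns1 : 0 < `|s1| by rewrite normr_gt0.
pose K := e' + `|w1| + e / 5 + `|b|.
have K0 : 0 < K by rewrite /K !ltr_wpDr// ltW.
have small : \forall s \near (0 : R), `|s| * K <= e / 5 * `|s1|.
  have eK : 0 < e / 5 * `|s1| / K by rewrite divr_gt0// mulr_gt0.
  by apply: filterS (near_norm_le eK) => s; rewrite ler_pdivlMr.
apply: filterS3 near_t1 (Dw1 _ e'0) small => s sd [g Gg gP] sK.
rewrite addr0; rewrite addr0 in gP.
have [[h Gh c'h] c'hn] := c'P _ sd.
pose g' := h *m g *m k1.
have Gg' : G g' by apply: (GM) => //; exact: (GM).
have g'E u : g' *m (g1 *m u) = h *m (g *m u).
  by rewrite /g' -!mulmxA (mulmxA k1) kg1 mul1mx.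
have gP' : `|c' (t1 + s) - g' *m (c' t1 + s *: (g1 *m w1))| <= e' * `|s|.
  rewrite c't1 c'h scalemxAr -mulmxDr g'E -mulmxBr.
  by rewrite (isometry_group_norm _ GG Gh).
exists g' => //; apply: contrapT => nH.
have [Hs _] := Hd1 s1 t1s1.
have := Hs g' (conj Gg' nH); apply/negP; rewrite -ltNge.
set L := a + s1 *: b.
have N1 : `|g' *m L - g' *m c' t1| <= e / 5 * `|s1|.
  by rewrite -mulmxBr (isometry_group_norm _ GG Gg') distrC.
have N2 : `|g' *m c' t1 - c' (t1 + s)| <= (e' + `|w1|) * `|s|.
  have -> : g' *m c' t1 - c' (t1 + s) =
    - (c' (t1 + s) - g' *m (c' t1 + s *: (g1 *m w1))) - g' *m (s *: (g1 *m w1)).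
    by rewrite mulmxDr opprB [RHS]addrAC addrK.
  rewrite (le_trans (ler_normB _ _))// normrN mulrDl lerD//.
  by rewrite (isometry_group_norm _ GG Gg') normrZ (isometry_group_norm _ GG Gg1) mulrC.
have N3 : `|c' (t1 + s) - L| <= e / 5 * (`|s1| + `|s|) + `|b| * `|s|.
  have -> : c' (t1 + s) - L = (c' (t1 + s) - (a + (t1 + s - t0) *: b)) + s *: b.
    rewrite [t1 + s - t0]addrAC -/s1 scalerDl (addrA a).
    by rewrite !opprD !addrA subrK.
  rewrite (le_trans (ler_normD _ _))// lerD//; last by rewrite normrZ mulrC.
  apply: (le_trans c'hn); rewrite ler_pM2l// addrAC; exact: ler_normD.
have -> : g' *m L - L = (g' *m L - g' *m c' t1) + (g' *m c' t1 - c' (t1 + s)) +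
    (c' (t1 + s) - L) by rewrite !subrKA.
rewrite (le_lt_trans (ler_normD _ _))//.
have := ler_normD (g' *m L - g' *m c' t1) (g' *m c' t1 - c' (t1 + s)).
move: N1 N2 N3 sK ns1; rewrite /K.
move: `|_ *m L - _| `|_ - c' (t1 + s)| `|c' (t1 + s) - L| `|_ + _| => n1 n2 n3 n4.
nra.
Qed.

(** By induction on the order of the group.  Where the common stabilizer of the
    value and the derivative is a proper subgroup, [stabilizer_reduction] and the
    induction hypothesis give local selections, which are glued; elsewhere the
    value and the derivative are fixed by the group and every selection is
    differentiable. *)
Theorem differentiable_selection G c (D : set R) : isometry_group G -> open D ->
  (forall t, D t -> exists w, orbit_derivative G (fun s => c (t + s)) w) ->
  exists f, lift G c D f.
Proof.
move=> GG; have [/finite_seqP[l Gl] _ _ _ _] := GG.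
have [N] := ubnP (size l).
elim: N => // N IH in G GG c D l Gl *; rewrite ltnS => lN oD Dc.
have [f Lf] := lift_liftable c GG; have [Gf G1 GM GV Gn] := GG.
pose f' t := if pselect (liftable_at G c t) then f t else c t.
exists f' => t Dt.
have f'f s : liftable_at G c s -> f' s = f s by rewrite /f'; case: pselect.
have f'c s : exists2 g, G g & f' s = g *m c s.
  have [Ls|nLs] := pselect (liftable_at G c s).
    by rewrite f'f//; have [] := Lf s Ls.
  by exists 1%:M => //; rewrite mul1mx /f'; case: pselect.
split=> //.
have [Lt|nLt] := pselect (liftable_at G c t).
  have [d d0 Hd] := lift_component_nbhs Lt.
  have [_ [w Dw]] := Lf t Lt; exists w.
  apply: has_derivative_eq d0 _ Dw => s sd; rewrite f'f//.
  have [y [z [/andP[yt tz] _]]] := Hd s sd; apply.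
  by rewrite !ltW.
have [b Db] := Dc t Dt.
have fix_b g : G g -> g *m c t = c t /\ g *m b = b.
  move=> Gg; apply: contrapT => nfix; apply: nLt.
  have [d d0 [c' c'P]] := stabilizer_reduction GG oD Dt Dc Db.
  pose H := [set g | [/\ G g, g *m c t = c t & g *m b = b]].
  have [||||h Lh] := IH H (stabilizer_group _ _ GG) c' [set s | `|s - t| < d]
      [seq g <- l | `[< H g >]].
  - apply/seteqP; split=> h /=; rewrite mem_filter => /=.
      move=> Hh; apply/andP; split; first exact/asboolP.
      by case: Hh => + _ _; rewrite Gl.
    by move=> /andP[/asboolP].
  - apply: leq_trans lN; rewrite size_filter ltn_neqAle count_size andbT.
    rewrite -all_count; apply/allPn; exists g; first by move: Gg; rewrite Gl.
    by apply/asboolPn => -[_ H1 H2]; apply: nfix.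
  - exact: open_ball_norm.
  - by move=> s /c'P[].
  exists d => //; exists h => s sd; have [[k [Gk _ _] hk] Dh] := Lh s sd.
  split=> //; rewrite hk; have [[g' Gg' ->] _] := c'P s sd.
  by exists (k *m g'); [exact: GM | rewrite mulmxA].
exists b => e /Db; apply: filterS => s [g Gg]; rewrite addr0.
have [gc gb] := fix_b g Gg; rewrite mulmxDr -scalemxAr gc gb => gP.
have [h Gh ->] := f'c (t + s); have [h0 Gh0 ->] := f'c t.
have [hc hb] := fix_b h Gh; rewrite (fix_b h0 Gh0).1.
have -> : c t + s *: b = h *m (c t + s *: b).
  by rewrite mulmxDr -scalemxAr hc hb.
by rewrite -mulmxBr (isometry_group_norm _ GG Gh).
Qed.

End Lifting.

(** * Regularity near the axes, and extraction of roots *)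

Section Slices.
Variables (R : realType) (X : Type).
Implicit Types (f g a b c x y z : X -> R -> R).

(** A square root which stays away from 0 is a simple root. *)
Lemma Tay_sqrt k f (e : R) : 0 < e -> Tay 0 f ->
  Tay k (fun i s => f i s ^+ 2) -> (forall i, e <= `|f i 0|) -> Tay k f.
Proof.
move=> e0 Tf Tf2 fe.
apply: (@Tay_implicit _ _ k f (fun i s => f i s + f i 0)
  (fun i s => f i s ^+ 2 - f i 0 ^+ 2) (e + e)) => //.
- by rewrite addr_gt0.
- move=> j _ Tj; apply: TayD => //; exact: Tay_base Tj.
- by apply: TayB => //; exact: Tay_base Tf2.
- by move=> i; rewrite subrr.
- move=> i; by rewrite -[X in `|X|]mulr2n normrMn mulr2n lerD.
- by apply: unifW => i s; ring.
Qed.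

(** [a] is a simple root of the cubic polynomial with roots [a], [b], [c]; the
    quotient by the corresponding linear factor is a quadratic polynomial with
    regular coefficients, whose roots may coincide. *)
Lemma Tay_cubic_root k a b c (e : R) : 0 < e ->
  Tay 0 a -> Tay 0 b -> Tay 0 c ->
  Tay k (fun i s => a i s + b i s + c i s) ->
  Tay k (fun i s => a i s * b i s + b i s * c i s + c i s * a i s) ->
  Tay k (fun i s => a i s * b i s * c i s) ->
  (forall i, e <= `|(a i 0 - b i 0) * (a i 0 - c i 0)|) ->
  [/\ Tay k a, Tay k (fun i s => b i s + c i s) &
      Tay k (fun i s => b i s * c i s)].
Proof.
move=> e0 Ta Tb Tc T1 T2 T3 abc.
pose e1 i s := a i s + b i s + c i s.
pose e2 i s := a i s * b i s + b i s * c i s + c i s * a i s.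
pose e3 i s := a i s * b i s * c i s.
have Tka : Tay k a.
  apply: (@Tay_implicit _ _ k a
    (fun i s => - (a i 0 ^+ 2 - a i 0 * (e1 i s - a i s) +
       (e2 i s - a i s * (e1 i s - a i s))))
    (fun i s => a i 0 ^+ 3 - e1 i s * a i 0 ^+ 2 + e2 i s * a i 0 - e3 i s) e)
    => //.
  - move=> j jk Tja; have Tj0 := Tay_base Tja.
    have Tj1 := Tay_le jk T1; have Tj2 := Tay_le jk T2.
    apply: TayN; apply: TayD; first by apply: TayB; [exact: TayX | apply: TayM => //; exact: TayB].
    by apply: TayB => //; apply: TayM => //; exact: TayB.
  - have Tk0 : Tay k (fun i (_ : R) => a i 0) by apply: Tay_cst; exact: Tay_bnd0 Ta.
    apply: TayB => //; apply: TayD; last exact: TayM.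
    apply: TayB; first exact: TayX.
    by apply: TayM => //; exact: TayX.
  - by move=> i; rewrite /e1 /e2 /e3; ring.
  - move=> i; apply: le_trans (abc i) _.
    by rewrite normrN /e1 /e2 le_eqVlt; apply/orP; left; apply/eqP; congr `|_|; ring.
  - by apply: unifW => i s; rewrite /e1 /e2 /e3; ring.
have Ts : Tay k (fun i s => b i s + c i s).
  by apply: Tay_ext (TayB T1 Tka) => i s; ring.
split=> //; apply: Tay_ext (TayB T2 (TayM Tka Ts)) => i s; ring.
Qed.

Section Slice.
Variables (x y z : X -> R -> R) (k : nat).
Hypotheses (Tx : Tay 0 x) (Ty : Tay 0 y) (Tz : Tay 0 z).
Hypotheses (T2 : Tay k (fun i s => x i s ^+ 2 + y i s ^+ 2 + z i s ^+ 2))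
  (T4 : Tay k (fun i s => x i s ^+ 2 * y i s ^+ 2 + y i s ^+ 2 * z i s ^+ 2 +
     z i s ^+ 2 * x i s ^+ 2))
  (T6 : Tay k (fun i s => x i s ^+ 2 * y i s ^+ 2 * z i s ^+ 2))
  (T9 : Tay k (fun i s => x i s * y i s * z i s * (x i s ^+ 2 - y i s ^+ 2) *
     (y i s ^+ 2 - z i s ^+ 2) * (z i s ^+ 2 - x i s ^+ 2))).

Lemma Tay_near_neq0 f (e : R) : 0 < e -> Tay 0 f ->
  (forall i, e <= `|f i 0|) -> unif (fun i s => f i s != 0).
Proof.
move=> e0 Tf fe; apply: filterS (Tay_lb e0 Tf fe) => s H i.
by rewrite -normr_gt0 (lt_le_trans _ (H i))// divr_gt0.
Qed.

(** Near an axis through the centre of a face, [x ^+ 2] is a simple root of the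
    cubic polynomial with roots [x ^+ 2], [y ^+ 2], [z ^+ 2]; then the factors
    of the invariant of degree 9 which do not vanish can be divided out.  The
    results are the coordinate along the axis and the basic invariants of the
    stabilizer, a cyclic group of order 4 acting on the coordinates [y], [z]. *)
Lemma face_slice : (forall i, 10^-1 <= x i 0 ^+ 2 - y i 0 ^+ 2) ->
  (forall i, 10^-1 <= x i 0 ^+ 2 - z i 0 ^+ 2) ->
  [/\ Tay k x, Tay k (fun i s => y i s ^+ 2 + z i s ^+ 2),
      Tay k (fun i s => y i s ^+ 4 - 6 * y i s ^+ 2 * z i s ^+ 2 + z i s ^+ 4) &
      Tay k (fun i s => y i s ^+ 3 * z i s - y i s * z i s ^+ 3)].
Proof.
move=> xy xz; have e0 : 0 < 10^-1 :> R by rewrite invr_gt0.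
have e00 : 0 < 100^-1 :> R by rewrite invr_gt0.
have N0 i : 100^-1 <= (x i 0 ^+ 2 - y i 0 ^+ 2) * (x i 0 ^+ 2 - z i 0 ^+ 2).
  by have := xy i; have := xz i; nra.
have [Ta Ts Tp] := Tay_cubic_root e00 (TayX 2 Tx) (TayX 2 Ty) (TayX 2 Tz) T2 T4 T6
  (fun i => le_trans (N0 i) (ler_norm _)).
have x0 i : 10^-1 <= `|x i 0|.
  have x2 : `|x i 0| ^+ 2 = x i 0 ^+ 2 by rewrite real_normK ?num_real.
  have := xy i; have := sqr_ge0 (y i 0); have := normr_ge0 (x i 0); nra.
have Tkx := Tay_sqrt e0 Tx Ta x0.
have TN : Tay k (fun i s => (x i s ^+ 2 - y i s ^+ 2) * (x i s ^+ 2 - z i s ^+ 2)).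
  apply: (@Tay_ext _ _ _ (fun i s => x i s ^+ 2 * x i s ^+ 2 -
    x i s ^+ 2 * (y i s ^+ 2 + z i s ^+ 2) + y i s ^+ 2 * z i s ^+ 2)).
    by move=> i s; ring.
  by apply: TayD => //; apply: TayB; apply: TayM.
have TxN := TayM Tkx TN.
have xN0 i : 10^-1 * 100^-1 <=
    `|x i 0 * ((x i 0 ^+ 2 - y i 0 ^+ 2) * (x i 0 ^+ 2 - z i 0 ^+ 2))|.
  rewrite normrM ler_pM// ?invr_ge0//.
  exact: le_trans (N0 i) (ler_norm _).
have e000 : 0 < 10^-1 * 100^-1 :> R by rewrite mulr_gt0.
split=> //.
  apply: (@Tay_ext _ _ _ (fun i s => (y i s ^+ 2 + z i s ^+ 2) *
    (y i s ^+ 2 + z i s ^+ 2) - 8 * (y i s ^+ 2 * z i s ^+ 2))).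
    by move=> i s; ring.
  by apply: TayB; apply: TayM => //; exact: Tay_num.
apply: (Tay_eq _ (TayN (TayM T9 (TayV e000 TxN xN0)))).
apply: filterS (Tay_near_neq0 e000 (Tay_le (leq0n _) TxN) xN0) => s H i.
have := H i; rewrite !mulf_eq0 !negb_or => /and3P[H1 H2 H3].
by field; rewrite H1 H2 H3.
Qed.

(** Near an axis through the midpoint of an edge, the simple root is [z ^+ 2],
    and [x * y] and [x + y] are square roots of functions without zeros. *)
Lemma edge_slice : (forall i, 10^-1 <= x i 0 ^+ 2 - z i 0 ^+ 2) ->
  (forall i, 10^-1 <= y i 0 ^+ 2 - z i 0 ^+ 2) ->
  (forall i, 0 <= x i 0 * y i 0) ->
  [/\ Tay k (fun i s => x i s + y i s), Tay k (fun i s => (x i s - y i s) ^+ 2),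
      Tay k (fun i s => z i s ^+ 2) & Tay k (fun i s => (x i s - y i s) * z i s)].
Proof.
move=> xz yz xy0; have e0 : 0 < 10^-1 :> R by rewrite invr_gt0.
have e00 : 0 < 100^-1 :> R by rewrite invr_gt0.
have N0 i : 100^-1 <= (z i 0 ^+ 2 - x i 0 ^+ 2) * (z i 0 ^+ 2 - y i 0 ^+ 2).
  by have := xz i; have := yz i; nra.
have [||||Tc Ts Tp] := @Tay_cubic_root k (fun i s => z i s ^+ 2)
    (fun i s => x i s ^+ 2) (fun i s => y i s ^+ 2) _ e00 (TayX 2 Tz)
    (TayX 2 Tx) (TayX 2 Ty).
- by apply: Tay_ext T2 => i s; ring.
- by apply: Tay_ext T4 => i s; ring.
- by apply: Tay_ext T6 => i s; ring.
- by move=> i; apply: le_trans (N0 i) (ler_norm _).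
have m0 i : 10^-1 <= `|x i 0 * y i 0|.
  rewrite ger0_norm//.
  have : 100^-1 <= (x i 0 * y i 0) ^+ 2.
    have := xz i; have := yz i; have := sqr_ge0 (z i 0); rewrite exprMn; nra.
  by have := xy0 i; nra.
have Tm : Tay k (fun i s => x i s * y i s).
  apply: Tay_sqrt e0 (TayM Tx Ty) _ m0.
  by apply: Tay_ext Tp => i s; rewrite exprMn.
have q0 i : 10^-1 <= `|x i 0 + y i 0|.
  have q2 : `|x i 0 + y i 0| ^+ 2 = (x i 0 + y i 0) ^+ 2.
    by rewrite real_normK ?num_real.
  have := xz i; have := xy0 i; have := normr_ge0 (x i 0 + y i 0).
  have := sqr_ge0 (z i 0); have := sqr_ge0 (y i 0); nra.
have Tq : Tay k (fun i s => x i s + y i s).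
  apply: Tay_sqrt e0 (TayD Tx Ty) _ q0.
  apply: (@Tay_ext _ _ _ (fun i s => x i s ^+ 2 + y i s ^+ 2 + 2 * (x i s * y i s))).
    by move=> i s; ring.
  by apply: TayD => //; apply: TayM => //; exact: Tay_num.
have TN : Tay k (fun i s => (z i s ^+ 2 - x i s ^+ 2) * (z i s ^+ 2 - y i s ^+ 2)).
  apply: (@Tay_ext _ _ _ (fun i s => z i s ^+ 2 * z i s ^+ 2 -
    z i s ^+ 2 * (x i s ^+ 2 + y i s ^+ 2) + x i s ^+ 2 * y i s ^+ 2)).
    by move=> i s; ring.
  by apply: TayD => //; apply: TayB; apply: TayM.
have TJ := TayM (TayM Tm Tq) TN.
have J0 i : 10^-1 * 10^-1 * 100^-1 <= `|x i 0 * y i 0 * (x i 0 + y i 0) *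
    ((z i 0 ^+ 2 - x i 0 ^+ 2) * (z i 0 ^+ 2 - y i 0 ^+ 2))|.
  rewrite normrM ler_pM// ?mulr_ge0 ?invr_ge0//.
    by rewrite normrM ler_pM// invr_ge0.
  exact: le_trans (N0 i) (ler_norm _).
have e4 : 0 < 10^-1 * 10^-1 * 100^-1 :> R by rewrite !mulr_gt0.
split=> //.
  apply: (@Tay_ext _ _ _ (fun i s => x i s ^+ 2 + y i s ^+ 2 - 2 * (x i s * y i s))).
    by move=> i s; ring.
  by apply: TayB => //; apply: TayM => //; exact: Tay_num.
apply: (Tay_eq _ (TayN (TayM T9 (TayV e4 TJ J0)))).
apply: filterS (Tay_near_neq0 e4 (Tay_le (leq0n _) TJ) J0) => s H i.
have := H i; rewrite !mulf_eq0 !negb_or => /andP[/andP[/andP[H1 H2] H3] /andP[H4 H5]].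
by field; rewrite H1 H2 H3 H4 H5.
Qed.

(** Near the axes through the vertices, [q = x + y + z] is a simple root of
    the quartic [(q ^+ 2 - e1) ^+ 2 - 4 e2 - 8 m q], where [m = x y z]. *)
Lemma vertex_slice : (forall i, 10^-1 <= x i 0) -> (forall i, 10^-1 <= y i 0) ->
  (forall i, 10^-1 <= z i 0) ->
  [/\ Tay k (fun i s => x i s + y i s + z i s),
      Tay k (fun i s => x i s * y i s + y i s * z i s + z i s * x i s),
      Tay k (fun i s => x i s * y i s * z i s) &
      Tay k (fun i s => (x i s - y i s) * (y i s - z i s) * (z i s - x i s))].
Proof.
move=> x0 y0 z0.
pose e : R := 10^-1 * 10^-1 * 10^-1.
have i10 : 0 <= 10^-1 :> R by rewrite invr_ge0.
have e3 : 0 < e by rewrite !mulr_gt0.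
have m0 i : e <= x i 0 * y i 0 * z i 0 by rewrite !ler_pM// mulr_ge0.
have Tm : Tay k (fun i s => x i s * y i s * z i s).
  apply: Tay_sqrt e3 (TayM (TayM Tx Ty) Tz) _ (fun i => le_trans (m0 i) (ler_norm _)).
  by apply: Tay_ext T6 => i s; rewrite !exprMn.
pose q i s := x i s + y i s + z i s.
pose e1 i s := x i s ^+ 2 + y i s ^+ 2 + z i s ^+ 2.
pose e2 i s := x i s ^+ 2 * y i s ^+ 2 + y i s ^+ 2 * z i s ^+ 2 + z i s ^+ 2 * x i s ^+ 2.
pose m i s := x i s * y i s * z i s.
pose J i s := (x i s + y i s) * (y i s + z i s) * (z i s + x i s).
have J0 i : e <= J i 0.
  have := x0 i; have := y0 i; have := z0 i => hz hy hx.
  by rewrite !ler_pM ?mulr_ge0//; lra.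
have Tq0 : Tay 0 q by apply: TayD => //; exact: TayD.
have Tq : Tay k q.
  apply: (@Tay_implicit _ _ k q
    (fun i s => - ((q i s + q i 0) * (q i s ^+ 2 + q i 0 ^+ 2 - 2 * e1 i s) -
       8 * m i s))
    (fun i s => (q i 0 ^+ 2 - e1 i s) ^+ 2 - 4 * e2 i s - 8 * m i s * q i 0)
    (8 * e)) => //.
  - by rewrite mulr_gt0.
  - move=> j jk Tj; have Tj0 := Tay_base Tj.
    have Tj1 : Tay j e1 := Tay_le jk T2; have Tj2 : Tay j m := Tay_le jk Tm.
    apply/TayN/TayB; last by apply: TayM => //; exact: Tay_num.
    apply: TayM; first exact: TayD.
    apply: TayB; last by apply: TayM => //; exact: Tay_num.
    by apply: TayD; exact: TayX.
  - have Tk0 : Tay k (fun i (_ : R) => q i 0).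
      by apply: Tay_cst; exact: Tay_bnd0 Tq0.
    have Tm8 : Tay k (fun i s => 8 * m i s) by apply: TayM => //; exact: Tay_num.
    apply: TayB; last exact: TayM.
    apply: TayB; last by apply: TayM => //; exact: Tay_num.
    by apply: TayX; apply: TayB => //; exact: TayX.
  - by move=> i; rewrite /q /e1 /e2 /m; ring.
  - move=> i.
    have -> : - ((q i 0 + q i 0) * (q i 0 ^+ 2 + q i 0 ^+ 2 - 2 * e1 i 0) -
        8 * m i 0) = - (8 * J i 0) by rewrite /q /e1 /m /J; ring.
    by rewrite normrN; apply: le_trans (ler_norm _); rewrite ler_pM2l.
  - by apply: unifW => i s; rewrite /q /e1 /e2 /m; ring.
have Te2 : Tay k (fun i s => x i s * y i s + y i s * z i s + z i s * x i s).
  apply: (@Tay_ext _ _ _ (fun i s => 2^-1 * (q i s ^+ 2 - e1 i s))).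
    by move=> i s; rewrite /q /e1; field.
  apply: TayM; first exact: Tay_num.
  by apply: TayB => //; exact: TayX.
have TJ : Tay k J.
  apply: (@Tay_ext _ _ _ (fun i s => q i s * (x i s * y i s + y i s * z i s +
    z i s * x i s) - m i s)); first by move=> i s; rewrite /q /m /J; ring.
  by apply: TayB => //; exact: TayM.
split=> //.
have TmJ := TayM Tm TJ.
have mJ0 i : e * e <= `|x i 0 * y i 0 * z i 0 * J i 0|.
  by apply: le_trans (ler_norm _); rewrite ler_pM// ltW.
have e6 : 0 < e * e :> R by rewrite mulr_gt0.
apply: (Tay_eq _ (TayM T9 (TayV e6 TmJ mJ0))).
apply: filterS (Tay_near_neq0 e6 (Tay_le (leq0n _) TmJ) mJ0) => s H i.
have := H i; rewrite /J !mulf_eq0 !negb_or.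
move=> /andP[/andP[/andP[H1 H2] H3] /andP[/andP[H4 H5] H6]].
by field; rewrite H1 H2 H3 H4 H5 H6.
Qed.

End Slice.

(** A quotient whose numerator vanishes at the base point and has one
    derivative there. *)
Lemma Tay1_quotient f (D1 D2 a b Q : X -> R -> R) (e : R) : 0 < e -> Tay 0 f ->
  Tay 1 D1 -> Tay 1 D2 -> (forall i, D1 i 0 = 0) -> (forall i, D2 i 0 = 0) ->
  Tay 0 a -> Tay 0 b -> Tay 0 Q -> (forall i, e <= `|Q i 0|) ->
  (forall i s, (f i s - f i 0) * Q i s = D1 i s * a i s + D2 i s * b i s) ->
  Tay 1 f.
Proof.
move=> e0 Tf T1 T2 D10 D20 Ta Tb TQ Qe fE.
have [E1 TE1 E1E] := Tay_unroot T1 D10; have [E2 TE2 E2E] := Tay_unroot T2 D20.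
split; first exact: Tay_bnd0 Tf.
exists (fun i s => (E1 i s * a i s + E2 i s * b i s) * (Q i s)^-1).
  by apply: TayM; [apply: TayD; exact: TayM | exact: TayV e0 TQ Qe].
apply: filterS3 E1E E2E (Tay_near_neq0 e0 TQ Qe) => s H1 H2 HQ i.
apply: (addIr (- f i 0)); rewrite [RHS]addrC addKr.
apply: (mulIf (HQ i)); rewrite fE mulrA divfK ?HQ// H1 H2; ring.
Qed.

(** Extraction of a fourth root of [(y + i z) ^ 4], whose imaginary part is
    [4 (y ^ 3 z - y z ^ 3)], on the unit circle. *)
Lemma fourth_root_regular y z : Tay 0 y -> Tay 0 z ->
  (forall i, y i 0 ^+ 2 + z i 0 ^+ 2 = 1) ->
  Tay 1 (fun i s => y i s ^+ 4 - 6 * y i s ^+ 2 * z i s ^+ 2 + z i s ^+ 4) ->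
  Tay 1 (fun i s => y i s ^+ 3 * z i s - y i s * z i s ^+ 3) ->
  Tay 1 y /\ Tay 1 z.
Proof.
move=> Ty Tz yz1 TRe TIm.
have Ty0 := Tay_base Ty; have Tz0 := Tay_base Tz.
pose Re (y z : R) : R := y ^+ 4 - 6 * y ^+ 2 * z ^+ 2 + z ^+ 4.
pose Im (y z : R) : R := y ^+ 3 * z - y * z ^+ 3.
(* For [w = y + i z], the quotient [(w ^ 4 - w0 ^ 4) / (w - w0)], which is
   [(w + w0) (w ^ 2 + w0 ^ 2)], has real part [qr] and imaginary part [qi]. *)
pose A i s := y i s + y i 0; pose B i s := z i s + z i 0.
pose C i s := y i s ^+ 2 - z i s ^+ 2 + (y i 0 ^+ 2 - z i 0 ^+ 2).
pose D i s := 2 * (y i s * z i s) + 2 * (y i 0 * z i 0).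
pose qr i s := A i s * C i s - B i s * D i s.
pose qi i s := A i s * D i s + B i s * C i s.
have TA : Tay 0 A by apply: TayD.
have TB : Tay 0 B by apply: TayD.
have TC : Tay 0 C by rewrite /C; Tay_arith.
have TD : Tay 0 D by rewrite /D; Tay_arith.
have Tqr : Tay 0 qr by apply: TayB; apply: TayM.
have Tqi : Tay 0 qi by apply: TayD; apply: TayM.
have T1 : Tay 1 (fun i s => Re (y i s) (z i s) - Re (y i 0) (z i 0)).
  by apply: TayB => //; exact: (Tay_base TRe).
have T2 : Tay 1 (fun i s => 4 * (Im (y i s) (z i s) - Im (y i 0) (z i 0))).
  by apply: TayM; [exact: Tay_num | apply: TayB => //; exact: (Tay_base TIm)].
have TQ : Tay 0 (fun i s => qr i s ^+ 2 + qi i s ^+ 2) by Tay_arith.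
have Q0 i : 16 <= `|qr i 0 ^+ 2 + qi i 0 ^+ 2|.
  have -> : qr i 0 ^+ 2 + qi i 0 ^+ 2 = 16 * (y i 0 ^+ 2 + z i 0 ^+ 2) ^+ 3.
    by rewrite /qr /qi /A /B /C /D; ring.
  by rewrite yz1 expr1n mulr1 ger0_norm.
have p16 : 0 < 16 :> R by [].
split.
  apply: (Tay1_quotient p16 Ty T1 T2 _ _ Tqr Tqi TQ Q0).
  - by move=> i; rewrite subrr.
  - by move=> i; rewrite subrr mulr0.
  - by move=> i s; rewrite /Re /Im /qr /qi /A /B /C /D; ring.
apply: (Tay1_quotient p16 Tz T2 (TayN T1) _ _ Tqr Tqi TQ Q0).
- by move=> i; rewrite subrr mulr0.
- by move=> i; rewrite subrr oppr0.
- by move=> i s; rewrite /Re /Im /qr /qi /A /B /C /D; ring.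
Qed.

(** Extraction of a square root of [(y + i z) ^ 2] away from 0. *)
Lemma square_root_regular y z : Tay 0 y -> Tay 0 z ->
  (forall i, 1 <= y i 0 ^+ 2 + z i 0 ^+ 2) ->
  Tay 1 (fun i s => y i s ^+ 2) -> Tay 1 (fun i s => z i s ^+ 2) ->
  Tay 1 (fun i s => y i s * z i s) -> Tay 1 y /\ Tay 1 z.
Proof.
move=> Ty Tz yz1 Tyy Tzz Tyz.
have Ty0 := Tay_base Ty; have Tz0 := Tay_base Tz.
pose A i s := y i s + y i 0; pose B i s := z i s + z i 0.
have TA : Tay 0 A by apply: TayD.
have TB : Tay 0 B by apply: TayD.
have T1 : Tay 1 (fun i s => (y i s ^+ 2 - z i s ^+ 2) - (y i 0 ^+ 2 - z i 0 ^+ 2)).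
  by apply: TayB; [exact: TayB | exact: (Tay_base (TayB Tyy Tzz))].
have T2 : Tay 1 (fun i s => 2 * (y i s * z i s - y i 0 * z i 0)).
  by apply: TayM; [exact: Tay_num | apply: TayB => //; exact: (Tay_base Tyz)].
have TQ : Tay 0 (fun i s => A i s ^+ 2 + B i s ^+ 2) by Tay_arith.
have Q0 i : 4 <= `|A i 0 ^+ 2 + B i 0 ^+ 2|.
  have -> : A i 0 ^+ 2 + B i 0 ^+ 2 = 4 * (y i 0 ^+ 2 + z i 0 ^+ 2).
    by rewrite /A /B; ring.
  by rewrite (le_trans _ (ler_norm _))//; have := yz1 i; lra.
have p4 : 0 < 4 :> R by [].
split.
  apply: (Tay1_quotient p4 Ty T1 T2 _ _ TA TB TQ Q0).
  - by move=> i; rewrite subrr.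
  - by move=> i; rewrite subrr mulr0.
  - by move=> i s; rewrite /A /B; ring.
apply: (Tay1_quotient p4 Tz T2 (TayN T1) _ _ TA TB TQ Q0).
- by move=> i; rewrite subrr mulr0.
- by move=> i; rewrite subrr oppr0.
- by move=> i s; rewrite /A /B; ring.
Qed.

(** Extraction of a cube root of [(a + b w) ^ 3], where [w ^ 2 = - 1 - w] and the
    squared modulus of [a + b w] is [a ^ 2 - a b + b ^ 2]. *)
Lemma cube_root_regular a b : Tay 0 a -> Tay 0 b ->
  (forall i, 1 <= a i 0 ^+ 2 - a i 0 * b i 0 + b i 0 ^+ 2) ->
  Tay 1 (fun i s => a i s ^+ 3 - 3 * a i s * b i s ^+ 2 + b i s ^+ 3) ->
  Tay 1 (fun i s => 3 * a i s ^+ 2 * b i s - 3 * a i s * b i s ^+ 2) ->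
  Tay 1 a /\ Tay 1 b.
Proof.
move=> Ta Tb ab1 TA TB.
have Ta0 := Tay_base Ta; have Tb0 := Tay_base Tb.
pose A (a b : R) : R := a ^+ 3 - 3 * a * b ^+ 2 + b ^+ 3.
pose B (a b : R) : R := 3 * a ^+ 2 * b - 3 * a * b ^+ 2.
(* [c + d w] is the quotient of the difference of the cubes by that of the roots. *)
pose c i s := (a i s ^+ 2 - b i s ^+ 2) + (a i s * a i 0 - b i s * b i 0) +
  (a i 0 ^+ 2 - b i 0 ^+ 2).
pose d i s := (2 * (a i s * b i s) - b i s ^+ 2) +
  (a i s * b i 0 + b i s * a i 0 - b i s * b i 0) +
  (2 * (a i 0 * b i 0) - b i 0 ^+ 2).
have Tc : Tay 0 c by rewrite /c; Tay_arith.
have Td : Tay 0 d by rewrite /d; Tay_arith.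
have T1 : Tay 1 (fun i s => A (a i s) (b i s) - A (a i 0) (b i 0)).
  by apply: TayB => //; exact: (Tay_base TA).
have T2 : Tay 1 (fun i s => B (a i s) (b i s) - B (a i 0) (b i 0)).
  by apply: TayB => //; exact: (Tay_base TB).
have Tcd : Tay 0 (fun i s => c i s - d i s) by exact: TayB.
have TQ : Tay 0 (fun i s => c i s ^+ 2 - c i s * d i s + d i s ^+ 2) by Tay_arith.
have Q0 i : 1 <= `|c i 0 ^+ 2 - c i 0 * d i 0 + d i 0 ^+ 2|.
  have -> : c i 0 ^+ 2 - c i 0 * d i 0 + d i 0 ^+ 2 =
    9 * (a i 0 ^+ 2 - a i 0 * b i 0 + b i 0 ^+ 2) ^+ 2.
    by rewrite /c /d; ring.
  by rewrite (le_trans _ (ler_norm _))//; have := ab1 i; nra.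
split.
  apply: (Tay1_quotient ltr01 Ta T1 T2 _ _ Tcd Td TQ Q0).
  - by move=> i; rewrite subrr.
  - by move=> i; rewrite subrr.
  - by move=> i s; rewrite /A /B /c /d; ring.
apply: (Tay1_quotient ltr01 Tb T2 (TayN T1) _ _ Tc Td TQ Q0).
- by move=> i; rewrite subrr.
- by move=> i; rewrite subrr oppr0.
- by move=> i s; rewrite /A /B /c /d; ring.
Qed.

End Slices.

(** * Families of curves around a fixed vector *)

Section PlanarParts.
Variables (R : realType) (n : nat).
Local Notation V := 'cV[R]_n.

Lemma bounded_orbit_derivative_sub (G H : set 'M[R]_n) X (c : X -> R -> V) :
  H `<=` G -> bounded_orbit_derivative H c -> bounded_orbit_derivative G c.
Proof.
move=> HG [C HC]; exists C => x; have [w wC Dw] := HC x; exists w => // e /Dw.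
by apply: filterS => s [g /HG Gg gP]; exists g.
Qed.

Lemma Tay1_bounded_orbit_derivative (G : set 'M[R]_n) X (c : X -> R -> V) :
  G 1%:M -> (forall i, Tay 1 (fun x s => c x s i 0)) ->
  bounded_orbit_derivative G c.
Proof.
move=> G1 Tc.
have /choice[F FP] : forall i, exists F : X -> R -> R, Tay 0 F /\
    unif (fun x s => c x s i 0 = c x 0 i 0 + s * F x s).
  by move=> i; have [_ [F TF FE]] := Tc i; exists F.
have /choice[C HC] : forall i, exists C : R, forall x, `|F i x 0| <= C.
  by move=> i; have [/Tay_bnd0[C HC] _] := FP i; exists C.
exists (\sum_i `|C i|) => x; exists (\col_i F i x 0).
  apply/cV_norm_leP; first exact: sumr_ge0.
  move=> i; rewrite mxE (le_trans (HC i x))// (le_trans (ler_norm _))//.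
  by rewrite (bigD1 i)//= lerDl sumr_ge0.
move=> e e0.
have : \forall s \near (0 : R), forall i,
    `|c x s i 0 - (c x 0 i 0 + s * F i x 0)| <= e * `|s|.
  apply: (@filter_forall _ 'I_n (fun i s =>
    `|c x s i 0 - (c x 0 i 0 + s * F i x 0)| <= e * `|s|) (nbhs (0 : R))) => i.
  have [[_ /(_ e e0) FC] FE] := FP i.
  apply: filterS2 FC FE => s FC FE; rewrite FE opprD addrACA subrr add0r.
  by rewrite -mulrBr normrM mulrC ler_wpM2r.
apply: filterS => s Hs; exists 1%:M => //; rewrite mul1mx.
apply/cV_norm_leP; first by rewrite mulr_ge0// ltW.
by move=> i; rewrite !mxE; exact: Hs.
Qed.

(** Adding a component along a fixed vector of the group. *)
Lemma bounded_orbit_derivative_fixed (G : set 'M[R]_n) X (c : X -> R -> V)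
    (q : X -> R -> R) (a : V) : (forall g, G g -> g *m a = a) -> Tay 1 q ->
  bounded_orbit_derivative G c ->
  bounded_orbit_derivative G (fun x s => q x s *: a + c x s).
Proof.
move=> Ga [_ [q1 [[C qC] Tq1] qE]] [D HD].
exists (C * `|a| + D) => x; have [w wD Dw] := HD x.
exists (q1 x 0 *: a + w).
  by rewrite (le_trans (ler_normD _ _))// lerD// normrZ ler_wpM2r//; exact: qC.
move=> e e0; have a0 : 0 < 2 * (`|a| + 1) by rewrite mulr_gt0// ltr_wpDl.
have e20 : 0 < e / 2 by rewrite divr_gt0.
have ea : 0 < e / (2 * (`|a| + 1)) by rewrite divr_gt0.
apply: filterS3 (Dw _ e20) (Tq1 _ ea) qE => s [g Gg gP] Hq qE; exists g => //.
have -> : q x s *: a + c x s -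
    g *m (q x 0 *: a + c x 0 + s *: (q1 x 0 *: a + w)) =
    (s * (q1 x s - q1 x 0)) *: a + (c x s - g *m (c x 0 + s *: w)).
  rewrite (scalerDr s) addrACA (mulmxDr g (_ + _)) scalerA -scalerDl -scalemxAr Ga//.
  by rewrite qE opprD addrACA -scalerBl opprD addrACA subrr add0r -mulrBr.
have -> : e * `|s| = `|s| * (e / 2) + e / 2 * `|s| by field.
rewrite (le_trans (ler_normD _ _))// lerD//.
rewrite normrZ normrM -mulrA ler_wpM2l//.
apply: (@le_trans _ _ (e / (2 * (`|a| + 1)) * (`|a| + 1))).
  by apply: ler_pM => //; rewrite lerDl.
by rewrite le_eqVlt; apply/orP; left; apply/eqP; field; rewrite gt_eqF// ltr_wpDl.
Qed.

(** The squared norm is one of the invariants, so that the family is bounded near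
    0 and [orbit_selection] applies. *)
Lemma continuous_selection (G : set 'M[R]_n) (E : set V) m
    (h : 'I_m -> V -> R) k i0 X (c : X -> R -> V) :
  isometry_group G -> closed E -> (forall i, continuous (h i)) ->
  (forall u v, E u -> E v -> (forall i, h i u = h i v) ->
     exists2 g, G g & u = g *m v) ->
  (forall u, h i0 u = sqnorm u) ->
  (forall g u, G g -> E u -> E (g *m u)) ->
  (forall i g u, G g -> E u -> h i (g *m u) = h i u) ->
  invariant_family E h k c -> (forall x, sqnorm (c x 0) = 1) ->
  exists c' : X -> R -> V, [/\ forall x s, exists2 g, G g & c' x s = g *m c x s,
    invariant_family E h k c', forall x, c' x 0 = c x 0 &
    forall i, Tay 0 (fun x s => c' x s i 0)].
Proof.
move=> GG cE ch sep h0 EG hG [Ec Tc] c1.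
have T0 i : Tay 0 (fun x s => h i (c x s)) by exact: Tay_le (Tc i).
have cB : unif (fun x s => `|c x s| <= 1 + 2).
  have [_ /(_ 1 ltr01)] := T0 i0; apply: filterS => s Hs x.
  apply: norm_le_sqnorm; have := Hs x; rewrite !h0 c1 ler_norml; lra.
have [c' [c'c c'0 c'n]] := orbit_selection GG cE ch sep Ec cB T0.
exists c'; split => //.
  split=> [x s|i]; first by have [g Gg ->] := c'c x s; exact: EG.
  by apply: Tay_ext (Tc i) => x s; have [g Gg ->] := c'c x s; rewrite hG.
move=> i; split.
  by exists (1 + 2) => x; rewrite c'0 (le_trans (cV_coord_le _ _))// (unif0 cB).
move=> e /c'n; apply: filterS => s Hs x; rewrite c'0.
have -> : c' x s i 0 - c x 0 i 0 = (c' x s - c x 0) i 0 by rewrite !mxE.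
exact: le_trans (cV_coord_le _ _) (Hs x).
Qed.

End PlanarParts.

(** * Coordinates in dimension three *)

Section Vec3.
Variable R : realType.
Implicit Types (x y z : R) (u v : 'cV[R]_3).

Definition i0 : 'I_3 := @Ordinal 3 0 isT.
Definition i1 : 'I_3 := @Ordinal 3 1 isT.
Definition i2 : 'I_3 := @Ordinal 3 2 isT.

Lemma forall_I3 (P : 'I_3 -> Prop) : P i0 -> P i1 -> P i2 -> forall i, P i.
Proof.
move=> P0 P1 P2 [[|[|[|//]]] Hi].
- by rewrite (_ : Ordinal Hi = i0)//; exact: val_inj.
- by rewrite (_ : Ordinal Hi = i1)//; exact: val_inj.
- by rewrite (_ : Ordinal Hi = i2)//; exact: val_inj.
Qed.

Lemma sum_I3 (F : 'I_3 -> R) : \sum_i F i = F i0 + F i1 + F i2.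
Proof.
rewrite !big_ord_recl big_ord0 addr0 addrA.
by congr (F _ + F _ + F _); exact: val_inj.
Qed.

Definition vec3 x y z : 'cV[R]_3 := \col_i nth 0 [:: x; y; z] i.

Lemma vec3_0 x y z : vec3 x y z i0 0 = x. Proof. by rewrite mxE. Qed.
Lemma vec3_1 x y z : vec3 x y z i1 0 = y. Proof. by rewrite mxE. Qed.
Lemma vec3_2 x y z : vec3 x y z i2 0 = z. Proof. by rewrite mxE. Qed.
Definition vec3E := (vec3_0, vec3_1, vec3_2).

Lemma vec3_eta u : u = vec3 (u i0 0) (u i1 0) (u i2 0).
Proof. by apply/colP; apply: forall_I3; rewrite vec3E. Qed.

Lemma vec3_inj x y z x' y' z' : vec3 x y z = vec3 x' y' z' ->
  [/\ x = x', y = y' & z = z'].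
Proof.
move=> /colP E; have := E i0; have := E i1; have := E i2.
by rewrite !vec3E.
Qed.

Definition mat3 (a b c d e f g h k : R) : 'M[R]_3 :=
  \matrix_(i, j) nth 0 (nth [::] [:: [:: a; b; c]; [:: d; e; f]; [:: g; h; k]] i) j.

Lemma mat3_eta (A : 'M[R]_3) : A = mat3 (A i0 i0) (A i0 i1) (A i0 i2)
  (A i1 i0) (A i1 i1) (A i1 i2) (A i2 i0) (A i2 i1) (A i2 i2).
Proof. by apply/matrixP; apply: forall_I3; apply: forall_I3; rewrite !mxE. Qed.

Lemma mat3_vec3 a b c d e f g h k x y z : mat3 a b c d e f g h k *m vec3 x y z =
  vec3 (a * x + b * y + c * z) (d * x + e * y + f * z) (g * x + h * y + k * z).
Proof. by apply/colP; apply: forall_I3; rewrite !mxE sum_I3 !mxE. Qed.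

Lemma mat3_tr a b c d e f g h k :
  (mat3 a b c d e f g h k)^T = mat3 a d g b e h c f k.
Proof. by apply/matrixP; apply: forall_I3; apply: forall_I3; rewrite !mxE. Qed.

Lemma det_mat3 a b c d e f g h k : \det (mat3 a b c d e f g h k) =
  a * (e * k - f * h) - b * (d * k - f * g) + c * (d * h - e * g).
Proof.
rewrite (expand_det_row _ i0) sum_I3 /cofactor.
rewrite !(expand_det_row _ ord0) !big_ord_recl !big_ord0 /cofactor !det_mx11 !mxE /=.
rewrite /bump /=; ring.
Qed.

Lemma sqnorm3 u : sqnorm u = u i0 0 ^+ 2 + u i1 0 ^+ 2 + u i2 0 ^+ 2.
Proof. exact: sum_I3. Qed.

End Vec3.

(** * The rotation group of the cube and its invariants *)

Section CubeGroup.
Variable R : realType.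
Implicit Types (x y z : R) (u v : 'cV[R]_3).
Local Notation W := (cube_rotations R).

Lemma cubeE u : cube u <-> `|u| <= 1.
Proof. by rewrite cV_norm_leP. Qed.

Lemma cube_rotations_isometry_group : isometry_group W.
Proof.
have [Wf WO W1 WM WV] := cube_rotations_group R; split => //.
  move=> g Wg; exists (invmx g); first exact: WV.
  by rewrite mulVmx//; case: (mulmx1_unit (WO g Wg)).
move=> g u [_ _ gC]; have [->|u0] := eqVneq u 0; first by rewrite mulmx0.
have nu : 0 < `|u| by rewrite normr_gt0.
have : cube (g *m (`|u|^-1 *: u)).
  rewrite -gC; exists (`|u|^-1 *: u) => //; apply/cubeE.
  by rewrite normrZ normfV normr_id mulVf// gt_eqF.
move=> /cubeE; rewrite -scalemxAr normrZ normfV normr_id mulrC.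
by rewrite ler_pdivrMr// mul1r.
Qed.

Lemma cube_rotation_intro (A : 'M[R]_3) : A *m A^T = 1%:M -> \det A = 1 ->
  (forall u, cube u -> cube (A *m u)) -> (forall u, cube u -> cube (A^T *m u)) ->
  W A.
Proof.
move=> AAT dA AC ATC; split => //; apply/seteqP; split=> [_ [u Cu <-]|u Cu].
  exact: AC.
by exists (A^T *m u); [exact: ATC | rewrite mulmxA AAT mul1mx].
Qed.

(** Describing rotations by their effect on coordinates makes their composition
    hold by computation. *)
Definition cube_action (p q r : R -> R -> R -> R) := exists2 g, W g &
  forall x y z, g *m vec3 x y z = vec3 (p x y z) (q x y z) (r x y z).

Lemma cube_action_comp p q r p' q' r' :
  cube_action p q r -> cube_action p' q' r' ->
  cube_action (fun x y z => p' (p x y z) (q x y z) (r x y z))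
    (fun x y z => q' (p x y z) (q x y z) (r x y z))
    (fun x y z => r' (p x y z) (q x y z) (r x y z)).
Proof.
move=> [g Wg gE] [g' Wg' g'E]; exists (g' *m g).
  by have [_ _ WM _ _] := cube_rotations_isometry_group; exact: WM.
by move=> x y z; rewrite -mulmxA gE g'E.
Qed.

Lemma cube_action_rot : cube_action (fun x y z => y) (fun x y z => z) (fun x y z => x).
Proof.
exists (mat3 0 1 0 0 0 1 1 0 0); last first.
  by move=> x y z; rewrite mat3_vec3; congr vec3; ring.
apply: cube_rotation_intro.
- by rewrite mat3_tr; apply/matrixP; apply: forall_I3; apply: forall_I3;
    rewrite !mxE sum_I3 !mxE /=; ring.
- by rewrite det_mat3; ring.
- move=> u Cu; rewrite [u]vec3_eta mat3_vec3; apply: forall_I3; rewrite vec3E;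
    rewrite !(mul0r, mul1r, addr0, add0r); exact: Cu.
- move=> u Cu; rewrite [u]vec3_eta mat3_tr mat3_vec3; apply: forall_I3; rewrite vec3E;
    rewrite !(mul0r, mul1r, addr0, add0r); exact: Cu.
Qed.

Lemma cube_action_neg : cube_action (fun x y z => - x) (fun x y z => - y) (fun x y z => z).
Proof.
exists (mat3 (-1) 0 0 0 (-1) 0 0 0 1); last first.
  by move=> x y z; rewrite mat3_vec3; congr vec3; ring.
apply: cube_rotation_intro.
- by rewrite mat3_tr; apply/matrixP; apply: forall_I3; apply: forall_I3;
    rewrite !mxE sum_I3 !mxE /=; ring.
- by rewrite det_mat3; ring.
- move=> u Cu; rewrite [u]vec3_eta mat3_vec3; apply: forall_I3; rewrite vec3E;
    rewrite !(mul0r, mulN1r, mul1r, addr0, add0r) ?normrN; exact: Cu.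
- move=> u Cu; rewrite [u]vec3_eta mat3_tr mat3_vec3; apply: forall_I3; rewrite vec3E;
    rewrite !(mul0r, mulN1r, mul1r, addr0, add0r) ?normrN; exact: Cu.
Qed.

Lemma cube_action_swap : cube_action (fun x y z => y) (fun x y z => x) (fun x y z => - z).
Proof.
exists (mat3 0 1 0 1 0 0 0 0 (-1)); last first.
  by move=> x y z; rewrite mat3_vec3; congr vec3; ring.
apply: cube_rotation_intro.
- by rewrite mat3_tr; apply/matrixP; apply: forall_I3; apply: forall_I3;
    rewrite !mxE sum_I3 !mxE /=; ring.
- by rewrite det_mat3; ring.
- move=> u Cu; rewrite [u]vec3_eta mat3_vec3; apply: forall_I3; rewrite vec3E;
    rewrite !(mul0r, mulN1r, mul1r, addr0, add0r) ?normrN; exact: Cu.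
- move=> u Cu; rewrite [u]vec3_eta mat3_tr mat3_vec3; apply: forall_I3; rewrite vec3E;
    rewrite !(mul0r, mulN1r, mul1r, addr0, add0r) ?normrN; exact: Cu.
Qed.

Lemma cube_action_ext p q r p' q' r' : cube_action p q r ->
  (forall x y z, [/\ p x y z = p' x y z, q x y z = q' x y z & r x y z = r' x y z]) ->
  cube_action p' q' r'.
Proof.
move=> [g Wg gE] E; exists g => // x y z.
by rewrite gE; have [-> -> ->] := E x y z.
Qed.

Let rot := cube_action_rot.
Let neg := cube_action_neg.
Let swap := cube_action_swap.
Let rot2 := cube_action_comp rot rot.

Lemma cube_action_neg_xz : cube_action (fun x y z => - x) (fun x y z => y) (fun x y z => - z).
Proof. exact: (cube_action_comp (cube_action_comp rot2 neg) rot). Qed.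

Lemma cube_action_neg_yz : cube_action (fun x y z => x) (fun x y z => - y) (fun x y z => - z).
Proof. exact: (cube_action_comp (cube_action_comp rot neg) rot2). Qed.

Lemma cube_action_swap_yz : cube_action (fun x y z => - x) (fun x y z => z) (fun x y z => y).
Proof. exact: (cube_action_comp (cube_action_comp rot swap) rot2). Qed.

Lemma cube_action_swap_xz : cube_action (fun x y z => z) (fun x y z => - y) (fun x y z => x).
Proof. exact: (cube_action_comp (cube_action_comp rot2 swap) rot). Qed.

Lemma cube_action_quarter : cube_action (fun x y z => x) (fun x y z => - z) (fun x y z => y).
Proof.
by apply: cube_action_ext (cube_action_comp cube_action_swap_yz cube_action_neg) _
  => x y z; split; rewrite ?opprK.
Qed.

Definition in_orbit u v := exists2 g, W g & v = g *m u.

Lemma in_orbit_refl u : in_orbit u u.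
Proof.
have [_ W1 _ _ _] := cube_rotations_isometry_group.
by exists 1%:M => //; rewrite mul1mx.
Qed.

Lemma in_orbit_trans v u w : in_orbit u v -> in_orbit v w -> in_orbit u w.
Proof.
have [_ _ WM _ _] := cube_rotations_isometry_group.
by move=> [g Wg ->] [h Wh ->]; exists (h *m g); [exact: WM | rewrite mulmxA].
Qed.

Lemma cube_action_orbit p q r x y z : cube_action p q r ->
  in_orbit (vec3 x y z) (vec3 (p x y z) (q x y z) (r x y z)).
Proof. by move=> [g Wg gE]; exists g. Qed.

Lemma orbit_rot x y z : in_orbit (vec3 x y z) (vec3 y z x).
Proof. exact: cube_action_orbit rot. Qed.
Lemma orbit_neg_xy x y z : in_orbit (vec3 x y z) (vec3 (- x) (- y) z).
Proof. exact: cube_action_orbit neg. Qed.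
Lemma orbit_neg_xz x y z : in_orbit (vec3 x y z) (vec3 (- x) y (- z)).
Proof. exact: cube_action_orbit cube_action_neg_xz. Qed.
Lemma orbit_neg_yz x y z : in_orbit (vec3 x y z) (vec3 x (- y) (- z)).
Proof. exact: cube_action_orbit cube_action_neg_yz. Qed.
Lemma orbit_swap_xy x y z : in_orbit (vec3 x y z) (vec3 y x (- z)).
Proof. exact: cube_action_orbit swap. Qed.
Lemma orbit_swap_yz x y z : in_orbit (vec3 x y z) (vec3 (- x) z y).
Proof. exact: cube_action_orbit cube_action_swap_yz. Qed.
Lemma orbit_swap_xz x y z : in_orbit (vec3 x y z) (vec3 z (- y) x).
Proof. exact: cube_action_orbit cube_action_swap_xz. Qed.

(** The first three invariants are the elementary symmetric functions of the
    squared coordinates, which generate the invariants of the full symmetry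
    group of the cube; [inv9] is the product of the linear forms vanishing on
    its nine reflection planes and changes sign under the reflections. *)
Definition inv2 u := u i0 0 ^+ 2 + u i1 0 ^+ 2 + u i2 0 ^+ 2.
Definition inv4 u := u i0 0 ^+ 2 * u i1 0 ^+ 2 + u i1 0 ^+ 2 * u i2 0 ^+ 2 +
  u i2 0 ^+ 2 * u i0 0 ^+ 2.
Definition inv6 u := u i0 0 ^+ 2 * u i1 0 ^+ 2 * u i2 0 ^+ 2.
Definition inv9 u := u i0 0 * u i1 0 * u i2 0 * (u i0 0 ^+ 2 - u i1 0 ^+ 2) *
  (u i1 0 ^+ 2 - u i2 0 ^+ 2) * (u i2 0 ^+ 2 - u i0 0 ^+ 2).

(** Points with the same squared coordinates: either they differ by an even
    number of signs, or by an odd one, and then [inv9] vanishes and the point is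
    fixed by a reflection of the full symmetry group. *)
Lemma orbit_of_equal_squares x y z x' y' z' : x' ^+ 2 = x ^+ 2 -> y' ^+ 2 = y ^+ 2 ->
  z' ^+ 2 = z ^+ 2 -> inv9 (vec3 x' y' z') = inv9 (vec3 x y z) ->
  in_orbit (vec3 x y z) (vec3 x' y' z').
Proof.
move=> /eqP + /eqP + /eqP; rewrite !eqf_sqr.
have antipode : inv9 (vec3 (- x) (- y) (- z)) = inv9 (vec3 x y z) ->
    in_orbit (vec3 x y z) (vec3 (- x) (- y) (- z)).
  rewrite /inv9 !vec3E => H.
  have /eqP : x * y * z * (x ^+ 2 - y ^+ 2) * (y ^+ 2 - z ^+ 2) * (z ^+ 2 - x ^+ 2) = 0.
    by move: H; rewrite !sqrrN; lra.
  rewrite !mulf_eq0 !subr_eq0 !eqf_sqr.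
  move=> /orP[/orP[/orP[/orP[/orP[]|]|/orP[]]|/orP[]]|/orP[]] /eqP E; subst.
  - by rewrite oppr0; exact: orbit_neg_yz.
  - by rewrite oppr0; exact: orbit_neg_xz.
  - by rewrite oppr0; exact: orbit_neg_xy.
  - exact: in_orbit_trans (orbit_neg_xy _ _ _) (orbit_swap_xy _ _ _).
  - by rewrite opprK; apply: in_orbit_trans (orbit_swap_xy _ _ _) _; exact: in_orbit_refl.
  - exact: in_orbit_trans (orbit_neg_yz _ _ _) (orbit_swap_yz _ _ _).
  - by rewrite opprK; apply: in_orbit_trans (orbit_swap_yz _ _ _) _; exact: in_orbit_refl.
  - exact: in_orbit_trans (orbit_neg_xz _ _ _) (orbit_swap_xz _ _ _).
  - by rewrite opprK; apply: in_orbit_trans (orbit_swap_xz _ _ _) _; exact: in_orbit_refl.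
have N9 : inv9 (vec3 (- x) (- y) (- z)) = - inv9 (vec3 x y z).
  by rewrite /inv9 !vec3E !sqrrN; ring.
move=> /orP[] /eqP -> /orP[] /eqP -> /orP[] /eqP -> H.
- exact: in_orbit_refl.
- apply: in_orbit_trans (antipode _) _; last first.
    by rewrite -{2}[x]opprK -{2}[y]opprK; exact: orbit_neg_xy.
  by rewrite N9 -[RHS]H /inv9 !vec3E; ring.
- apply: in_orbit_trans (antipode _) _; last first.
    by rewrite -{2}[x]opprK -{2}[z]opprK; exact: orbit_neg_xz.
  by rewrite N9 -[RHS]H /inv9 !vec3E; ring.
- exact: orbit_neg_yz.
- apply: in_orbit_trans (antipode _) _; last first.
    by rewrite -{2}[y]opprK -{2}[z]opprK; exact: orbit_neg_yz.
  by rewrite N9 -[RHS]H /inv9 !vec3E; ring.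
- exact: orbit_neg_xz.
- exact: orbit_neg_xy.
- exact: antipode.
Qed.

(** The symmetric functions determine the squared coordinates up to order. *)
Lemma cube_separation u v : inv2 u = inv2 v -> inv4 u = inv4 v ->
  inv6 u = inv6 v -> inv9 u = inv9 v -> in_orbit v u.
Proof.
rewrite [u]vec3_eta [v]vec3_eta.
move: (u i0 0) (u i1 0) (u i2 0) (v i0 0) (v i1 0) (v i2 0) => x' y' z' x y z.
have first_eq a b c : x' ^+ 2 = a ^+ 2 ->
    inv2 (vec3 x' y' z') = inv2 (vec3 a b c) ->
    inv4 (vec3 x' y' z') = inv4 (vec3 a b c) ->
    inv9 (vec3 x' y' z') = inv9 (vec3 a b c) ->
    in_orbit (vec3 a b c) (vec3 x' y' z').
  rewrite /inv2 /inv4 !vec3E => xa H2 H4 H9.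
  have S : y' ^+ 2 + z' ^+ 2 = b ^+ 2 + c ^+ 2 by lra.
  have P : y' ^+ 2 * z' ^+ 2 = b ^+ 2 * c ^+ 2.
    have : a ^+ 2 * (y' ^+ 2 + z' ^+ 2) = a ^+ 2 * (b ^+ 2 + c ^+ 2) by rewrite S.
    by move: H4; rewrite xa; lra.
  have /eqP : (y' ^+ 2 - b ^+ 2) * (y' ^+ 2 - c ^+ 2) = 0.
    have -> : (y' ^+ 2 - b ^+ 2) * (y' ^+ 2 - c ^+ 2) =
      y' ^+ 2 * (y' ^+ 2 + z' ^+ 2) - y' ^+ 2 * (b ^+ 2 + c ^+ 2) -
      (y' ^+ 2 * z' ^+ 2 - b ^+ 2 * c ^+ 2) by ring.
    by rewrite S P !subrr.
  rewrite mulf_eq0 !subr_eq0 => /orP[/eqP yb|/eqP yc].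
    by apply: orbit_of_equal_squares => //; lra.
  apply: in_orbit_trans (orbit_swap_yz a b c) _.
  apply: orbit_of_equal_squares; rewrite ?sqrrN//; first by lra.
  by rewrite H9 /inv9 !vec3E sqrrN; ring.
move=> H2 H4 H6 H9.
have /eqP : (x' ^+ 2 - x ^+ 2) * (x' ^+ 2 - y ^+ 2) * (x' ^+ 2 - z ^+ 2) = 0.
  have -> : (x' ^+ 2 - x ^+ 2) * (x' ^+ 2 - y ^+ 2) * (x' ^+ 2 - z ^+ 2) =
    x' ^+ 4 * (inv2 (vec3 x' y' z') - inv2 (vec3 x y z)) -
    x' ^+ 2 * (inv4 (vec3 x' y' z') - inv4 (vec3 x y z)) +
    (inv6 (vec3 x' y' z') - inv6 (vec3 x y z)).
    by rewrite /inv2 /inv4 /inv6 !vec3E; ring.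
  by rewrite H2 H4 H6 !subrr !mulr0 subr0 addr0.
rewrite !mulf_eq0 !subr_eq0 => /orP[/orP[]|] /eqP E.
- exact: first_eq.
- apply: in_orbit_trans (orbit_rot x y z) _; apply: first_eq => //.
  + by rewrite H2 /inv2 !vec3E; ring.
  + by rewrite H4 /inv4 !vec3E; ring.
  + by rewrite H9 /inv9 !vec3E; ring.
- apply: in_orbit_trans (in_orbit_trans (orbit_rot x y z) (orbit_rot y z x)) _.
  apply: first_eq => //.
  + by rewrite H2 /inv2 !vec3E; ring.
  + by rewrite H4 /inv4 !vec3E; ring.
  + by rewrite H9 /inv9 !vec3E; ring.
Qed.

(** Every point of the unit sphere is in the orbit of a point near one of the
    three kinds of rotation axes. *)
Lemma axis_regions u : inv2 u = 1 -> exists x y z, in_orbit u (vec3 x y z) /\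
  [\/ 10^-1 <= x ^+ 2 - y ^+ 2 /\ 10^-1 <= x ^+ 2 - z ^+ 2,
      [/\ 10^-1 <= x ^+ 2 - z ^+ 2, 10^-1 <= y ^+ 2 - z ^+ 2 & 0 <= x * y] |
      [/\ 10^-1 <= x, 10^-1 <= y & 10^-1 <= z]].
Proof.
move=> u1.
have [x [y [z [ouv xy yz xyz]]]] : exists x y z, [/\ in_orbit u (vec3 x y z),
    y ^+ 2 <= x ^+ 2, z ^+ 2 <= y ^+ 2 & x ^+ 2 + y ^+ 2 + z ^+ 2 = 1].
  have sort2 a b c : in_orbit u (vec3 a b c) -> a ^+ 2 + b ^+ 2 + c ^+ 2 = 1 ->
      b ^+ 2 <= a ^+ 2 -> c ^+ 2 <= a ^+ 2 -> exists x y z, [/\ in_orbit u (vec3 x y z),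
    y ^+ 2 <= x ^+ 2, z ^+ 2 <= y ^+ 2 & x ^+ 2 + y ^+ 2 + z ^+ 2 = 1].
    move=> o s ab ac; case: (leP (c ^+ 2) (b ^+ 2)) => [bc|/ltW cb].
      by exists a, b, c.
    exists (- a), c, b; split; rewrite ?sqrrN//; last by lra.
    exact: in_orbit_trans (orbit_swap_yz _ _ _).
  have := u1; rewrite /inv2; have := in_orbit_refl u; rewrite {2}[u]vec3_eta.
  move: (u i0 0) (u i1 0) (u i2 0) => a b c o s.
  have o1 := in_orbit_trans o (orbit_rot a b c).
  have o2 := in_orbit_trans o1 (orbit_rot b c a).
  case: (leP (b ^+ 2) (a ^+ 2)) => [ba|/ltW ab].
    case: (leP (c ^+ 2) (a ^+ 2)) => [ca|/ltW ac]; first exact: (sort2 a b c).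
    by apply: (sort2 c a b) => //; lra.
  case: (leP (c ^+ 2) (b ^+ 2)) => [cb|/ltW bc].
    by apply: (sort2 b c a) => //; lra.
  by apply: (sort2 c a b) => //; lra.
case: (leP 10^-1 (x ^+ 2 - y ^+ 2)) => [h1|h1].
  by exists x, y, z; split => //; constructor 1; split => //; lra.
case: (leP 10^-1 (y ^+ 2 - z ^+ 2)) => [h2|h2].
  case: (leP 0 (x * y)) => [h3|/ltW h3].
    by exists x, y, z; split => //; constructor 2; split => //; lra.
  exists (- x), y, (- z); split; first exact: in_orbit_trans (orbit_neg_xz _ _ _).
  by constructor 2; rewrite !sqrrN mulNr oppr_ge0; split => //; lra.
have sq (a : R) : 10^-1 <= a ^+ 2 -> 10^-1 <= `|a|.
  move=> ha; have : `|a| ^+ 2 = a ^+ 2 by rewrite real_normK ?num_real.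
  by have := normr_ge0 a; nra.
have x2 := sq x ltac:(lra); have y2 := sq y ltac:(lra); have z2 := sq z ltac:(lra).
suff : exists p q r, [/\ in_orbit u (vec3 p q r),
    10^-1 <= p, 10^-1 <= q & 10^-1 <= r].
  by move=> [p [q [r [upqr p0 q0 r0]]]]; exists p, q, r; split => //; constructor 3.
have even a b c : in_orbit u (vec3 a b c) -> 10^-1 <= `|a| -> 10^-1 <= `|b| ->
    10^-1 <= `|c| -> 0 <= a * b * c -> exists p q r, [/\ in_orbit u (vec3 p q r),
    10^-1 <= p, 10^-1 <= q & 10^-1 <= r].
  move=> o; case: (ler0P a) => a0 ha; case: (ler0P b) => b0 hb;
    case: (ler0P c) => c0 hc abc.
  - have ab : 0 < a * b by nra.
    exfalso; nra.
  - exists (- a), (- b), c; split => //; exact: in_orbit_trans (orbit_neg_xy _ _ _).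
  - exists (- a), b, (- c); split => //; exact: in_orbit_trans (orbit_neg_xz _ _ _).
  - have ab : a * b < 0 by nra.
    exfalso; nra.
  - exists a, (- b), (- c); split => //; exact: in_orbit_trans (orbit_neg_yz _ _ _).
  - have ab : a * b < 0 by nra.
    exfalso; nra.
  - have ab : 0 < a * b by nra.
    exfalso; nra.
  - by exists a, b, c.
case: (leP 0 (x * y * z)) => [h|/ltW h]; first exact: (even x y z).
apply: (even y x (- z)); rewrite ?normrN//.
  exact: in_orbit_trans (orbit_swap_xy _ _ _).
by rewrite mulrN oppr_ge0 (mulrC y).
Qed.

End CubeGroup.

(** * Rotations of the cube as signed permutation matrices *)

Section CubeRotationInvariants.
Variable R : realType.
Implicit Types (x y z : R) (u v : 'cV[R]_3).
Local Notation W := (cube_rotations R).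

(** Basic invariants of the stabilizers of the axes, acting on the orthogonal
    planes: [quartic_re] and [4 * quartic_im] are the real and imaginary parts
    of [(y + i z) ^ 4]; [edge_square] and [edge_product] come from the square of
    a complex number with real part [x - y]; and on the plane [x + y + z = 0] the
    cube of [(x - z) + (y - z) w], where [w ^ 2 = - 1 - w], has coordinates which
    are combinations of [coord_product] and [discriminant_root]. *)
Definition quartic_re u := u i1 0 ^+ 4 - 6 * u i1 0 ^+ 2 * u i2 0 ^+ 2 + u i2 0 ^+ 4.
Definition quartic_im u := u i1 0 ^+ 3 * u i2 0 - u i1 0 * u i2 0 ^+ 3.
Definition edge_square u := (u i0 0 - u i1 0) ^+ 2.
Definition edge_product u := (u i0 0 - u i1 0) * u i2 0.
Definition coord_product u := u i0 0 * u i1 0 * u i2 0.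
Definition discriminant_root u :=
  (u i0 0 - u i1 0) * (u i1 0 - u i2 0) * (u i2 0 - u i0 0).

Lemma unit_row_cases x y z : x \in [:: 0; 1; -1] -> y \in [:: 0; 1; -1] ->
  z \in [:: 0; 1; -1] -> x * x + y * y + z * z = 1 -> exists s : R,
    s \in [:: 1; -1] /\ [\/ [/\ x = s, y = 0 & z = 0], [/\ x = 0, y = s & z = 0] |
      [/\ x = 0, y = 0 & z = s]].
Proof.
rewrite !inE => /or3P[] /eqP-> /or3P[] /eqP-> /or3P[] /eqP-> E;
  try (by exfalso; lra);
  solve [ by exists 1; rewrite inE eqxx; split => //; constructor 1
        | by exists 1; rewrite inE eqxx; split => //; constructor 2
        | by exists 1; rewrite inE eqxx; split => //; constructor 3
        | by exists (-1); rewrite !inE eqxx orbT; split => //; constructor 1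
        | by exists (-1); rewrite !inE eqxx orbT; split => //; constructor 2
        | by exists (-1); rewrite !inE eqxx orbT; split => //; constructor 3 ].
Qed.

Definition signed_permutations (s t : R) : seq 'M[R]_3 :=
  [:: mat3 s 0 0 0 t 0 0 0 (s * t); mat3 s 0 0 0 0 t 0 (- (s * t)) 0;
      mat3 0 s 0 t 0 0 0 0 (- (s * t)); mat3 0 s 0 0 0 t (s * t) 0 0;
      mat3 0 0 s t 0 0 0 (s * t) 0; mat3 0 0 s 0 t 0 (- (s * t)) 0 0].

(** The first two rows are orthogonal signed unit vectors, and the third one is
    their cross product. *)
Lemma cube_rotation_cases (g : 'M[R]_3) : W g -> exists s t,
  [/\ s \in [:: 1; -1], t \in [:: 1; -1] & g \in signed_permutations s t].
Proof.
rewrite [g]mat3_eta; move: (g i0 i0) (g i0 i1) (g i0 i2) (g i1 i0) (g i1 i1)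
  (g i1 i2) (g i2 i0) (g i2 i1) (g i2 i2) => a b c d e f p q r {g} Wg.
have gE := cube_rotations_entries Wg; have [ggT dg _] := Wg.
have row k l := congr1 (fun M : 'M[R]_3 => M k l) ggT.
move: (gE i0 i0) (gE i0 i1) (gE i0 i2) (gE i1 i0) (gE i1 i1) (gE i1 i2)
  (row i0 i0) (row i1 i1) (row i0 i1) (row i0 i2) (row i1 i2) dg.
rewrite !mxE !sum_I3 !mxE /= !mulr1n !mulr0n det_mat3 {Wg gE ggT row}.
move=> ha hb hc hd he hf r00 r11.
have [s [hs row0]] := unit_row_cases ha hb hc r00.
have [t [ht row1]] := unit_row_cases hd he hf r11.
move: (hs) (ht); rewrite !inE => s1 t1 r01 r02 r12 dg.
exists s, t; split => //; move: r01 r02 r12 dg.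
case: row0 => -[-> -> ->]; case: row1 => -[-> -> ->];
  rewrite !(mulr0, mul0r, addr0, add0r, subr0, sub0r);
  case/orP: s1 => /eqP ->; case/orP: t1 => /eqP ->;
  rewrite ?(mulr1, mul1r, mulN1r, opprK) => /eqP;
  rewrite ?oppr_eq0 ?oner_eq0 // => _ /eqP + /eqP; rewrite ?oppr_eq0;
  move=> /eqP -> /eqP ->; rewrite ?(mulr0, oppr0, addr0, add0r, subr0, sub0r, opprK);
  move=> /eqP; rewrite ?eqr_oppLR => /eqP ->;
  by rewrite !inE ?(mulr1, mul1r, mulN1r, opprK) !eqxx ?orbT.
Qed.

Local Ltac enumerate_rotations Wg :=
  have [s [t [+ + +]]] := cube_rotation_cases Wg; rewrite !inE;
  move=> /orP[] /eqP -> /orP[] /eqP ->; rewrite ?(mulr1, mul1r, mulN1r, opprK);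
  do 5?[case/orP]; move=> /eqP ->.

Lemma cube_rotation_invariants (g : 'M[R]_3) u : W g ->
  [/\ inv2 (g *m u) = inv2 u, inv4 (g *m u) = inv4 u,
    inv6 (g *m u) = inv6 u & inv9 (g *m u) = inv9 u].
Proof.
move=> Wg; rewrite [u]vec3_eta; move: (u i0 0) (u i1 0) (u i2 0) => x y z.
rewrite /inv2 /inv4 /inv6 /inv9; enumerate_rotations Wg;
  rewrite mat3_vec3 !vec3E !(mul0r, mul1r, mulN1r, add0r, addr0) ?sqrrN; split; ring.
Qed.

Local Ltac column_contradiction :=
  rewrite mat3_vec3 !(mulr0, mulr1, addr0, add0r) => /vec3_inj[? ? ?];
  try (by exfalso; lra).

Lemma face_stabilizer_invariants (g : 'M[R]_3) y z (u := vec3 0 y z) : W g ->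
  g *m vec3 1 0 0 = vec3 1 0 0 ->
  [/\ (g *m u) i0 0 = 0, quartic_re (g *m u) = quartic_re u &
      quartic_im (g *m u) = quartic_im u].
Proof.
move=> Wg; rewrite /u /quartic_re /quartic_im; enumerate_rotations Wg;
  column_contradiction; rewrite mat3_vec3 !vec3E; split; ring.
Qed.

Lemma edge_stabilizer_invariants (g : 'M[R]_3) x z (u := vec3 x (- x) z) : W g ->
  g *m vec3 1 1 0 = vec3 1 1 0 ->
  [/\ (g *m u) i0 0 + (g *m u) i1 0 = 0, edge_square (g *m u) = edge_square u &
      edge_product (g *m u) = edge_product u].
Proof.
move=> Wg; rewrite /u /edge_square /edge_product; enumerate_rotations Wg;
  column_contradiction; rewrite mat3_vec3 !vec3E; split; ring.
Qed.

Lemma vertex_stabilizer_invariants (g : 'M[R]_3) x y z (u := vec3 x y z) : W g ->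
  g *m vec3 1 1 1 = vec3 1 1 1 ->
  [/\ (g *m u) i0 0 + (g *m u) i1 0 + (g *m u) i2 0 = x + y + z,
      coord_product (g *m u) = coord_product u &
      discriminant_root (g *m u) = discriminant_root u].
Proof.
move=> Wg; rewrite /u /coord_product /discriminant_root; enumerate_rotations Wg;
  column_contradiction; rewrite mat3_vec3 !vec3E; split; ring.
Qed.

End CubeRotationInvariants.

(** * Families of curves with regular invariants *)

Section ContinuousReal.
Variables (R : realType) (T : topologicalType).
Implicit Types f g : T -> R.

Lemma continuous_add f g : continuous f -> continuous g ->
  continuous (fun u => f u + g u).
Proof. by move=> cf cg u; apply: cvgD; [exact: cf | exact: cg]. Qed.

Lemma continuous_sub f g : continuous f -> continuous g ->
  continuous (fun u => f u - g u).
Proof. by move=> cf cg u; apply: cvgB; [exact: cf | exact: cg]. Qed.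

Lemma continuous_mul f g : continuous f -> continuous g ->
  continuous (fun u => f u * g u).
Proof. by move=> cf cg u; apply: cvgM; [exact: cf | exact: cg]. Qed.

Lemma continuous_exp f k : continuous f -> continuous (fun u => f u ^+ k).
Proof.
move=> cf; elim: k => [|k IH]; first by move=> u; exact: cvg_cst.
have -> : (fun u => f u ^+ k.+1) = (fun u => f u * f u ^+ k).
  by apply/funext => u; rewrite exprS.
exact: continuous_mul.
Qed.

Lemma continuous_const (a : R) : continuous (fun _ : T => a).
Proof. by move=> u; exact: cvg_cst. Qed.

End ContinuousReal.

Ltac polynomial_continuous := lazymatch goal with
  | |- continuous (fun u => @?f u - @?g u) =>
      apply: (@continuous_sub _ _ f g); polynomial_continuous
  | |- continuous (fun u => @?f u + @?g u) =>
      apply: (@continuous_add _ _ f g); polynomial_continuous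
  | |- continuous (fun u => @?f u * @?g u) =>
      apply: (@continuous_mul _ _ f g); polynomial_continuous
  | |- continuous (fun u => @?f u ^+ ?k) =>
      apply: (@continuous_exp _ _ f k); polynomial_continuous
  | |- continuous (fun u => fun_of_matrix u _ _) => exact: coord_continuous
  | |- _ => exact: continuous_const
  end.

Section CubeFamilies.
Variable R : realType.
Implicit Types (x y z : R) (u v : 'cV[R]_3).
Local Notation W := (cube_rotations R).

(** The condition is repeated to obtain an instance of [stabilizer_group]. *)
Definition axis_stabilizer (a : 'cV[R]_3) :=
  [set g | [/\ W g, g *m a = a & g *m a = a]].

Lemma axis_stabilizer_group a : isometry_group (axis_stabilizer a).
Proof. exact: stabilizer_group (cube_rotations_isometry_group R). Qed.

Lemma axis_stabilizer_sub a : axis_stabilizer a `<=` W.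
Proof. by move=> g []. Qed.

Lemma axis_stabilizer_action x y z p q r : cube_action p q r ->
  p x y z = x -> q x y z = y -> r x y z = z ->
  exists2 g, axis_stabilizer (vec3 x y z) g & forall x y z,
    g *m vec3 x y z = vec3 (p x y z) (q x y z) (r x y z).
Proof.
by move=> [g Wg gE] px qy rz; exists g => //; split=> //; rewrite gE px qy rz.
Qed.

Definition face_invariants (i : 'I_3) : 'cV[R]_3 -> R :=
  match val i with 0%N => @sqnorm R 3 | 1%N => @quartic_re R | _ => @quartic_im R end.

Lemma face_separation u v : u i0 0 = 0 -> v i0 0 = 0 ->
  (forall i, face_invariants i u = face_invariants i v) ->
  exists2 g, axis_stabilizer (vec3 1 0 0) g & u = g *m v.
Proof.
move=> u0 v0 huv; have := huv i1; have := huv i2; rewrite /face_invariants /=.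
rewrite [u]vec3_eta [v]vec3_eta u0 v0.
move: (u i1 0) (u i2 0) (v i1 0) (v i2 0) => y' z' y z.
rewrite /quartic_re /quartic_im !vec3E => Him Hre.
(* The norm of [w' ^ 4 - w ^ 4] factors along the four rotations. *)
have /eqP : ((y' - y) ^+ 2 + (z' - z) ^+ 2) * ((y' + y) ^+ 2 + (z' + z) ^+ 2) *
    (((y' + z) ^+ 2 + (z' - y) ^+ 2) * ((y' - z) ^+ 2 + (z' + y) ^+ 2)) = 0.
  have <- : ((y' ^+ 4 - 6 * y' ^+ 2 * z' ^+ 2 + z' ^+ 4) -
      (y ^+ 4 - 6 * y ^+ 2 * z ^+ 2 + z ^+ 4)) ^+ 2 +
    16 * ((y' ^+ 3 * z' - y' * z' ^+ 3) - (y ^+ 3 * z - y * z ^+ 3)) ^+ 2 = 0.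
    by rewrite Him Hre !subrr expr0n /= mulr0 addr0.
  ring.
have sum_sq (a b : R) : a ^+ 2 + b ^+ 2 == 0 -> a = 0 /\ b = 0.
  by rewrite paddr_eq0 ?sqr_ge0// !sqrf_eq0 => /andP[/eqP -> /eqP ->].
have [_ G1 _ _ _] := axis_stabilizer_group (vec3 1 0 0).
rewrite !mulf_eq0 => /orP[/orP[]|/orP[]] /sum_sq[Ey Ez].
- exists 1%:M => //; rewrite mul1mx; congr vec3; lra.
- have [|||g Gg gE] := axis_stabilizer_action (x := 1) (y := 0) (z := 0)
    (cube_action_neg_yz R); rewrite ?oppr0//.
  by exists g => //; rewrite gE; congr vec3; lra.
- have [|||g Gg gE] := axis_stabilizer_action (x := 1) (y := 0) (z := 0)
    (cube_action_quarter R); rewrite ?oppr0//.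
  by exists g => //; rewrite gE; congr vec3; lra.
- have [|||g Gg gE] := axis_stabilizer_action (x := 1) (y := 0) (z := 0)
    (cube_action_comp (cube_action_quarter R) (cube_action_neg_yz R)); rewrite ?opprK ?oppr0//.
  by exists g => //; rewrite gE; congr vec3; lra.
Qed.

Lemma planar_closed (f : 'cV[R]_3 -> R) : continuous f -> closed [set u | f u = 0].
Proof.
move=> cf; apply: (@preimage_closed _ _ f [set x | x = 0]) => [u _|]; first exact: cf.
exact: closed_eq.
Qed.

(** The stabilizer of the axis is cyclic of order 4 and acts on the orthogonal
    plane.  Homogeneity reduces the problem to the unit circle, where the family
    is regular because fourth roots can be extracted.  The other kinds of axes
    are treated in the same way. *)
Lemma face_plane X k (c : X -> R -> 'cV[R]_3) : (4 <= k)%N ->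
  (forall j s, c j s i0 0 = 0) ->
  (forall i, Tay k (fun j s => face_invariants i (c j s))) ->
  bounded_orbit_derivative (axis_stabilizer (vec3 1 0 0)) c.
Proof.
move=> k4 c0 Tc; pose G := axis_stabilizer (vec3 (1 : R) 0 0).
have GG : isometry_group G := axis_stabilizer_group _.
pose E := [set u : 'cV[R]_3 | u i0 0 = 0].
have cE : closed E by apply: planar_closed; exact: coord_continuous.
have ch i : continuous (face_invariants i).
  move: i; apply: forall_I3; rewrite /face_invariants /=.
  - have -> : @sqnorm R 3 = fun u => u i0 0 ^+ 2 + u i1 0 ^+ 2 + u i2 0 ^+ 2.
      by apply/funext => u; rewrite sqnorm3.
    by polynomial_continuous.
  - by rewrite /quartic_re; polynomial_continuous.
  - by rewrite /quartic_im; polynomial_continuous.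
have facts g u : G g -> E u -> E (g *m u) /\
    forall i, face_invariants i (g *m u) = face_invariants i u.
  move=> [Wg ga _] u0; have [H1 _ _ _] := cube_rotation_invariants u Wg.
  have uE : u = vec3 0 (u i1 0) (u i2 0) by rewrite {1}[u]vec3_eta u0.
  have := face_stabilizer_invariants (u i1 0) (u i2 0) Wg ga; rewrite -uE => -[E0 Ere Eim].
  split=> //; apply: forall_I3; rewrite /face_invariants //=.
  by rewrite !sqnorm3.
apply: (@homogeneous_reduction R 3 G E 3 face_invariants
  (fun i => match val i with 0%N => 2%N | _ => 4%N end) k i0) => //.
- by move=> a u; rewrite /E /= mxE => ->; rewrite mulr0.
- apply: forall_I3 => a u; rewrite /face_invariants /= ?sqnormZ//.
    by rewrite /quartic_re !mxE; ring.
  by rewrite /quartic_im !mxE; ring.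
- by apply: forall_I3 => //=; rewrite (leq_trans _ k4).
- by rewrite (leq_trans _ k4).
- by move=> u v; exact: face_separation.
move=> Y d Fd d1.
have [||c' [c'd [Ec' Tc'] c'0 T0]] := continuous_selection GG cE ch face_separation
  (fun u => erefl : face_invariants i0 u = sqnorm u) _ _ Fd d1.
- by move=> g u Gg Eu; have [] := facts g u Gg Eu.
- by move=> i g u Gg Eu; have [_] := facts g u Gg Eu; apply.
apply: (bounded_orbit_derivative_move GG c'd).
have k1 : (1 <= k)%N by exact: leq_trans k4.
have [|Ty Tz] := fourth_root_regular (T0 i1) (T0 i2) _
    (Tay_le k1 (Tc' i1)) (Tay_le k1 (Tc' i2)).
  move=> j; have := d1 j; rewrite -c'0 sqnorm3.
  by rewrite (Ec' j 0) expr0n add0r.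
have [_ G1 _ _ _] := GG; apply: Tay1_bounded_orbit_derivative => //.
apply: forall_I3 => //.
by apply: Tay_ext (Tay_num _ _ 0) => j s; rewrite (Ec' j s).
Qed.

Definition edge_invariants (i : 'I_3) : 'cV[R]_3 -> R :=
  match val i with 0%N => @sqnorm R 3 | 1%N => @edge_square R | _ => @edge_product R end.

Lemma edge_eta u : u i0 0 + u i1 0 = 0 -> u = vec3 (u i0 0) (- u i0 0) (u i2 0).
Proof. by move=> /eqP; rewrite addrC addr_eq0 => /eqP <-; exact: vec3_eta. Qed.

Lemma edge_separation u v : u i0 0 + u i1 0 = 0 -> v i0 0 + v i1 0 = 0 ->
  (forall i, edge_invariants i u = edge_invariants i v) ->
  exists2 g, axis_stabilizer (vec3 1 1 0) g & u = g *m v.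
Proof.
move=> /edge_eta -> /edge_eta -> huv; have := huv i0; have := huv i1; have := huv i2.
rewrite /edge_invariants /= !sqnorm3; move: (u i0 0) (u i2 0) (v i0 0) (v i2 0) => x' z' x z.
rewrite /edge_square /edge_product !vec3E {huv} => Hp Hs Hn.
have /eqP : ((2 * x' - 2 * x) ^+ 2 + (z' - z) ^+ 2) *
    ((2 * x' + 2 * x) ^+ 2 + (z' + z) ^+ 2) = 0.
  have Hz : z' ^+ 2 = z ^+ 2 by lra.
  have <- : (((x' + x') ^+ 2 - (x + x) ^+ 2) - (z' ^+ 2 - z ^+ 2)) ^+ 2 +
    4 * ((x' + x') * z' - (x + x) * z) ^+ 2 = 0.
    have -> : (x' + x') ^+ 2 = (x + x) ^+ 2 by lra.
    have -> : (x' + x') * z' = (x + x) * z by lra.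
    by rewrite Hz !subrr expr0n /= mulr0 addr0.
  ring.
have sum_sq (a b : R) : a ^+ 2 + b ^+ 2 == 0 -> a = 0 /\ b = 0.
  by rewrite paddr_eq0 ?sqr_ge0// !sqrf_eq0 => /andP[/eqP -> /eqP ->].
have [_ G1 _ _ _] := axis_stabilizer_group (vec3 1 1 0).
rewrite mulf_eq0 => /orP[] /sum_sq[Ex Ez].
- exists 1%:M => //; rewrite mul1mx; congr vec3; lra.
- have [|||g Gg gE] := axis_stabilizer_action (x := 1) (y := 1) (z := 0)
    (cube_action_swap R); rewrite ?oppr0//.
  by exists g => //; rewrite gE; congr vec3; lra.
Qed.

Lemma edge_plane X k (c : X -> R -> 'cV[R]_3) : (2 <= k)%N ->
  (forall j s, c j s i0 0 + c j s i1 0 = 0) ->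
  (forall i, Tay k (fun j s => edge_invariants i (c j s))) ->
  bounded_orbit_derivative (axis_stabilizer (vec3 1 1 0)) c.
Proof.
move=> k2 c0 Tc; pose G := axis_stabilizer (vec3 (1 : R) 1 0).
have GG : isometry_group G := axis_stabilizer_group _.
pose E := [set u : 'cV[R]_3 | u i0 0 + u i1 0 = 0].
have cE : closed E by apply: planar_closed; polynomial_continuous.
have ch i : continuous (edge_invariants i).
  move: i; apply: forall_I3; rewrite /edge_invariants /=.
  - have -> : @sqnorm R 3 = fun u => u i0 0 ^+ 2 + u i1 0 ^+ 2 + u i2 0 ^+ 2.
      by apply/funext => u; rewrite sqnorm3.
    by polynomial_continuous.
  - by rewrite /edge_square; polynomial_continuous.
  - by rewrite /edge_product; polynomial_continuous.
have facts g u : G g -> E u -> E (g *m u) /\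
    forall i, edge_invariants i (g *m u) = edge_invariants i u.
  move=> [Wg ga _] u0; have [H1 _ _ _] := cube_rotation_invariants u Wg.
  have := edge_stabilizer_invariants (u i0 0) (u i2 0) Wg ga; rewrite -(edge_eta u0) => -[E0 Es Ep].
  split=> //; apply: forall_I3; rewrite /edge_invariants //=.
  by rewrite !sqnorm3.
apply: (@homogeneous_reduction R 3 G E 3 edge_invariants (fun=> 2%N) k i0) => //.
- by move=> a u; rewrite /E /= !mxE -mulrDr => ->; rewrite mulr0.
- apply: forall_I3 => a u; rewrite /edge_invariants /= ?sqnormZ//.
    by rewrite /edge_square !mxE; ring.
  by rewrite /edge_product !mxE; ring.
- by move=> u v; exact: edge_separation.
move=> Y d Fd d1.
have [||c' [c'd [Ec' Tc'] c'0 T0]] := continuous_selection GG cE ch edge_separation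
  (fun u => erefl : edge_invariants i0 u = sqnorm u) _ _ Fd d1.
- by move=> g u Gg Eu; have [] := facts g u Gg Eu.
- by move=> i g u Gg Eu; have [_] := facts g u Gg Eu; apply.
apply: (bounded_orbit_derivative_move GG c'd).
have k1 : (1 <= k)%N by exact: leq_trans k2.
have c'1 j s : c' j s i1 0 = - c' j s i0 0.
  by have := Ec' j s; rewrite /E /=; lra.
have Tn := Tay_le k1 (Tc' i0); have Ts := Tay_le k1 (Tc' i1).
have Tp := Tay_le k1 (Tc' i2).
have [||| Td Tz] := @square_root_regular R Y (fun j s => c' j s i0 0 - c' j s i1 0)
    (fun j s => c' j s i2 0) _ (T0 i2) _ Ts _ Tp.
- by apply: TayB; exact: T0.
- move=> j; have := d1 j; rewrite -c'0 sqnorm3 c'1.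
  by have := sqr_ge0 (c' j 0 i0 0); lra.
- apply: (@Tay_ext _ _ _ (fun j s => sqnorm (c' j s) - 2^-1 * edge_square (c' j s))).
    by move=> j s; rewrite sqnorm3 /edge_square c'1; field.
  by apply: TayB => //; apply: TayM => //; exact: Tay_num.
have Tx : Tay 1 (fun j s => c' j s i0 0).
  apply: (@Tay_ext _ _ _ (fun j s => 2^-1 * (c' j s i0 0 - c' j s i1 0))).
    by move=> j s; rewrite c'1; field.
  by apply: TayM => //; exact: Tay_num.
have [_ G1 _ _ _] := GG; apply: Tay1_bounded_orbit_derivative => //.
apply: forall_I3 => //.
by apply: Tay_ext (TayN Tx) => j s; rewrite c'1.
Qed.

Definition vertex_invariants (i : 'I_3) : 'cV[R]_3 -> R :=
  match val i with 0%N => @sqnorm R 3 | 1%N => @coord_product R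
  | _ => @discriminant_root R end.

Lemma vertex_separation u v : u i0 0 + u i1 0 + u i2 0 = 0 ->
  v i0 0 + v i1 0 + v i2 0 = 0 ->
  (forall i, vertex_invariants i u = vertex_invariants i v) ->
  exists2 g, axis_stabilizer (vec3 1 1 1) g & u = g *m v.
Proof.
move=> u0 v0 huv; have := huv i1; have := huv i2.
rewrite /vertex_invariants /= [u]vec3_eta [v]vec3_eta; move: u0 v0.
move: (u i0 0) (u i1 0) (u i2 0) (v i0 0) (v i1 0) (v i2 0) => x' y' z' x y z u0 v0.
rewrite /coord_product /discriminant_root !vec3E {huv} => HD Hm.
pose N (a b : R) := a ^+ 2 - a * b + b ^+ 2.
have N0 a b : N a b == 0 -> a = 0 /\ b = 0.
  rewrite /N => /eqP H; have b0 : b = 0.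
    apply/eqP; rewrite -sqrf_eq0 eq_le sqr_ge0 andbT.
    by have := sqr_ge0 (2 * a - b); nra.
  split=> //; apply/eqP; rewrite -sqrf_eq0; apply/eqP.
  by move: H; rewrite b0 mulr0 subr0 expr0n addr0.
pose a := x - z; pose b := y - z; pose a' := x' - z'; pose b' := y' - z'.
(* The norm of [w' ^ 3 - w ^ 3] factors along the three rotations. *)
have /eqP : N (a' - a) (b' - b) * N (a' + b) (b' - (a - b)) *
    N (a' - (b - a)) (b' + a) = 0.
  have -> : N (a' - a) (b' - b) * N (a' + b) (b' - (a - b)) * N (a' - (b - a)) (b' + a) =
    N ((a' ^+ 3 - 3 * a' * b' ^+ 2 + b' ^+ 3) - (a ^+ 3 - 3 * a * b ^+ 2 + b ^+ 3))
      ((3 * a' ^+ 2 * b' - 3 * a' * b' ^+ 2) - (3 * a ^+ 2 * b - 3 * a * b ^+ 2)).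
    by rewrite /N; ring.
  have cubes (p q r : R) : p + q + r = 0 ->
      (p - r) ^+ 3 - 3 * (p - r) * (q - r) ^+ 2 + (q - r) ^+ 3 =
        27 / 2 * (p * q * r) - 3 / 2 * ((p - q) * (q - r) * (r - p)) /\
      3 * (p - r) ^+ 2 * (q - r) - 3 * (p - r) * (q - r) ^+ 2 =
        - 3 * ((p - q) * (q - r) * (r - p)).
    move=> H; have -> : r = - p - q by lra.
    by split; field.
  have [-> ->] := cubes _ _ _ u0; have [-> ->] := cubes _ _ _ v0.
  by rewrite HD Hm !subrr /N expr0n /= mul0r subrr addr0.
have [_ G1 _ _ _] := axis_stabilizer_group (vec3 1 1 1).
rewrite !mulf_eq0 => /orP[/orP[]|] /N0; rewrite /a /b /a' /b' => -[Ea Eb].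
- exists 1%:M => //; rewrite mul1mx; congr vec3; lra.
- have [|||g Gg gE] := axis_stabilizer_action (x := 1) (y := 1) (z := 1)
    (cube_action_comp (cube_action_rot R) (cube_action_rot R)) => //.
  by exists g => //; rewrite gE; congr vec3; lra.
- have [|||g Gg gE] := axis_stabilizer_action (x := 1) (y := 1) (z := 1)
    (cube_action_rot R) => //.
  by exists g => //; rewrite gE; congr vec3; lra.
Qed.

Lemma vertex_plane X k (c : X -> R -> 'cV[R]_3) : (3 <= k)%N ->
  (forall j s, c j s i0 0 + c j s i1 0 + c j s i2 0 = 0) ->
  (forall i, Tay k (fun j s => vertex_invariants i (c j s))) ->
  bounded_orbit_derivative (axis_stabilizer (vec3 1 1 1)) c.
Proof.
move=> k3 c0 Tc; pose G := axis_stabilizer (vec3 (1 : R) 1 1).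
have GG : isometry_group G := axis_stabilizer_group _.
pose E := [set u : 'cV[R]_3 | u i0 0 + u i1 0 + u i2 0 = 0].
have cE : closed E by apply: planar_closed; polynomial_continuous.
have ch i : continuous (vertex_invariants i).
  move: i; apply: forall_I3; rewrite /vertex_invariants /=.
  - have -> : @sqnorm R 3 = fun u => u i0 0 ^+ 2 + u i1 0 ^+ 2 + u i2 0 ^+ 2.
      by apply/funext => u; rewrite sqnorm3.
    by polynomial_continuous.
  - by rewrite /coord_product; polynomial_continuous.
  - by rewrite /discriminant_root; polynomial_continuous.
have facts g u : G g -> E u -> E (g *m u) /\
    forall i, vertex_invariants i (g *m u) = vertex_invariants i u.
  move=> [Wg ga _] u0; have [H1 _ _ _] := cube_rotation_invariants u Wg.
  have := vertex_stabilizer_invariants (u i0 0) (u i1 0) (u i2 0) Wg ga;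
  rewrite -vec3_eta => -[E0 Em ED].
  split; first by rewrite /E /= E0.
  apply: forall_I3; rewrite /vertex_invariants //=.
  by rewrite !sqnorm3.
apply: (@homogeneous_reduction R 3 G E 3 vertex_invariants
  (fun i => match val i with 0%N => 2%N | _ => 3%N end) k i0) => //.
- by move=> a u; rewrite /E /= !mxE -!mulrDr => ->; rewrite mulr0.
- apply: forall_I3 => a u; rewrite /vertex_invariants /= ?sqnormZ//.
    by rewrite /coord_product !mxE; ring.
  by rewrite /discriminant_root !mxE; ring.
- by apply: forall_I3 => //=; rewrite (leq_trans _ k3).
- by rewrite (leq_trans _ k3).
- by move=> u v; exact: vertex_separation.
move=> Y d Fd d1.
have [||c' [c'd [Ec' Tc'] c'0 T0]] := continuous_selection GG cE ch vertex_separation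
  (fun u => erefl : vertex_invariants i0 u = sqnorm u) _ _ Fd d1.
- by move=> g u Gg Eu; have [] := facts g u Gg Eu.
- by move=> i g u Gg Eu; have [_] := facts g u Gg Eu; apply.
apply: (bounded_orbit_derivative_move GG c'd).
have k1 : (1 <= k)%N by exact: leq_trans k3.
have c'2 j s : c' j s i2 0 = - c' j s i0 0 - c' j s i1 0.
  by have := Ec' j s; rewrite /E /=; lra.
have Tm := Tay_le k1 (Tc' i1); have TD := Tay_le k1 (Tc' i2).
have [|||||Ta Tb] := @cube_root_regular R Y (fun j s => c' j s i0 0 - c' j s i2 0)
    (fun j s => c' j s i1 0 - c' j s i2 0).
- by apply: TayB; exact: T0.
- by apply: TayB; exact: T0.
- move=> j; have := d1 j; rewrite -c'0 sqnorm3 c'2.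
  by lra.
- apply: (@Tay_ext _ _ _ (fun j s => 27 / 2 * coord_product (c' j s) -
    3 / 2 * discriminant_root (c' j s))).
    by move=> j s; rewrite /coord_product /discriminant_root c'2; field.
  by Tay_arith.
- apply: (@Tay_ext _ _ _ (fun j s => - 3 * discriminant_root (c' j s))).
    by move=> j s; rewrite /discriminant_root c'2; ring.
  by Tay_arith.
have T3 : Tay 1 (fun (_ : Y) (_ : R) => 3^-1 : R) by exact: Tay_num.
have Tx : Tay 1 (fun j s => c' j s i0 0).
  apply: (@Tay_ext _ _ _ (fun j s => 3^-1 * (2 * (c' j s i0 0 - c' j s i2 0) -
    (c' j s i1 0 - c' j s i2 0)))); first by move=> j s; rewrite c'2; field.
  by Tay_arith.
have Ty : Tay 1 (fun j s => c' j s i1 0).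
  apply: (@Tay_ext _ _ _ (fun j s => 3^-1 * (2 * (c' j s i1 0 - c' j s i2 0) -
    (c' j s i0 0 - c' j s i2 0)))); first by move=> j s; rewrite c'2; field.
  by Tay_arith.
have [_ G1 _ _ _] := GG; apply: Tay1_bounded_orbit_derivative => //.
apply: forall_I3 => //.
apply: (@Tay_ext _ _ _ (fun j s => - c' j s i0 0 - c' j s i1 0)).
  by move=> j s; rewrite c'2.
by Tay_arith.
Qed.

Section Regions.
Variables (X : Type) (k : nat) (c : X -> R -> 'cV[R]_3).
Hypotheses (k4 : (4 <= k)%N) (T0 : forall i, Tay 0 (fun j s => c j s i 0))
  (T2 : Tay k (fun j s => inv2 (c j s))) (T4 : Tay k (fun j s => inv4 (c j s)))
  (T6 : Tay k (fun j s => inv6 (c j s))) (T9 : Tay k (fun j s => inv9 (c j s))).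

(** The part of the curve along the axis is fixed by the stabilizer and regular,
    and the orthogonal part is a family with regular invariants. *)
Lemma face_region : (forall j, 10^-1 <= c j 0 i0 0 ^+ 2 - c j 0 i1 0 ^+ 2) ->
  (forall j, 10^-1 <= c j 0 i0 0 ^+ 2 - c j 0 i2 0 ^+ 2) ->
  bounded_orbit_derivative W c.
Proof.
move=> xy xz.
have [Tx Tn Tre Tim] := face_slice (T0 i0) (T0 i1) (T0 i2) T2 T4 T6 T9 xy xz.
apply: (bounded_orbit_derivative_sub (@axis_stabilizer_sub (vec3 1 0 0))).
have -> : c = fun j s => c j s i0 0 *: vec3 1 0 0 + vec3 0 (c j s i1 0) (c j s i2 0).
  apply/funext => j; apply/funext => s; rewrite {1}[c j s]vec3_eta.
  by apply/colP; apply: forall_I3; rewrite !mxE /=; ring.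
have k1 : (1 <= k)%N by exact: leq_trans k4.
apply: bounded_orbit_derivative_fixed; [by move=> g [] | exact: Tay_le Tx |].
apply: (face_plane k4); first by move=> j s; rewrite vec3E.
apply: forall_I3; rewrite /face_invariants /=.
- by apply: Tay_ext Tn => j s; rewrite sqnorm3 !vec3E expr0n add0r.
- by apply: Tay_ext Tre => j s; rewrite /quartic_re !vec3E.
- by apply: Tay_ext Tim => j s; rewrite /quartic_im !vec3E.
Qed.

Lemma edge_region : (forall j, 10^-1 <= c j 0 i0 0 ^+ 2 - c j 0 i2 0 ^+ 2) ->
  (forall j, 10^-1 <= c j 0 i1 0 ^+ 2 - c j 0 i2 0 ^+ 2) ->
  (forall j, 0 <= c j 0 i0 0 * c j 0 i1 0) ->
  bounded_orbit_derivative W c.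
Proof.
move=> xz yz xy.
have [Tq Ts Tz Tp] := edge_slice (T0 i0) (T0 i1) (T0 i2) T2 T4 T6 T9 xz yz xy.
apply: (bounded_orbit_derivative_sub (@axis_stabilizer_sub (vec3 1 1 0))).
pose d j s := 2^-1 * (c j s i0 0 - c j s i1 0).
have -> : c = fun j s => (2^-1 * (c j s i0 0 + c j s i1 0)) *: vec3 1 1 0 +
    vec3 (d j s) (- d j s) (c j s i2 0).
  apply/funext => j; apply/funext => s; rewrite {1}[c j s]vec3_eta.
  by apply/colP; apply: forall_I3; rewrite !mxE /= /d; field.
have k1 : (1 <= k)%N by exact: leq_trans k4.
apply: bounded_orbit_derivative_fixed; first by move=> g [].
  by apply: TayM; [exact: Tay_num | exact: Tay_le Tq].
apply: (@edge_plane _ k); first by rewrite (leq_trans _ k4).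
  by move=> j s; rewrite !vec3E subrr.
have T2' : Tay k (fun (_ : X) (_ : R) => 2^-1 : R) by exact: Tay_num.
apply: forall_I3; rewrite /edge_invariants /=.
- apply: (@Tay_ext _ _ _ (fun j s => 2^-1 * (c j s i0 0 - c j s i1 0) ^+ 2 +
    c j s i2 0 ^+ 2)); first by move=> j s; rewrite sqnorm3 !vec3E /d; field.
  by apply: TayD => //; exact: TayM.
- by apply: Tay_ext Ts => j s; rewrite /edge_square !vec3E /d; field.
- by apply: Tay_ext Tp => j s; rewrite /edge_product !vec3E /d; field.
Qed.

Lemma vertex_region : (forall j, 10^-1 <= c j 0 i0 0) ->
  (forall j, 10^-1 <= c j 0 i1 0) -> (forall j, 10^-1 <= c j 0 i2 0) ->
  bounded_orbit_derivative W c.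
Proof.
move=> x0 y0 z0.
have [Tq Te Tm TD] := vertex_slice (T0 i0) (T0 i1) (T0 i2) T2 T4 T6 T9 x0 y0 z0.
apply: (bounded_orbit_derivative_sub (@axis_stabilizer_sub (vec3 1 1 1))).
pose q j s := c j s i0 0 + c j s i1 0 + c j s i2 0.
pose t j s := 3^-1 * q j s.
have Tt : Tay k t by apply: TayM => //; exact: Tay_num.
have -> : c = fun j s => t j s *: vec3 1 1 1 +
    vec3 (c j s i0 0 - t j s) (c j s i1 0 - t j s) (c j s i2 0 - t j s).
  apply/funext => j; apply/funext => s; rewrite {1}[c j s]vec3_eta.
  by apply/colP; apply: forall_I3; rewrite !mxE /=; ring.
have k1 : (1 <= k)%N by exact: leq_trans k4.
apply: bounded_orbit_derivative_fixed; [by move=> g [] | exact: Tay_le Tt |].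
apply: (@vertex_plane _ k); first by rewrite (leq_trans _ k4).
  by move=> j s; rewrite !vec3E /t /q; field.
apply: forall_I3; rewrite /vertex_invariants /=.
- apply: (@Tay_ext _ _ _ (fun j s => inv2 (c j s) - 3 * t j s ^+ 2)).
    by move=> j s; rewrite sqnorm3 !vec3E /inv2 /t /q; field.
  by apply: TayB => //; apply: TayM; [exact: Tay_num | exact: TayX].
- apply: (@Tay_ext _ _ _ (fun j s => c j s i0 0 * c j s i1 0 * c j s i2 0 -
    t j s * (c j s i0 0 * c j s i1 0 + c j s i1 0 * c j s i2 0 +
    c j s i2 0 * c j s i0 0) + 2 * t j s ^+ 3)).
    by move=> j s; rewrite /coord_product !vec3E /t /q; field.
  apply: TayD; last by apply: TayM; [exact: Tay_num | exact: TayX].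
  by apply: TayB => //; exact: TayM.
- by apply: Tay_ext TD => j s; rewrite /discriminant_root !vec3E; ring.
Qed.

End Regions.

Definition cube_invariants (i : 'I_4) : 'cV[R]_3 -> R :=
  match val i with 0%N => @inv2 R | 1%N => @inv4 R | 2 => @inv6 R | _ => @inv9 R end.

Lemma forall_I4 (P : 'I_4 -> Prop) : P (@Ordinal 4 0 isT) -> P (@Ordinal 4 1 isT) ->
  P (@Ordinal 4 2 isT) -> P (@Ordinal 4 3 isT) -> forall i, P i.
Proof.
move=> P0 P1 P2 P3 [[|[|[|[|//]]]] Hi].
- by rewrite (_ : Ordinal Hi = @Ordinal 4 0 isT)//; exact: val_inj.
- by rewrite (_ : Ordinal Hi = @Ordinal 4 1 isT)//; exact: val_inj.
- by rewrite (_ : Ordinal Hi = @Ordinal 4 2 isT)//; exact: val_inj.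
- by rewrite (_ : Ordinal Hi = @Ordinal 4 3 isT)//; exact: val_inj.
Qed.

(** The order of regularity [9] is the degree of [inv9]; this is required by the
    rescaling of curves which start close to 0. *)
Theorem cube_families X k (c : X -> R -> 'cV[R]_3) : (9 <= k)%N ->
  (forall i, Tay k (fun j s => cube_invariants i (c j s))) ->
  bounded_orbit_derivative W c.
Proof.
move=> k9 Tc; have GG := cube_rotations_isometry_group R.
pose E := [set: 'cV[R]_3].
have ch i : continuous (cube_invariants i).
  move: i; apply: forall_I4; rewrite /cube_invariants /=.
  - by rewrite /inv2; polynomial_continuous.
  - by rewrite /inv4; polynomial_continuous.
  - by rewrite /inv6; polynomial_continuous.
  - by rewrite /inv9; polynomial_continuous.
have sep u v : E u -> E v -> (forall i, cube_invariants i u = cube_invariants i v) ->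
    exists2 g, W g & u = g *m v.
  move=> _ _ H; apply: cube_separation.
  - exact: (H (@Ordinal 4 0 isT)).
  - exact: (H (@Ordinal 4 1 isT)).
  - exact: (H (@Ordinal 4 2 isT)).
  - exact: (H (@Ordinal 4 3 isT)).
have hW i g u : W g -> cube_invariants i (g *m u) = cube_invariants i u.
  move=> Wg; have [H2 H4 H6 H9] := cube_rotation_invariants u Wg.
  by move: i; apply: forall_I4.
have h0 u : cube_invariants (@Ordinal 4 0 isT) u = sqnorm u by rewrite sqnorm3.
apply: (@homogeneous_reduction R 3 W E 4 cube_invariants
  (fun i => match val i with 0%N => 2%N | 1%N => 4%N | 2 => 6%N | _ => 9%N end)
  k (@Ordinal 4 0 isT)) => //.
- apply: forall_I4 => a u; rewrite /cube_invariants /=.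
  + by rewrite /inv2 !mxE; ring.
  + by rewrite /inv4 !mxE; ring.
  + by rewrite /inv6 !mxE; ring.
  + by rewrite /inv9 !mxE; ring.
- by apply: forall_I4 => //=; rewrite (leq_trans _ k9).
- by rewrite (leq_trans _ k9).
move=> Y d [_ Td] d1.
have /choice[g gP] : forall j, exists g, W g /\ let u := g *m d j 0 in
  [\/ 10^-1 <= u i0 0 ^+ 2 - u i1 0 ^+ 2 /\ 10^-1 <= u i0 0 ^+ 2 - u i2 0 ^+ 2,
      [/\ 10^-1 <= u i0 0 ^+ 2 - u i2 0 ^+ 2, 10^-1 <= u i1 0 ^+ 2 - u i2 0 ^+ 2
        & 0 <= u i0 0 * u i1 0] |
      [/\ 10^-1 <= u i0 0, 10^-1 <= u i1 0 & 10^-1 <= u i2 0]].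
  move=> j; have [|x [y [z [[g Wg gE] H]]]] := @axis_regions R (d j 0).
    by have := d1 j; rewrite -h0.
  by exists g; split=> //; rewrite /= -gE !vec3E.
pose d' j s := g j *m d j s.
have d'd j s : exists2 g, W g & d' j s = g *m d j s.
  by exists (g j) => //; case: (gP j).
apply: (bounded_orbit_derivative_move GG d'd).
have Fd' : invariant_family E cube_invariants k d'.
  split=> // i; apply: Tay_ext (Td i) => j s.
  by have [h Wh ->] := d'd j s; rewrite hW.
have d'1 j : sqnorm (d' j 0) = 1.
  by have [h Wh ->] := d'd j 0; rewrite -h0 hW// h0.
have [|||c' [c'd [_ Tc'] c'0 T0]] := continuous_selection GG _ ch sep h0 _ _ Fd' d'1.
- exact: closedT.
- by [].
- by move=> i h u Wh _; exact: hW.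
apply: (bounded_orbit_derivative_move GG c'd).
pose P1 j := 10^-1 <= c' j 0 i0 0 ^+ 2 - c' j 0 i1 0 ^+ 2 /\
  10^-1 <= c' j 0 i0 0 ^+ 2 - c' j 0 i2 0 ^+ 2.
pose P2 j := [/\ 10^-1 <= c' j 0 i0 0 ^+ 2 - c' j 0 i2 0 ^+ 2,
  10^-1 <= c' j 0 i1 0 ^+ 2 - c' j 0 i2 0 ^+ 2 & 0 <= c' j 0 i0 0 * c' j 0 i1 0].
have k4 : (4 <= k)%N by exact: leq_trans k9.
have TT (Z : Type) (f : Z -> Y) i :
    Tay k (fun j s => cube_invariants i (c' (f j) s)).
  exact: (Tay_reindex f (Tc' i)).
have TT0 (Z : Type) (f : Z -> Y) i : Tay 0 (fun j s => c' (f j) s i 0).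
  exact: (Tay_reindex f (T0 i)).
apply: (bounded_orbit_derivative_split (P := P1)).
  apply: (face_region k4 (TT0 _ sval) (TT _ sval (@Ordinal 4 0 isT))
    (TT _ sval (@Ordinal 4 1 isT)) (TT _ sval (@Ordinal 4 2 isT))
    (TT _ sval (@Ordinal 4 3 isT))) => j; by have [] := svalP j.
apply: (bounded_orbit_derivative_split (P := fun j => P2 (sval j))).
  apply: (edge_region k4 (TT0 _ (fun j => sval (sval j)))
    (TT _ (fun j => sval (sval j)) (@Ordinal 4 0 isT))
    (TT _ (fun j => sval (sval j)) (@Ordinal 4 1 isT))
    (TT _ (fun j => sval (sval j)) (@Ordinal 4 2 isT))
    (TT _ (fun j => sval (sval j)) (@Ordinal 4 3 isT))) => j; by have [] := svalP j.
have P3 (j : {j : {j | ~ P1 j} | ~ P2 (sval j)}) : let u := c' (sval (sval j)) 0 in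
    [/\ 10^-1 <= u i0 0, 10^-1 <= u i1 0 & 10^-1 <= u i2 0].
  case: j => -[j nP1] nP2 /=; rewrite /= in nP2.
  by have [_] := gP j; rewrite /= -/(d' j 0) -c'0 => -[].
apply: (vertex_region k4 (TT0 _ (fun j => sval (sval j)))
    (TT _ (fun j => sval (sval j)) (@Ordinal 4 0 isT))
    (TT _ (fun j => sval (sval j)) (@Ordinal 4 1 isT))
    (TT _ (fun j => sval (sval j)) (@Ordinal 4 2 isT))
    (TT _ (fun j => sval (sval j)) (@Ordinal 4 3 isT))) => j; by have [] := P3 j.
Qed.

End CubeFamilies.

(** * Taylor classes of functions of class C^k *)

Section TaylorFormula.
Variable R : realType.

Lemma mean_value_bound (g g' : R -> R) (s B : R) :
  (forall r : R, `|r| <= `|s| -> is_derive (r : R) 1 g (g' r)) -> g 0 = 0 ->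
  (forall r, `|r| <= `|s| -> `|g' r| <= B) -> `|g s| <= B * `|s|.
Proof.
move=> dg g0 gB.
have cg a b : `|a| <= `|s| -> `|b| <= `|s| -> {within `[a, b], continuous g}.
  move=> ha hb; apply: derivable_within_continuous => r.
  rewrite in_itv /= => /andP[ar rb].
  have rs : `|r| <= `|s|.
    move: ha hb; rewrite !ler_norml => /andP[h1 h2] /andP[h3 h4].
    by rewrite (le_trans h1)// (le_trans rb).
  by have [] := dg r rs.
have [s0|s0] := leP 0 s.
  have [||c cs E] := @MVT_segment R g g' 0 s s0.
  - move=> r; rewrite in_itv /= => /andP[r0 rs]; apply: dg.
    by rewrite !ger0_norm// ltW.
  - by apply: cg; rewrite ?normr0.
  move: cs; rewrite in_itv /= => /andP[c0 cs].
  move: E; rewrite g0 !subr0 => ->; rewrite normrM ler_wpM2r// gB//.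
  by rewrite !ger0_norm.
have [||c cs E] := @MVT_segment R g g' s 0 (ltW s0).
- move=> r; rewrite in_itv /= => /andP[sr r0]; apply: dg.
  by rewrite (ltr0_norm s0) (ltr0_norm r0) lerN2 ltW.
- by apply: cg; rewrite ?normr0.
move: cs; rewrite in_itv /= => /andP[sc c0].
move: E; rewrite g0 !sub0r => /(congr1 Num.norm); rewrite normrN => ->.
rewrite normrM normrN ler_wpM2r// gB//.
by rewrite (ler0_norm c0) (ltr0_norm s0) lerN2.
Qed.

Lemma is_derive_sub_monomial (g : R -> R) (a s dg : R) m :
  is_derive s 1 g dg ->
  is_derive s 1 (fun r => g r - a / m.+1%:R * r ^+ m.+1) (dg - a * s ^+ m).
Proof.
move=> Dg.
have dX : is_derive s 1 (fun r : R => r ^+ m.+1) (m.+1%:R * s ^+ m).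
  apply: DeriveDef; first exact: exprn_derivable.
  by rewrite exp_derive /GRing.scale /= mulr1.
apply: (is_derive_eq (is_deriveB Dg (is_deriveZ (a / m.+1%:R) dX))).
by rewrite /GRing.scale /= mulrA divfK// pnatr_eq0.
Qed.

(** Integration gains one order, in a form suited to induction: the primitive
    of [s ^+ m * F] is [s ^+ m.+1 * P] with [P] as regular as [F]. *)
Lemma Tay_primitive X k m (F g : X -> R -> R) (d : R) : 0 < d -> Tay k F ->
  (forall x, g x 0 = 0) ->
  (forall x s, `|s| < d -> is_derive (s : R) 1 (g x) (s ^+ m * F x s)) ->
  exists2 P, Tay k P & unif (fun x s => g x s = s ^+ m.+1 * P x s).
Proof.
elim: k m F g d => [|k IH] m F g d d0 TF g0 dg; have [bF FE] := TF;
    have bF' : bnd (fun x => F x 0 / m.+1%:R)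
      by apply: bndM => //; exact: bnd_cst.
  pose P x s := if s == 0 then F x 0 / m.+1%:R else g x s / s ^+ m.+1.
  exists P; last first.
    apply: unifW => x s; rewrite /P; case: eqP => [->|/eqP s0].
      by rewrite g0 exprS mul0r mul0r.
    by rewrite mulrC divfK// expf_neq0.
  split; first by move: bF' => [M HM]; exists M => x; rewrite /P eqxx.
  move=> e e0; have /unifP[d' d'0 Fd'] := FE e e0.
  apply/unifP; exists (Num.min d d'); first by rewrite lt_min d0.
  move=> s; rewrite lt_min => /andP[sd sd'] x; rewrite /P eqxx.
  case: eqP => [_|/eqP s0]; first by rewrite subrr normr0 ltW.
  have sm0 : s ^+ m.+1 != 0 by rewrite expf_neq0.
  have -> : g x s / s ^+ m.+1 - F x 0 / m.+1%:R =
      (g x s - F x 0 / m.+1%:R * s ^+ m.+1) / s ^+ m.+1.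
    by rewrite mulrBl mulfK.
  rewrite normrM normfV ler_pdivrMr ?normr_gt0//.
  rewrite [in leRHS]normrX [in leRHS]exprSr mulrA.
  apply: (@mean_value_bound (fun s => g x s - F x 0 / m.+1%:R * s ^+ m.+1)
    (fun r => r ^+ m * (F x r - F x 0)) s (e * `|s| ^+ m)).
  - move=> r rs; have rd : `|r| < d by exact: le_lt_trans sd.
    apply: (is_derive_eq (is_derive_sub_monomial (F x 0) m (dg x r rd))).
    by rewrite mulrBr [F x 0 * _]mulrC.
  - by rewrite g0 exprS mul0r mulr0 subr0.
  - move=> r rs; rewrite normrM normrX mulrC ler_pM//.
      by apply: Fd'; exact: le_lt_trans sd'.
    by rewrite lerXn2r ?nnegrE.
have [F1 TF1 /unifP[d1 d10 FE1]] := FE.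
have [d2 [d20 d2d d2d1]] : exists d2, [/\ 0 < d2, d2 <= d & d2 <= d1].
  by exists (Num.min d d1); rewrite lt_min d0 d10 !ge_min !lexx orbT.
pose psi x s := g x s - F x 0 / m.+1%:R * s ^+ m.+1.
have [||P TP PE] := IH m.+1 F1 psi d2 d20 TF1.
- by move=> x; rewrite /psi g0 exprS mul0r mulr0 subr0.
- move=> x s sd; have sd' := lt_le_trans sd d2d.
  apply: (is_derive_eq (is_derive_sub_monomial (F x 0) m (dg x s sd'))).
  by rewrite (FE1 s (lt_le_trans sd d2d1)) exprS; ring.
exists (fun x s => F x 0 / m.+1%:R + s * P x s).
  apply: TayD; first exact: Tay_cst.
  exact: Tay_s.
apply: filterS PE => s PE x.
have -> : g x s = psi x s + F x 0 / m.+1%:R * s ^+ m.+1 by rewrite /psi subrK.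
by rewrite PE !exprS; ring.
Qed.

Lemma Tay_integral X k (p : X -> R) (f f' : R -> R) (d : R) : 0 < d ->
  (forall x s, `|s| < d -> is_derive (p x + s) 1 f (f' (p x + s))) ->
  bnd (fun x => f (p x)) -> Tay k (fun x s => f' (p x + s)) ->
  Tay k.+1 (fun x s => f (p x + s)).
Proof.
move=> d0 df bf Tf'.
have [||P TP PE] := @Tay_primitive X k 0 (fun x s => f' (p x + s))
  (fun x s => f (p x + s) - f (p x)) d d0 Tf'.
- by move=> x; rewrite addr0 subrr.
- move=> x s sd.
  have dp : is_derive s 1 (fun r : R => p x + r) 1.
    apply: (is_derive_eq (is_deriveD (is_derive_cst (p x) s 1) (is_derive_id s 1))).
    by rewrite add0r.
  have := is_derive1_comp (df x s sd) dp => dfp.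
  apply: (is_derive_eq (is_deriveB dfp (is_derive_cst (f (p x)) s 1))).
  by rewrite expr0 mul1r subr0 mulr1.
split; first by move: bf => [M HM]; exists M => x; rewrite addr0.
exists P => //; apply: filterS PE => s PE x.
by have := PE x; rewrite expr1 => E; rewrite addr0 -E [RHS]addrC subrK.
Qed.

(** The derivative of order [k] is uniformly continuous on a compact interval, and
    [k] integrations give the expansion. *)
Lemma Tay_of_derivatives k (f : nat -> R -> R) (I : set R) (t0 r : R) :
  0 < r -> (forall t, `|t - t0| <= r + r -> I t) ->
  (forall j t, (j < k)%N -> I t -> is_derive t 1 (f j) (f j.+1 t)) ->
  (forall j t, (j <= k)%N -> I t -> {for t, continuous (f j)}) ->
  Tay k (fun (a : {a : R | `|a - t0| < r}) s => f 0%N (sval a + s)).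
Proof.
move=> r0 HI df cf.
have K a s : `|a - t0| <= r -> `|s| < r -> I (a + s).
  move=> ar sr; apply: HI; rewrite addrAC (le_trans (ler_normD _ _))//.
  by rewrite lerD// ltW.
have KI a : `|a - t0| <= r -> I a.
  by move=> ar; rewrite -[a]addr0; apply: K; rewrite ?normr0.
pose B := [set a : R | `|a - t0| <= r].
have cB : compact B.
  have -> : B = `[t0 - r, t0 + r]%classic.
    by apply/seteqP; split => a; rewrite /B /= in_itv /= ler_distl.
  exact: segment_compact.
have bf j : (j <= k)%N -> bnd (fun a : {a : R | `|a - t0| < r} => f j (sval a)).
  move=> jk; have /compact_bounded[M [_ HM]] : compact (f j @` B).
    apply: continuous_compact cB; apply: continuous_in_subspaceT => a.
    by rewrite inE => aB; apply: cf => //; exact: KI.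
  exists (M + 1) => a; apply: (HM (M + 1)); first by rewrite ltrDl.
  by exists (sval a) => //; exact/ltW/(svalP a).
have T0 : Tay 0 (fun (a : {a : R | `|a - t0| < r}) s => f k (sval a + s)).
  split; first by have [M HM] := bf k (leqnn k); exists M => a; rewrite addr0.
  move=> e e0; have e20 : 0 < e / 2 by rewrite divr_gt0.
  pose P s a := `|f k (a + s) - f k a| <= e.
  have Ploc a : B a -> \forall a' \near a & s \near nbhs (0 : R), P s a'.
    move=> aB; have cfa := cf k a (leqnn k) (KI a aB).
    have c1 : \forall b \near a, `|f k a - f k b| <= e / 2.
      by have /cvgrPdist_le/(_ _ e20) := cfa.
    have [d d0 Hd] : exists2 d : R, 0 < d & forall b, `|b - a| < d ->
        `|f k a - f k b| <= e / 2.
      have /nbhs_normP[d /= d0 Hd] := c1; exists d => // b ba; apply: Hd => /=.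
      by rewrite distrC.
    have d20 : 0 < d / 2 by rewrite divr_gt0.
    have nb : \forall b \near a, `|b - a| < d / 2.
      by apply/nbhs_normP; exists (d / 2) => // b /=; rewrite distrC.
    have ns : \forall s \near (0 : R), `|s| < d / 2.
      by apply/near0P; exists (d / 2).
    suff : filter_prod (nbhs a) (nbhs (0 : R))
        [set p | `|f k (p.1 + p.2) - f k p.1| <= e] by move=> Hp; exact: Hp.
    exists ([set b | `|b - a| < d / 2], [set s : R | `|s| < d / 2]) => //.
    move=> [b s] /= [bd sd].
    have H1 : `|f k a - f k (b + s)| <= e / 2.
      apply: Hd; rewrite addrAC (le_lt_trans (ler_normD _ _))//.
      by rewrite (splitr d) ltrD.
    have H2 : `|f k a - f k b| <= e / 2 by apply: Hd; rewrite (lt_trans bd)//; lra.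
    have -> : f k (b + s) - f k b = (f k a - f k b) - (f k a - f k (b + s)) by ring.
    by rewrite (le_trans (ler_normB _ _))// (splitr e) lerD.
  have := (compact_near_coveringP B).1 cB R (nbhs (0 : R)) P
    (nbhs_filter (0 : R)) Ploc => near_P.
  apply: (@filterS _ (nbhs (0 : R)) _ _ _ _ near_P) => s Hs a; rewrite addr0; apply: (Hs (sval a)).
  exact/ltW/(svalP a).
suff H j : (j <= k)%N -> Tay j (fun (a : {a : R | `|a - t0| < r}) s => f (k - j)%N (sval a + s)).
  by have := H k (leqnn k); rewrite subnn.
elim: j => [_|j IH jk]; first by rewrite subn0.
have kj : (k - j = (k - j.+1).+1)%N by rewrite -subSn.
apply: (Tay_integral r0 (f' := f (k - j)%N)).
- move=> a s sr; rewrite kj; apply: df; first by rewrite -kj leq_subr.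
  by apply: K => //; exact/ltW/(svalP a).
- by apply: bf; exact: leq_subr.
- exact/IH/ltnW.
Qed.

End TaylorFormula.

(** * Curves in the orbit space *)

Section CubeInvariantPolynomials.
Variable R : realType.

Local Notation x_ := (mpoly.mpolyX R (mpoly.mnm1 i0)).
Local Notation y_ := (mpoly.mpolyX R (mpoly.mnm1 i1)).
Local Notation z_ := (mpoly.mpolyX R (mpoly.mnm1 i2)).

Definition cube_polynomials (i : 'I_4) : mpoly.mpoly 3 R :=
  match val i with
  | 0%N => x_ ^+ 2 + y_ ^+ 2 + z_ ^+ 2
  | 1%N => x_ ^+ 2 * y_ ^+ 2 + y_ ^+ 2 * z_ ^+ 2 + z_ ^+ 2 * x_ ^+ 2
  | 2 => x_ ^+ 2 * y_ ^+ 2 * z_ ^+ 2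
  | _ => x_ * y_ * z_ * (x_ ^+ 2 - y_ ^+ 2) * (y_ ^+ 2 - z_ ^+ 2) *
      (z_ ^+ 2 - x_ ^+ 2)
  end.

Lemma peval_cube_polynomials i u :
  peval (cube_polynomials i) u = cube_invariants i u.
Proof.
move: i; apply: forall_I4; rewrite /cube_polynomials /cube_invariants /= /peval;
  rewrite !(mpoly.mevalD, mpoly.mevalN, mpoly.mevalM, rmorphXn) /= ?mpoly.mevalXU -?expr2.
all: by [].
Qed.

End CubeInvariantPolynomials.

Section Final.
Variable R : realType.

Lemma Tay_meval X k m (q : mpoly.mpoly m R) (c : X -> R -> 'cV[R]_m) :
  (forall i, Tay k (fun x s => c x s i 0)) ->
  Tay k (fun x s => mpoly.meval (fun i => c x s i 0) q).
Proof.
move=> Tc.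
have Tprod (r : seq 'I_m) (e : 'I_m -> nat) :
    Tay k (fun x s => \prod_(i <- r) c x s i 0 ^+ e i).
  elim: r => [|i r IH].
    apply: (@Tay_ext _ _ _ (fun _ _ => 1)); last exact: Tay_num.
    by move=> x s; rewrite big_nil.
  apply: (@Tay_ext _ _ _ (fun x s => c x s i 0 ^+ e i * \prod_(i <- r) c x s i 0 ^+ e i)).
    by move=> x s; rewrite big_cons.
  by apply: TayM => //; apply: TayX.
apply: (@Tay_ext _ _ _ (fun x s => \sum_(n <- mpoly.msupp q)
  mpoly.mcoeff n q * \prod_i c x s i 0 ^+ n i)).
  by move=> x s; rewrite mpoly.mevalE.
elim: (mpoly.msupp q) => [|n r IH].
  apply: (@Tay_ext _ _ _ (fun _ _ => 0)); last exact: Tay_num.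
  by move=> x s; rewrite big_nil.
apply: (@Tay_ext _ _ _ (fun x s => mpoly.mcoeff n q * \prod_i c x s i 0 ^+ n i +
  \sum_(n <- r) mpoly.mcoeff n q * \prod_i c x s i 0 ^+ n i)).
  by move=> x s; rewrite big_cons.
by apply: TayD => //; apply: TayM; [exact: Tay_num | exact: Tprod].
Qed.

Lemma has_derivative_is_derive (U : normedModType R) (f : R -> U) (t : R) (w : U) :
  (forall e : R, 0 < e ->
    \forall s \near (0 : R), `|f (t + s) - (f t + s *: w)| <= e * `|s|) ->
  is_derive t 1 f w.
Proof.
move=> Df.
have L : h^-1 *: (f (h *: 1 + t) - f t) @[h --> 0^'] --> w.
  apply/cvgrPdist_le => e e0; near=> h.
  have h0 : h != 0 by near: h; exact: nbhs_dnbhs_neq.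
  have Dh : `|f (t + h) - (f t + h *: w)| <= e * `|h|.
    by near: h; apply: nbhs_dnbhs; exact: Df.
  have -> : w - h^-1 *: (f (h *: 1 + t) - f t) =
      - (h^-1 *: (f (t + h) - (f t + h *: w))).
    rewrite -[h *: 1]/(h * 1) mulr1 (addrC h t) (opprD (f t)) (addrA (f (t + h))).
    by rewrite [in RHS]scalerBr scalerA mulVf// scale1r opprB.
  rewrite normrN normrZ normfV ler_pdivrMl ?normr_gt0//.
  by rewrite mulrC.
apply: DeriveDef; first by apply/cvg_ex; exists w.
exact: cvg_lim L.
Unshelve. all: by end_near. Qed.

Lemma Ck_on_coord k m (I : set R) (c : R -> 'cV[R]_m) (i : 'I_m)
    (f := fun j t => derive1n j c t i 0) : Ck_on k I c ->
  (forall j t, (j < k)%N -> I t -> is_derive t 1 (f j) (f j.+1 t)) /\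
  (forall j t, (j <= k)%N -> I t -> {for t, continuous (f j)}).
Proof.
move=> [dc cc]; split=> j t jk It.
  have djc := dc j t jk It.
  have := djc; rewrite derivable_mxP => /(_ i 0) dji.
  apply: DeriveDef => //; rewrite /f derive1nS derive1E derive_mx//.
  by rewrite mxE.
have := cc j t jk It => cj.
exact: (@continuous_comp _ _ _ (derive1n j c) (fun M : 'cV[R]_m => M i 0) t cj
  (@coord_continuous _ _ _ _ _ _)).
Qed.

End Final.

Theorem mainTheorem12 (R : realType) : property_B 9 (cube_rotations R).
Proof.
move=> m s [sW _ sgen]; pose W := cube_rotations R.
have GG : isometry_group W := cube_rotations_isometry_group R.
(* The invariants being homogeneous, the result near 0 is no easier than the
   global one. *)
exists (range (orbit_map s)); split => //.
  by rewrite /within /=; apply: (@filterE _ (nbhs (0 : 'cV[R]_m))).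
move=> I c oI _ Ck cU t0 It0.
(* The preimages [v t] are arbitrary and depend on [t] without any regularity. *)
have /choice[v vc] : forall t, exists v, I t -> orbit_map s v = c t.
  move=> t; have [It|nIt] := pselect (I t); last by exists 0.
  by have [v _ vE] := cU t It; exists v.
have /choice[q qE] : forall i, exists q : mpoly.mpoly m R,
    cube_polynomials R i = mpoly.comp_mpoly s q.
  move=> i; apply: sgen => A u WA; rewrite !peval_cube_polynomials.
  have [H2 H4 H6 H9] := cube_rotation_invariants u WA.
  by move: i; apply: forall_I4.
have invE i t : I t -> cube_invariants i (v t) = mpoly.meval (fun j => c t j 0) (q i).
  move=> It; rewrite -peval_cube_polynomials qE /peval mpoly.comp_mpoly_meval.
  by apply: mpoly.meval_eq => j; rewrite -(vc t It) mxE.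
(* The family consists of the curve seen from each point near [t0]. *)
have [d d0 Id] := open_near oI It0.
pose r := d / 3; have r0 : 0 < r by rewrite divr_gt0.
have Ir t : `|t - t0| <= r + r -> I t.
  move=> tr; rewrite -(subrK t0 t) addrC; apply: Id.
  by apply: (le_lt_trans tr); rewrite /r; lra.
pose X := {a : R | `|a - t0| < r}.
have Tc i : Tay 9 (fun (a : X) s => c (sval a + s) i 0).
  have [df cf] := Ck_on_coord i Ck.
  exact: (Tay_of_derivatives r0 Ir df cf).
have Tinv i : Tay 9 (fun (a : X) s => cube_invariants i (v (sval a + s))).
  have := Tay_meval (q i) Tc; apply: Tay_eq; apply/unifP; exists r => // s' sr a.
  rewrite invE//; apply: Ir; rewrite addrAC (le_trans (ler_normD _ _))//.
  by rewrite lerD ?ltW//; exact: (svalP a).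
have [C HC] := cube_families (leqnn 9) Tinv.
pose J := [set t : R | `|t - t0| < r].
have oJ : open J by exact: open_ball_norm.
have JI : J `<=` I by move=> t Jt; apply: Ir; rewrite ltW// (lt_trans Jt)// ltrDl.
have Dv t : J t -> exists w, orbit_derivative W (fun s => v (t + s)) w.
  by move=> Jt; have [w _ Dw] := HC (exist _ t Jt); exists w.
have [f Lf] := differentiable_selection GG oJ Dv.
have Df t : J t -> exists w, is_derive t 1 f w /\ `|w| <= C.
  move=> Jt; have [_ [w Dw]] := Lf t Jt; exists w; split.
    exact: has_derivative_is_derive.
  (* The derivative of [f] at [t] is the image of the orbit derivative [b] under
     an element of the group. *)
  have [b bC Db] := HC (exist _ t Jt).
  have [Wf _ WM WV _] := GG.
  have [|g [Wg _ ->]] := @selection_derivative R 3 W f t (v t) b w Wf _ Dw.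
    move=> e e0; have [d' d'0 Hd'] := open_near oJ Jt.
    have /near0P[d2 d20 Hd2] := Db e e0.
    apply/near0P; exists (Num.min d' d2); first by rewrite lt_min d'0.
    move=> s'; rewrite lt_min => /andP[s'd s'd2].
    have [g Wg gP] := Hd2 s' s'd2; rewrite /= addr0 in gP.
    have [[h Wh ->] _] := Lf (t + s') (Hd' s' s'd).
    exists (h *m g); first exact: WM.
    by rewrite -mulmxA -mulmxBr (isometry_group_norm _ GG Wh).
  by rewrite (isometry_group_norm _ GG Wg).
exists J, f; split.
  split=> //; first by rewrite /J /= subrr normr0.
  move=> t Jt; have [[g Wg ->] _] := Lf t Jt; rewrite -(vc t (JI t Jt)).
  by apply/colP => i; rewrite !mxE sW.
split; first by move=> t /Df[w [[]]].
move=> K _ KJ; exists C => t /KJ/Df[w [[_ Dw] wC]].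
by rewrite derive1E Dw.
Qed.
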